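(* Let $g\ge2$. Then $MG_g$ is a deformation retract of $MG_g^{\neq2}$.
   Context: Graphs are finite, connected, without legs, possibly with multiple edges and tadpoles. A weighted graph is a graph $G$ with vertex set $V_G$, edge set $E_G$, loop number $h_G=\dim H_1(G;\mathbb Q)$ and a map $w:V_G\to\{0,1,2,\dots\}$; its genus is $h_G+\sum_v w(v)$. A vertex $v$ is stable if $2w(v)+\mathrm{val}(v)>2$, and $G$ is stable if all its vertices are. For $\gamma\subset G$ given by a set of edges, $G/\gamma$ collapses each connected component of $\gamma$ to a vertex, whose weight is the loop number of that component plus the sum of the weights of its vertices. Isomorphisms of weighted graphs preserve weights. For a weighted graph $G$ with at least one edge let $\Delta_G=\{x\in\mathbb R_{\ge0}^{E_G}:\sum_e x_e=1\}$. The moduli space of graphs $MG_g$ is the quotient of the disjoint union of $\Delta_G$ over all stable weighted graphs $G$ of genus $g$ (with at least one edge), under the identifications of the face $\{x_e=0\ \forall e\in E_\gamma\}\subset\Delta_G$ with $\Delta_{G/\gamma}$ (for proper edge subsets $\gamma$), and of $x$ with $x\circ\varphi$ for isomorphisms $\varphi$ of weighted graphs. The space $MG_g^{\neq2}$ is defined by the same construction (with the colimit/quotient topology), using all weighted graphs of genus $g$ in which every vertex is either stable or a bivalent vertex of weight $0$, and in which at least one vertex is stable. $MG_g$ is the subspace of $MG_g^{\neq2}$ given by the stable graphs. *)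

(* Defs.v *)
From HB Require Import structures.
From Stdlib Require Import Relation_Operators.
From mathcomp Require Import all_boot all_order all_algebra.
From mathcomp Require Import all_classical all_reals all_analysis.
Set Implicit Arguments.
Unset Strict Implicit.
Unset Printing Implicit Defensive.
Import GRing.Theory Num.Theory numFieldNormedType.Exports.
Local Open Scope ring_scope.

(* Multiple edges and tadpoles (esrc e = etgt e) are allowed.  The orientation
   of an edge is an auxiliary choice, ignored by isomorphisms. *)
Record wgraph (V E : finType) := WGraph {
  esrc : E -> V;
  etgt : E -> V;
  weight : V -> nat
}.

Section WeightedGraph.
Variables (V E : finType) (G : wgraph V E).

Definition valency (v : V) : nat :=
  (\sum_(e : E) ((esrc G e == v) + (etgt G e == v)))%N.

Definition stable_vertex (v : V) : bool := (2 < 2 * weight G v + valency v)%N.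

Definition bivalent0 (v : V) : bool := (valency v == 2)%N && (weight G v == 0)%N.

Definition adj (gam : {set E}) : rel V := fun u v =>
  [exists e in gam, ((esrc G e == u) && (etgt G e == v))
                 || ((esrc G e == v) && (etgt G e == u))].

(* The components of the subgraph with all the vertices of G and edge set gam;
   a vertex meeting no edge of gam is a component by itself. *)
Definition component (gam : {set E}) (v : V) : {set V} :=
  [set u | connect (adj gam) v u].

Definition components (gam : {set E}) : {set {set V}} :=
  [set component gam v | v in V].

Definition connected_graph : bool := (#|components [set: E]| == 1)%N.

(* The simplicial boundary Q^gam -> Q^V, acting on row vectors. *)
Definition boundary (gam : {set E}) : 'M[rat]_(#|gam|, #|V|) :=
  \matrix_(i, j) ((etgt G (enum_val i) == enum_val j)%:R
                - (esrc G (enum_val i) == enum_val j)%:R).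

(* dim H_1(gam; Q): a graph has no 2-cells, so H_1 is the space of 1-cycles. *)
Definition loop_number (gam : {set E}) : nat := \rank (kermx (boundary gam)).

Definition genus : nat :=
  (loop_number [set: E] + \sum_(v : V) weight G v)%N.

Lemma component_in (gam : {set E}) (v : V) :
  component gam v \in components gam.
Proof. exact: imset_f. Qed.

Definition contract_vertex (gam : {set E}) (v : V) :
  {C : {set V} | C \in components gam} := 
  exist (fun C : {set V} => C \in components gam) _ (component_in gam v).

(* G / gam *)
Definition contract (gam : {set E}) :
    wgraph {C : {set V} | C \in components gam} {e : E | e \notin gam} :=
  {| esrc := fun e => contract_vertex gam (esrc G (sval e));
     etgt := fun e => contract_vertex gam (etgt G (sval e));
     weight := fun C => (loop_number [set e in gam | esrc G e \in sval C]
                         + \sum_(v in sval C) weight G v)%N |}.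

End WeightedGraph.

Definition isomorphism (V E V' E' : finType) (G : wgraph V E)
    (G' : wgraph V' E') (fV : V -> V') (fE : E -> E') : Prop :=
  [/\ bijective fV, bijective fE,
      forall e, [set esrc G' (fE e); etgt G' (fE e)]
                = [set fV (esrc G e); fV (etgt G e)]
    & forall v, weight G' (fV v) = weight G v].

(* The small collection of graphs over which the disjoint union is taken: it
   contains every finite weighted graph up to isomorphism. *)
Record graph := Graph {
  nvert : nat;
  nedge : nat;
  wgraph_of :> wgraph 'I_nvert 'I_nedge
}.
HB.instance Definition _ := gen_eqMixin graph.
HB.instance Definition _ := gen_choiceMixin graph.

Local Open Scope classical_set_scope.

Definition stable_graphs (g : nat) : set graph :=
  [set G | [/\ (0 < nedge G)%N, connected_graph G, genus G = g
             & forall v, stable_vertex G v]].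

Definition neq2_graphs (g : nat) : set graph :=
  [set G | [/\ (0 < nedge G)%N, connected_graph G, genus G = g,
               forall v, stable_vertex G v || bivalent0 G v
             & exists v, stable_vertex G v]].

Lemma stable_neq2 (g : nat) : stable_graphs g `<=` neq2_graphs g.
Proof.
move=> G [e0 Gc Gg Gs]; split=> // [v|]; first by rewrite Gs.
by exists (esrc G (Ordinal e0)).
Qed.

Section GluedSpace.
Variable R : realType.

(* Delta_G *)
Definition simplex (G : graph) : set 'rV[R]_(nedge G) :=
  [set x | (forall e, 0 <= x ord0 e) /\ \sum_e x ord0 e = 1].

Arguments simplex : clear implicits.

Section Class.
Variable K : set graph.

Definition disjoint_simplices : Type := {G : K & simplex (sval G)}.
HB.instance Definition _ := Topological.on disjoint_simplices.

Definition dgraph (p : disjoint_simplices) : graph := sval (projT1 p).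

Definition coord (p : disjoint_simplices) (e : 'I_(nedge (dgraph p))) : R :=
  (sval (projT2 p) : 'rV[R]_(nedge (dgraph p))) ord0 e.
Arguments coord : clear implicits.

Definition iso_glue (p q : disjoint_simplices) : Prop :=
  exists fV fE, isomorphism (dgraph p) (dgraph q) fV fE
    /\ forall e, coord p e = coord q (fE e).

(* q is the point of Delta_(G / gam) corresponding to the point p of the face
   x_gam = 0 of Delta_G, G / gam being represented by an isomorphic graph. *)
Definition face_glue (p q : disjoint_simplices) : Prop :=
  exists gam : {set 'I_(nedge (dgraph p))},
    [/\ gam \proper [set: 'I_(nedge (dgraph p))]%SET,
        forall e, e \in gam -> coord p e = 0
      & exists fV fE, isomorphism (dgraph q) (contract (dgraph p) gam) fV fE
          /\ forall e, coord q e = coord p (sval (fE e))].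

Definition glue_step (p q : disjoint_simplices) : Prop :=
  iso_glue p q \/ face_glue p q.

Definition glue (p q : disjoint_simplices) : bool :=
  `[< clos_refl_sym_trans disjoint_simplices glue_step p q >].

Lemma glue_refl : reflexive glue.
Proof. by move=> p; apply/asboolP; exact: rst_refl. Qed.

Lemma glue_sym : symmetric glue.
Proof.
by move=> p q; apply/asboolP/asboolP => ?; exact: rst_sym.
Qed.

Lemma glue_trans : transitive glue.
Proof.
by move=> q p r /asboolP pq /asboolP qr; apply/asboolP; exact: rst_trans pq qr.
Qed.

Canonical glue_equiv := EquivRel glue glue_refl glue_sym glue_trans.

Local Open Scope quotient_scope.

Definition glued_space := {eq_quot glue_equiv}.
HB.instance Definition _ :=
  Topological.copy glued_space (quotient_topology glued_space).
HB.instance Definition _ := Quotient.on glued_space.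

Definition glued_pi (p : disjoint_simplices) : glued_space := \pi_glued_space p.

Lemma glued_piP (p q : disjoint_simplices) :
  glued_pi p = glued_pi q <->
  clos_refl_sym_trans disjoint_simplices glue_step p q.
Proof.
split=> [h|h]; last by apply/eqmodP; exact/asboolP.
by apply/asboolP; move/eqmodP: h.
Qed.

End Class.

Section Inclusion.
Variables (K L : set graph) (KL : K `<=` L).

Definition widen_graph (G : K) : L :=
  exist (fun G => G \in L) (sval G) (mem_set (KL (set_mem (svalP G)))).

Definition widen_point (p : disjoint_simplices K) : disjoint_simplices L :=
  existT (fun G : L => simplex (sval G)) (widen_graph (projT1 p)) (projT2 p).

Definition glued_incl (x : glued_space K) : glued_space L :=
  glued_pi (widen_point (repr x)).

Lemma glued_inclE (p : disjoint_simplices K) :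
  glued_incl (glued_pi p) = glued_pi (widen_point p).
Proof.
have /glued_piP : glued_pi (repr (glued_pi p)) = glued_pi p by exact: reprK.
rewrite /glued_incl; move: (repr _) => p' pp'; apply/glued_piP.
elim: pp' => [q r [h|h]|q|q r _ ih|q r s _ ih1 _ ih2].
- by apply: rst_step; left.
- by apply: rst_step; right.
- exact: rst_refl.
- exact: rst_sym.
- exact: rst_trans ih1 ih2.
Qed.

End Inclusion.

Definition MG (g : nat) := glued_space (stable_graphs g).
HB.instance Definition _ (g : nat) := Topological.on (MG g).

Definition MG_neq2 (g : nat) := glued_space (neq2_graphs g).
HB.instance Definition _ (g : nat) := Topological.on (MG_neq2 g).

Definition MG_incl (g : nat) : MG g -> MG_neq2 g := glued_incl (@stable_neq2 g).

Definition embedding (A X : topologicalType) (i : A -> X) : Prop :=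
  [/\ continuous i, injective i
    & forall U : set A, open U -> exists2 W : set X, open W & U = i @^-1` W].

(* A homotopy relative to A, over the unit interval, from the identity of X to
   a map with values in A. *)
Definition deformation_retract (X : topologicalType) (A : set X) : Prop :=
  exists h : X * R -> X,
    [/\ {within [set: X] `*` `[0, 1]%classic, continuous h},
        forall x, h (x, 0) = x,
        forall x, A (h (x, 1))
      & forall a t, A a -> 0 <= t <= 1 -> h (a, t) = a].

End GluedSpace.

Arguments simplex R G : clear implicits.
Arguments coord R K p e : clear implicits.
Arguments MG_incl R g x : clear implicits.

(* Main.v *)
(* A point of MG_g^{<> 2} is a point of MG_g together with a finite set of
   marked points on each edge, the vertices of weight 0 and valency 2; a mark
   that reaches an end of its edge, or another mark, disappears, because edges
   of length 0 are contracted.  The marks have to be removed continuously and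
   compatibly with the reversal of the edges.  Scaling them towards an end does
   not work, since a mark that has reached an end must not move any more.

   Gluing the ends of an edge of length L to a marked base point, consider the
   loop p |-> {p} of finite subsets of the circle R/LZ.  It is homotopic to the
   loop running once backwards and then twice forwards.  As sets do not count
   multiplicities, the latter is also the union of two loops of degree 0, both
   running once backwards and then, one after the other, once forwards.  Loops
   of degree 0 are contractible.  Applying this null-homotopy to all the marks
   of an edge, and adding the mirror images, gives a homotopy which respects
   reversal and is constant when there are no marks.

   To define it on graphs, the stable graph B underlying G and the chains of
   edges of G replacing the edges of B are shown to exist, to be unique up to
   isomorphism, and to be compatible with contractions.  Stability and weights
   are followed through 2 w(v) + val(v) - 2, which is additive on the vertices
   identified by a contraction. *)

Require Import Defs.
From Stdlib Require Import Relation_Operators.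
From mathcomp Require Import all_boot all_order all_algebra.
From mathcomp Require Import all_classical all_reals all_analysis.
From mathcomp Require Import zify ring lra.
Set Implicit Arguments.
Unset Strict Implicit.
Unset Printing Implicit Defensive.
Import Order.TTheory GRing.Theory Num.Theory numFieldNormedType.Exports.

Local Notation contract := Defs.contract.
Local Notation coord := Defs.coord.
Local Notation glue := Defs.glue.

(** * Contractions and the excess of a vertex *)

(** On the simplex of one graph each mark becomes four points, two from the null-homotopy and two
    mirror images. The moved point therefore stays in the simplex of one fixed subdivision, and
    continuity is that of finitely many coordinates. The number of marks changes on passing to a
    face. There the argument rests on one fact: two points over the same stable graph are glued as
    soon as, on every edge, the positions of the vertices, both ends included, agree as sets. A
    motion of marks descends to the quotient once it depends on these sets only, and for this it
    suffices that a mark at an end is sent to ends. The loop of degree 1 cannot be shrunk by itself,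
    so the homotopy has two stages: the first deforms a loop of degree 1 into another one, the
    second shrinks two loops of degree 0 to the end [L]. The stages fit together only as sets of
    points, and only up to the ends. *)

Lemma big_sig (T : Type) (idx : T) (op : Monoid.com_law idx) (I : finType)
    (P : pred I) (F : I -> T) :
  \big[op/idx]_(i | P i) F i = \big[op/idx]_(x : {i | P i}) F (sval x).
Proof.
rewrite (reindex_omap (sval : {i | P i} -> I) insub) /=; last first.
  by move=> i Pi; rewrite insubT.
by apply: eq_bigl => -[i Pi] /=; rewrite Pi insubT /= eqxx.
Qed.

Section Connect.
Variable T : finType.

Lemma connect_closed_pred (e : rel T) (P : pred T) x y :
  P x -> (forall u v, P u -> e u v -> P v) -> connect e x y -> P y.
Proof.
move=> Px Pe /connectP[p]; elim: p x Px => [|z p IH] x Px /= => [_ -> //|].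
by case/andP=> xz pz; apply: IH pz; apply: Pe xz.
Qed.

Lemma connect_homo (T' : finType) (e : rel T) (e' : rel T') (q : T -> T') :
  (forall x y, e x y -> connect e' (q x) (q y)) ->
  forall x y, connect e x y -> connect e' (q x) (q y).
Proof.
move=> ee' x y; apply: (@connect_closed_pred _ (fun y => connect e' (q x) (q y))).
  exact: connect0.
by move=> u v xu /ee'; apply: connect_trans xu.
Qed.

End Connect.

Section Graph.
Variables (V E : finType) (G : wgraph V E).
Implicit Types (v : V) (e : E) (gam : {set E}).
Local Notation dart := (E * bool)%type.

(* The dart [(e, false)] runs along [e], and [(e, true)] against it. *)
Definition dtail (d : dart) : V := if d.2 then etgt G d.1 else esrc G d.1.
Definition dhead (d : dart) : V := if d.2 then esrc G d.1 else etgt G d.1.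

(* [stable_vertex G v] reads [2 < excess v]. *)
Definition excess v : nat := (2 * weight G v + valency G v)%N.

End Graph.

Section GraphTheory.
Variables (V E : finType) (G : wgraph V E).
Implicit Types (v : V) (e : E) (gam : {set E}).
Local Notation dart := (E * bool)%type.
Local Notation dtail := (dtail G).
Local Notation dhead := (dhead G).

Lemma adj_sym gam : symmetric (adj G gam).
Proof. by move=> u v; apply: eq_existsb => e; rewrite orbC. Qed.

Lemma adj_connect_sym gam : connect_sym (adj G gam).
Proof. exact/sym_connect_sym/adj_sym. Qed.

Lemma adj_edge gam e : e \in gam -> adj G gam (esrc G e) (etgt G e).
Proof. by move=> ge; apply/existsP; exists e; rewrite ge !eqxx. Qed.

Lemma adjP gam u v : adj G gam u v ->
  exists2 d : dart, d.1 \in gam & dtail d = u /\ dhead d = v.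
Proof.
case/existsP=> e /andP[ge /orP[]] /andP[/eqP <- /eqP <-].
  by exists (e, false).
by exists (e, true).
Qed.

Lemma adj_dart gam (d : dart) : d.1 \in gam -> adj G gam (dtail d) (dhead d).
Proof.
by case: d => e [] /= /adj_edge; rewrite /dtail /dhead //= adj_sym.
Qed.

Lemma connect_constant (T : Type) gam (rho : V -> T) :
  (forall e, e \in gam -> rho (esrc G e) = rho (etgt G e)) ->
  forall u v, connect (adj G gam) u v -> rho u = rho v.
Proof.
move=> rhoE u v /connectP[p]; elim: p u => [|w p IH] u /= => [_ -> //|].
case/andP=> /adjP[[e b] ge [<- <-]] /IH h /h <-.
by have := rhoE _ ge; case: b {ge h}; rewrite /dtail /dhead.
Qed.

Lemma mem_component gam u v : (u \in component G gam v) = connect (adj G gam) v u.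
Proof. by rewrite inE. Qed.

Lemma eq_component gam u v :
  (component G gam u == component G gam v) = connect (adj G gam) u v.
Proof.
apply/eqP/idP => [uv|uv]; first by rewrite -mem_component uv mem_component connect0.
apply/setP => w; rewrite !mem_component.
by rewrite (same_connect (@adj_connect_sym gam) uv).
Qed.

Lemma contract_vertex_eq gam u v :
  (contract_vertex G gam u == contract_vertex G gam v)
  = connect (adj G gam) u v.
Proof. by rewrite -val_eqE /= eq_component. Qed.

Lemma contract_vertexE gam v (C : {C : {set V} | C \in components G gam}) :
  (contract_vertex G gam v == C) = (v \in sval C).
Proof.
case: C => C /= CP; rewrite -val_eqE /=.
have [u _ ->] := imsetP CP.
by rewrite eq_component mem_component adj_connect_sym.
Qed.

Lemma contract_vertex_surj gam (C : {C : {set V} | C \in components G gam}) :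
  exists v, C = contract_vertex G gam v.
Proof.
case: C => C CP; have [u _ Cu] := imsetP CP.
by exists u; apply/val_inj.
Qed.

Lemma connected_graphP :
  reflect ((exists v0 : V, True) /\ forall u v, connect (adj G [set: E]) u v)
          (connected_graph G).
Proof.
apply: (iffP idP) => [/cards1P[C CE]|[[v0 _] uv]].
  have /imsetP[v0 _ _] : C \in components G [set: E] by rewrite CE set11.
  split; first by exists v0.
  move=> u v; rewrite -eq_component.
  have h w : component G [set: E] w = C.
    by apply/set1P; rewrite -CE; exact: component_in.
  by rewrite !h.
apply/cards1P; exists (component G [set: E] v0); apply/setP => C.
rewrite inE; apply/imsetP/eqP => [[u _ ->]|->]; last by exists v0.
by apply/eqP; rewrite eq_component.
Qed.

Lemma sum_valency : (\sum_v valency G v = 2 * #|E|)%N.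
Proof.
rewrite /valency exchange_big /= mul2n -addnn -sum1_card -big_split /=.
apply: eq_bigr => e _; rewrite big_split /=.
have h (w : V) : (\sum_v (w == v) = 1)%N.
  rewrite (bigD1 w) //= eqxx big1 // => v; by rewrite eq_sym => /negbTE ->.
by rewrite !h.
Qed.

Lemma dart_ends (d : dart) v :
  ((dtail d == v) + (dhead d == v) = (esrc G d.1 == v) + (etgt G d.1 == v))%N.
Proof. by case: d => e []; rewrite /dtail /dhead //= addnC. Qed.

Lemma valency_card v : valency G v = #|[set d | dtail d == v]|.
Proof.
rewrite -sum1_card (eq_bigl (fun d => dtail d == v)); last by move=> d; rewrite inE.
rewrite big_mkcond /= -(pair_big xpredT xpredT
  (fun (e : E) (b : bool) => if dtail (e, b) == v then 1 else 0)%N) /=.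
apply: eq_bigr => e _; rewrite big_bool /dtail /= addnC.
by congr (_ + _)%N; case: eqP.
Qed.

Lemma valency2_darts v (d1 d2 d3 : dart) : valency G v = 2 ->
  dtail d1 = v -> dtail d2 = v -> dtail d3 = v -> d1 != d2 ->
  d3 = d1 \/ d3 = d2.
Proof.
rewrite valency_card => v2 t1 t2 t3 d12.
have s12 : [set d1; d2] \subset [set d | dtail d == v].
  by apply/fintype.subsetP => d; rewrite !inE => /orP[] /eqP ->; apply/eqP.
have /eqP h : [set d1; d2] == [set d | dtail d == v].
  by rewrite eqEcard s12 v2 cards2 d12.
have : d3 \in [set d | dtail d == v] by rewrite inE t3.
by rewrite -h !inE => /orP[] /eqP; [left|right].
Qed.

(** The row space is spanned by the differences [dl v - dl u0] for [v] in [C] other than [u0]: rows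
    add up along paths of [del] starting at [u0], and conversely every row is a difference of two of
    these vectors. *)
Lemma rank_connected_boundary (C : {set V}) (u0 : V) (del : {set E}) :
  (forall e, e \in del -> esrc G e \in C /\ etgt G e \in C) ->
  u0 \in C -> (forall v, v \in C -> connect (adj G del) u0 v) ->
  \rank (boundary G del) = #|C :\ u0|.
Proof.
move=> delC u0C u0conn; set A := boundary G del.
pose dl (v : V) : 'rV[rat]_#|V| := delta_mx ord0 (enum_rank v).
pose M := (\matrix_(i < #|C :\ u0|) (dl (enum_val i) - dl u0))%R.
have dlE v (j : 'I_#|V|) : (dl v ord0 j = (v == enum_val j)%:R)%R.
  by rewrite mxE eqxx /= -(inj_eq enum_rank_inj) enum_valK eq_sym.
have MA : (M <= A)%MS.
  apply/row_subP => i; rewrite rowK.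
  have := enum_valP i; rewrite !inE => /andP[_ /u0conn].
  apply: (@connect_closed_pred _ (adj G del) (fun v => (dl v - dl u0)%R <= A)%MS).
    by rewrite subrr sub0mx.
  have rowA e : e \in del -> (dl (etgt G e) - dl (esrc G e) <= A)%MS%R.
    move=> eg; have -> : (dl (etgt G e) - dl (esrc G e)
        = row (enum_rank_in eg e) A)%R.
      by apply/rowP => j; rewrite !mxE -/(dl _) -!dlE !mxE enum_rankK_in.
    exact: row_sub.
  move=> v w vA vw; rewrite -(subrK (dl v) (dl w)) -addrA addmx_sub //.
  case/adjP: vw => -[e b] /rowA; rewrite /dtail /dhead /= => eA [<- <-].
  by case: b; rewrite // -opprB eqmx_opp.
have dM v : v \in C -> (dl v - dl u0 <= M)%MS%R.
  have [->|vu vC] := eqVneq v u0; first by rewrite subrr sub0mx.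
  have vD : v \in C :\ u0 by rewrite !inE vu.
  have -> : (dl v - dl u0 = row (enum_rank_in vD v) M)%R.
    by rewrite rowK enum_rankK_in.
  exact: row_sub.
have AM : (A <= M)%MS.
  apply/row_subP => i; have [sC tC] := delC _ (enum_valP i).
  have -> : (row i A = (dl (etgt G (enum_val i)) - dl u0)
                       - (dl (esrc G (enum_val i)) - dl u0))%R.
    by rewrite opprB addrA subrK; apply/rowP => j; rewrite !mxE -!dlE !mxE.
  by rewrite addmx_sub ?eqmx_opp ?dM.
(* The transposed indicator rows of [C :\ u0] form a right inverse, because they do not see the
   entry at [u0]. *)
have /eqP <- : row_free M.
  apply/row_freeP; exists (\matrix_(i < #|C :\ u0|) dl (enum_val i))^T%R.
  apply/matrixP => i k; rewrite !mxE.
  rewrite (bigD1 (enum_rank (enum_val k))) //= big1 => [|j jk]; last first.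
    by rewrite !mxE eqxx /= (negbTE jk) mulr0.
  have := enum_valP k; rewrite !inE => /andP[/negbTE ku _].
  rewrite !mxE !eqxx /= mulr1 addr0 !(inj_eq enum_rank_inj) ku subr0.
  by rewrite (inj_eq enum_val_inj) eq_sym.
by apply/eqP; rewrite eqn_leq !mxrankS.
Qed.

(** Rank and nullity of the boundary: this is the Euler characteristic of a connected graph, written
    without subtraction. *)
Lemma loop_number_connected (C : {set V}) (u0 : V) (del : {set E}) :
  (forall e, e \in del -> esrc G e \in C /\ etgt G e \in C) ->
  u0 \in C -> (forall v, v \in C -> connect (adj G del) u0 v) ->
  (loop_number G del + #|C| = #|del| + 1)%N.
Proof.
move=> delC u0C u0conn; rewrite /loop_number mxrank_ker.
have rk := rank_connected_boundary delC u0C u0conn.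
rewrite (cardsD1 u0 C) u0C -rk addnCA subnK; first by rewrite addnC.
exact: rank_leq_row.
Qed.

(** Both ends of an edge of [gam] lie in the same component, so it is enough to test the source, and
    a path of [gam] from [v0] only uses edges of [del]. *)
Lemma component_loop_number gam v0 :
  (loop_number G [set e in gam | esrc G e \in component G gam v0]
   + #|component G gam v0|
   = #|[set e in gam | esrc G e \in component G gam v0]| + 1)%N.
Proof.
set del := [set e in gam | _].
have compE e : e \in gam ->
    (esrc G e \in component G gam v0) = (etgt G e \in component G gam v0).
  move=> eg; rewrite !mem_component; apply: same_connect_r.
    exact: adj_connect_sym.
  exact/connect1/adj_edge.
apply: (@loop_number_connected _ v0) => [e||v].
- by rewrite inE => /andP[eg es]; rewrite -compE.
- by rewrite mem_component connect0.
rewrite mem_component => v0v.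
suff /andP[] : (v \in component G gam v0) && connect (adj G del) v0 v by [].
apply: (@connect_closed_pred _ (adj G gam) (fun v =>
  (v \in component G gam v0) && connect (adj G del) v0 v)) v0v.
  by rewrite mem_component !connect0.
move=> u w /andP[uC uconn] /adjP[d dg [du dw]].
have dd : d.1 \in del.
  rewrite inE dg; case: d dg du {dw} => e [] eg /= <- in uC *; last by [].
  by rewrite compE.
have uw : connect (adj G del) u w by rewrite -du -dw; exact/connect1/adj_dart.
rewrite (connect_trans uconn uw) andbT.
move: uC; rewrite !mem_component => uC; apply: connect_trans uC _.
by rewrite -du -dw; exact/connect1/adj_dart.
Qed.

Lemma valency_contract gam (C : {C : {set V} | C \in components G gam}) :
  valency (contract G gam) C
  = (\sum_(e | e \notin gam) ((esrc G e \in sval C) + (etgt G e \in sval C)))%N.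
Proof.
rewrite big_sig /valency; apply: eq_bigr => e _ /=.
by rewrite !contract_vertexE.
Qed.

Lemma sum_indicator (A : {set V}) (w : V) : (\sum_(v in A) (w == v) = (w \in A))%N.
Proof.
have [wA|wA] := boolP (w \in A).
  rewrite (bigD1 w) //= eqxx big1 // => v /andP[_].
  by rewrite eq_sym => /negbTE ->.
by rewrite big1 // => v vA; case: eqP wA vA => // -> /negbTE ->.
Qed.

Lemma sum_set_valency (A : {set V}) :
  (\sum_(v in A) valency G v = \sum_e ((esrc G e \in A) + (etgt G e \in A)))%N.
Proof.
rewrite exchange_big /=; apply: eq_bigr => e _.
by rewrite big_split /= !sum_indicator.
Qed.

(** The quantity [excess - 2] is additive. Contracting a component with [n] edges removes [2 * n]
    from the sum of the valencies, and its loop number [n + 1 - #|C|] enters twice through the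
    weight. *)
Lemma excess_contract gam (C : {C : {set V} | C \in components G gam}) :
  (excess (contract G gam) C + 2 * #|sval C|
   = \sum_(v in sval C) excess G v + 2)%N.
Proof.
have [v0 ->] := contract_vertex_surj C => {C}; set C := component G gam v0.
have -> : (\sum_(v in sval (contract_vertex G gam v0)) excess G v
  = 2 * (\sum_(v in C) weight G v) + \sum_(v in C) valency G v)%N.
  by rewrite big_distrr -big_split.
rewrite /excess valency_contract /= sum_set_valency -/C.
rewrite [in RHS](bigID (mem gam)) /=.
have -> : (\sum_(e in gam) ((esrc G e \in C) + (etgt G e \in C))
    = 2 * #|[set e in gam | esrc G e \in C]|)%N.
  rewrite -sum1_card big_distrr /= big_mkcond [RHS]big_mkcond /=.
  apply: eq_bigr => e _; rewrite inE; have [eg|//] := boolP (e \in gam).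
  have -> : (etgt G e \in C) = (esrc G e \in C).
    rewrite !mem_component; apply/esym; apply: same_connect_r.
      exact: adj_connect_sym.
    exact/connect1/adj_edge.
  by case: (_ \in C).
have := component_loop_number gam v0; rewrite -/C.
set W := (\sum_(v in C) weight G v)%N; set k := loop_number _ _.
set n := #|[set _ in _ | _]|; set S := (\sum_(e | _) _)%N.
by move: k n S #|C| W => k n S c W h; lia.
Qed.

(** In other words, [2 * genus - 2] is the sum of [excess - 2] over the vertices. Invariance of the
    genus under contractions, subdivisions and isomorphisms is thereby reduced to sums over
    vertices. *)
Lemma genus_excess : connected_graph G ->
  (2 * genus G + 2 * #|V| = \sum_v excess G v + 2)%N.
Proof.
case/connected_graphP=> -[v0 _] conn; rewrite /genus.
have -> : (\sum_v excess G v = 2 * (\sum_v weight G v) + 2 * #|E|)%N.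
  by rewrite -sum_valency big_distrr -big_split.
have := @loop_number_connected [set: V] v0 [set: E] (fun e _ => conj (finset.in_setT _) (finset.in_setT _))
  (finset.in_setT _) (fun v _ => conn v0 v).
rewrite !cardsT.
by move: (loop_number _ _) (\sum_v _)%N #|V| #|E| => k W n m; lia.
Qed.

End GraphTheory.

Section Contraction.
Variables (V E : finType) (G : wgraph V E) (gam : {set E}).
Local Notation cvert := {C : {set V} | C \in components G gam}.

Lemma contract_connected : connected_graph G -> connected_graph (contract G gam).
Proof.
case/connected_graphP => -[v0 _] conn.
have h u v : connect (adj (contract G gam) finset.setT) (contract_vertex G gam u)
                     (contract_vertex G gam v).
  move: (conn u v).
  apply: (connect_homo (q := contract_vertex G gam)) => {u v} u v.
  case/adjP=> -[e b] _ [<- <-].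
  have [eg|eg] := boolP (e \in gam).
    suff /eqP -> : contract_vertex G gam (dtail G (e, b))
                == contract_vertex G gam (dhead G (e, b)) by exact: connect0.
    by rewrite contract_vertex_eq; exact/connect1/adj_dart.
  pose e' : {e | e \notin gam} := exist _ e eg.
  have := @adj_dart _ _ (contract G gam) finset.setT (e', b) (finset.in_setT _).
  by rewrite /dtail /dhead /=; case: b => /= ?; apply: connect1.
apply/connected_graphP; split; first by exists (contract_vertex G gam v0).
by move=> C D; have [u ->] := contract_vertex_surj C;
  have [v ->] := contract_vertex_surj D.
Qed.

Lemma sum_contract (F : V -> nat) :
  (\sum_(C : cvert) \sum_(v in sval C) F v
   = \sum_v F v)%N.
Proof.
rewrite (exchange_big_dep xpredT) //=; apply: eq_bigr => v _.
rewrite (bigD1 (contract_vertex G gam v)) /=; last by rewrite mem_component connect0.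
rewrite big1 ?addn0 // => C /andP[vC].
by rewrite eq_sym contract_vertexE vC.
Qed.

Lemma contract_genus : connected_graph G -> genus (contract G gam) = genus G.
Proof.
move=> conn; have h1 := genus_excess conn.
have h2 := genus_excess (contract_connected conn).
have h3 : (\sum_(C : cvert) (excess (contract G gam) C + 2 * #|sval C|)
           = \sum_(C : cvert) (\sum_(v in sval C) excess G v + 2))%N.
  by apply: eq_bigr => C _; rewrite excess_contract.
move: h3; rewrite big_split [in RHS]big_split /= -big_distrr /= sum_contract.
have -> : (\sum_(C : cvert) #|sval C| = #|V|)%N.
  by rewrite -sum1_card -(sum_contract (fun=> 1%N)); apply: eq_bigr => C _; rewrite sum1_card.
have -> : (\sum_(C : cvert) 2 = 2 * #|{: cvert}|)%N.
  by rewrite sum_nat_const mulnC.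
move: h1 h2; set A := (\sum_(v : cvert) _)%N; set B := (\sum_v _)%N.
by move: A B (genus _) (genus _) #|V| #|{: cvert}| => A B p q n m; lia.
Qed.

(** A sum of terms [excess - 2], none of them negative, is positive exactly when one of them is. *)
Lemma contract_nonstable (C : cvert) :
  (forall v, 2 <= excess G v)%N ->
  stable_vertex (contract G gam) C = [exists v in sval C, stable_vertex G v].
Proof.
move=> ex2; have := excess_contract C.
rewrite -[stable_vertex _ C]/(2 < excess _ C)%N.
have [/existsP[v /andP[vC sv]]|ns] := boolP [exists v in sval C, stable_vertex G v].
  have : (\sum_(v in sval C) 2 < \sum_(v in sval C) excess G v)%N.
    rewrite (bigD1 v) //= [in X in (_ < X)%N](bigD1 v) //=.
    rewrite -addSn leq_add //; exact: leq_sum.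
  rewrite sum_nat_const; move: #|_| (\sum_(v in _) _)%N (excess _ _) => n A B.
  by lia.
have -> : (\sum_(v in sval C) excess G v = \sum_(v in sval C) 2)%N.
  apply: eq_bigr => v vC; apply/eqP; rewrite eqn_leq ex2 andbT leqNgt.
  by apply: contra ns => sv; apply/existsP; exists v; rewrite vC.
rewrite sum_nat_const; move: #|_| (excess _ _) => n B.
by lia.
Qed.

End Contraction.

Section Neq2.
Variables (V E : finType) (G : wgraph V E).

Lemma excess_bivalent0 v : bivalent0 G v -> excess G v = 2.
Proof. by rewrite /bivalent0 /excess => /andP[/eqP -> /eqP ->]. Qed.

Lemma excess_ge2 : (forall v, stable_vertex G v || bivalent0 G v) ->
  forall v, (2 <= excess G v)%N.
Proof.
move=> bi v; have /orP[sv|/excess_bivalent0 -> //] := bi v.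
by apply: ltnW; exact: sv.
Qed.

(** A connected graph with an edge has no isolated vertex, and with positive valency an excess of 2
    leaves only valency 2 and weight 0. *)
Lemma bivalent0P v : connected_graph G -> (0 < #|E|)%N -> (2 <= excess G v)%N ->
  stable_vertex G v || bivalent0 G v.
Proof.
move=> /connected_graphP[_ conn] /card_gt0P[e0 _] ex2.
have [//|] := boolP (stable_vertex G v); rewrite -leqNgt => ex2' /=.
have {ex2 ex2'} ex2 : excess G v = 2.
  by apply/eqP; rewrite eqn_leq ex2 andbT; exact: ex2'.
have : (0 < valency G v)%N.
  rewrite valency_card card_gt0; apply/set0Pn.
  have [vs|vs] := eqVneq v (esrc G e0).
    by exists (e0, false); rewrite inE vs.
  have /connectP[[|w p] /=] := conn v (esrc G e0).
    by move=> _ vE; rewrite vE eqxx in vs.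
  by case/andP=> /adjP[d _ [<- _]] _ _; exists d; rewrite inE.
move: ex2; rewrite /bivalent0 /excess.
move: (valency G v) (weight G v) => [|[|[|k]]] [|w] //; lia.
Qed.
End Neq2.

(** * Chains of edges and subdivisions *)

Section Chain.
Variables (V E : finType) (G : wgraph V E) (st : pred V).
Local Notation dart := (E * bool)%type.
Implicit Types (d : dart) (s : seq dart) (u v w : V).

Definition dflip d : dart := (d.1, ~~ d.2).

Definition revchain s : seq dart := rev (map dflip s).

(* A nonempty walk from [u] to [w] meeting [st] at most in its ends. *)
Fixpoint chain u s w : bool :=
  if s is d :: s' then
    (dtail G d == u) &&
    (if s' is [::] then dhead G d == w
     else ~~ st (dhead G d) && chain (dhead G d) s' w)
  else false.

Lemma dflipK : involutive dflip.
Proof. by case=> e b; rewrite /dflip negbK. Qed.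

Lemma dtail_flip d : dtail G (dflip d) = dhead G d.
Proof. by case: d => e []. Qed.

Lemma dhead_flip d : dhead G (dflip d) = dtail G d.
Proof. by case: d => e []. Qed.

Lemma dflip_neq d : dflip d != d.
Proof. by case: d => e []; rewrite /dflip xpair_eqE andbF. Qed.

Lemma eq_dart_edge d d' : d.1 = d'.1 -> d = d' \/ d = dflip d'.
Proof. by case: d d' => e [] [e' []] /= ->; [left|right|right|left]. Qed.

Lemma chain_cat u d s1 s2 w : s2 != [::] ->
  chain u ((d :: s1) ++ s2) w =
  [&& chain u (d :: s1) (dhead G (last d s1)), ~~ st (dhead G (last d s1))
    & chain (dhead G (last d s1)) s2 w].
Proof.
elim: s1 u d => [|d' s1 IH] u d s2N; first by case: s2 s2N => //= ? ? _; rewrite eqxx andbT.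
rewrite -[LHS]/((dtail G d == u) && (~~ st (dhead G d) && chain (dhead G d) ((d' :: s1) ++ s2) w)).
by rewrite IH //= !andbA.
Qed.

Lemma revchain_cons d s : revchain (d :: s) = rcons (revchain s) (dflip d).
Proof. by rewrite /revchain /= rev_cons. Qed.

Lemma revchainK : involutive revchain.
Proof. by move=> s; rewrite /revchain map_rev revK -map_comp map_id_in // => d _; exact: dflipK. Qed.

Lemma map_fst_revchain s : map fst (revchain s) = rev (map fst s).
Proof. by rewrite /revchain map_rev -map_comp. Qed.

Lemma chain_head u s w d : chain u s w -> dtail G (head d s) = u.
Proof. by case: s => //= d' s /andP[/eqP]. Qed.

Lemma chain_neq0 u s w : chain u s w -> s != [::].
Proof. by case: s. Qed.

Lemma chain_last u s w d : chain u s w -> dhead G (last d s) = w.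
Proof.
elim: s u d => [//|a [|b s] IH] u d /= /andP[_]; first by move/eqP.
by case/andP=> _ ch; apply: (IH (dhead G a) a).
Qed.

Lemma chain_revchain u s w : chain u s w -> chain w (revchain s) u.
Proof.
elim: s u => [//|d s IH] u; rewrite revchain_cons.
case: s IH => [_ /= /andP[/eqP <- /eqP <-]|d' s IH].
  by rewrite dtail_flip dhead_flip !eqxx.
case/andP=> /eqP <- /andP[hst /IH {}IH]; rewrite -cats1.
case E': (revchain (d' :: s)) IH => [//|a r] ch; rewrite chain_cat //.
have al : dhead G (last a r) = dhead G d by rewrite -(chain_last a ch).
by rewrite al ch hst /= dtail_flip dhead_flip !eqxx.
Qed.

(** The interior vertices of a chain lie outside [st], so [x] can be met only at its two ends. *)
Lemma chain_degree u s w x : chain u s w -> st x ->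
  (\sum_(d <- s) ((dtail G d == x) + (dhead G d == x)) = (u == x) + (w == x))%N.
Proof.
move=> + stx; elim: s u => [//|d s IH] u.
case: s IH => [_ /= /andP[/eqP <- /eqP <-]|d' s IH]; first by rewrite big_seq1.
case/andP=> /eqP <- /andP[hst /IH {}IH]; rewrite big_cons {}IH.
have /negbTE -> : dhead G d != x by apply: contraNneq hst => ->.
by rewrite addn0.
Qed.

Lemma chain_interior u d1 s1 d2 s2 w : chain u ((d1 :: s1) ++ d2 :: s2) w ->
  ~~ st (dhead G (last d1 s1)) /\ dtail G d2 = dhead G (last d1 s1).
Proof. by rewrite chain_cat // => /and3P[_ -> /(chain_head d2)]. Qed.

(* At a vertex of valency 2 a walk that does not turn back has only one way
   to go on. *)
Lemma chain_determined u s w u' s' w' d :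
  (forall v, ~~ st v -> valency G v = 2) -> st w -> st w' ->
  chain u (d :: s) w -> chain u' (d :: s') w' ->
  uniq (map fst (d :: s)) -> uniq (map fst (d :: s')) -> s = s'.
Proof.
move=> val2 stw stw'; elim: s d s' u u' => [|a s IH] d [|b s'] u u' //=.
- by move=> /andP[_ /eqP hw] /andP[_ /andP[]]; rewrite hw stw.
- by move=> /andP[_ /andP[hst _]] /andP[_ /eqP hw]; rewrite hw stw' in hst.
move=> /andP[_ /andP[hst cha]] /andP[_ /andP[_ chb]] /andP[da ua] /andP[db ub].
have ta : dtail G a = dhead G d by case/andP: cha => /eqP.
have tb : dtail G b = dhead G d by case/andP: chb => /eqP.
have : b = dflip d \/ b = a.
  apply: (valency2_darts (val2 _ hst) (dtail_flip d) ta tb).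
  by apply: contraNneq da => <-; rewrite mem_head.
case=> [bd|ba]; first by rewrite bd inE /= eqxx in db.
by subst b; congr (_ :: _); exact: (IH a _ _ _ cha chb ua ub).
Qed.

End Chain.

Section Subdivision.
Variables (VB EB : finType) (B : wgraph VB EB).
Variables (V E : finType) (G : wgraph V E) (st : pred V).
Variables (f : VB -> V) (c : EB -> seq (E * bool)).
Local Notation dart := (E * bool)%type.

(* [G] is obtained from [B], up to weights, by replacing each edge [b] by the
   walk [c b]; the new vertices are those outside [st]. *)
Record subdivision : Prop := Subdivision {
  sub_inj : injective f;
  sub_st : forall v, st (f v);
  sub_img : forall u, st u -> exists v, u = f v;
  sub_chain : forall b, chain G st (f (esrc B b)) (c b) (f (etgt B b));
  sub_count : forall e, (\sum_b count (fun d => d.1 == e) (c b) = 1)%N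
}.

Hypothesis sub : subdivision.

Lemma sub_perm :
  perm_eq [seq d.1 | b <- index_enum EB, d <- c b] (index_enum E).
Proof.
apply/allP => e _; apply/eqP; rewrite /= [in RHS]count_uniq_mem ?index_enum_uniq //.
rewrite mem_index_enum -[RHS](sub_count sub e) count_flatten -map_comp sumnE big_map.
by apply: eq_bigr => b _; rewrite /= count_map.
Qed.

Lemma sub_big (T : Type) (idx : T) (op : Monoid.com_law idx) (F : E -> T) :
  \big[op/idx]_b \big[op/idx]_(d <- c b) F d.1 = \big[op/idx]_e F e.
Proof. by rewrite -(perm_big _ sub_perm) big_allpairs_dep. Qed.

Lemma sub_edge e : exists b, exists2 d, d \in c b & d.1 = e.
Proof.
have : e \in [seq d.1 | b <- index_enum EB, d <- c b].
  by rewrite (perm_mem sub_perm) mem_index_enum.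
by case/allpairsPdep => b [d [_ db ->]]; exists b, d.
Qed.

Lemma sub_uniq b : uniq (map fst (c b)).
Proof.
rewrite -(map_inj_uniq (f := id)) // map_id.
have := index_enum_uniq E; rewrite -(perm_uniq sub_perm).
have /path.splitPr [s1 s2] := mem_index_enum b.
by rewrite map_cat flatten_cat /= !cat_uniq => /and3P[_ _ /and3P[]].
Qed.

Lemma sub_edge_uniq b b' d d' : d \in c b -> d' \in c b' -> d.1 = d'.1 -> b = b'.
Proof.
move=> db db' dd'; apply/eqP; apply: contraT => bb'.
have := sub_count sub d.1; rewrite (bigD1 b) //= (bigD1 b') //=; last by rewrite eq_sym.
have h (a : dart) s : a \in s -> (0 < count (fun x : dart => x.1 == a.1) s)%N.
  by move=> as_; rewrite -has_count; apply/hasP; exists a.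
have := h _ _ db; have := h _ _ db'; rewrite -dd'.
by move: (count _ _) (count _ _) (\sum_(_ | _) _)%N => x y z; lia.
Qed.

Lemma sub_dart_uniq b b' d d' : d \in c b -> d' \in c b' -> d.1 = d'.1 ->
  b = b' /\ d = d'.
Proof.
move=> db db' dd'; have bb' := sub_edge_uniq db db' dd'; subst b'; split=> //.
have := sub_uniq b; elim: (c b) db db' => [//|a s IH] /=.
rewrite !inE => /orP[/eqP da|ds] /orP[/eqP da'|ds'] /andP[ns us].
- by rewrite da da'.
- by case/negP: ns; rewrite -da dd' map_f.
- by case/negP: ns; rewrite -da' -dd' map_f.
- exact: IH.
Qed.

Lemma sub_valency v : valency G (f v) = valency B v.
Proof.
rewrite /valency -(sub_big _ (fun e => (esrc G e == f v) + (etgt G e == f v))%N).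
apply: eq_bigr => b _.
rewrite (eq_bigr (fun d => (dtail G d == f v) + (dhead G d == f v))%N); last first.
  by move=> d _; rewrite dart_ends.
rewrite (chain_degree (sub_chain sub b) (sub_st sub v)).
by rewrite !(inj_eq (sub_inj sub)).
Qed.

End Subdivision.

Lemma chain_ends (V E : finType) (G : wgraph V E) (st : pred V) u s w u' w' :
  chain G st u s w -> chain G st u' s w' -> u = u' /\ w = w'.
Proof.
case: s => [//|d s] ch ch'; split.
  by rewrite -(chain_head d ch) (chain_head d ch').
by rewrite -(chain_last d ch) (chain_last d ch').
Qed.

Section SubdivisionUnique.
Variables (V E : finType) (G : wgraph V E) (st : pred V).
Hypothesis val2 : forall v, ~~ st v -> valency G v = 2.

(** The tail of [d] is in [st], hence not interior to [t], so [d] is the first dart of [t]; from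
    there on the walk is forced. *)
Lemma chain_through u w d s u' w' t :
  st u -> st w -> st w' -> chain G st u (d :: s) w -> chain G st u' t w' ->
  uniq (map fst (d :: s)) -> uniq (map fst t) -> d \in t -> t = d :: s.
Proof.
move=> stu stw stw' ch ch' us ut dt.
case/path.splitPr: dt ch' ut => [[|a t1] t2] ch' ut.
  congr (_ :: _); apply/esym.
  exact: (chain_determined (G := G) (st := st) val2 stw stw' ch ch' us ut).
have [] := chain_interior ch'.
by move=> + ta; rewrite -ta; case/andP: ch => /eqP ->; rewrite stu.
Qed.

Variables (VB EB : finType) (B : wgraph VB EB).
Variables (f : VB -> V) (c : EB -> seq (E * bool)).
Variables (VB' EB' : finType) (B' : wgraph VB' EB').
Variables (f' : VB' -> V) (c' : EB' -> seq (E * bool)).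
Hypotheses (sub : subdivision B G st f c) (sub' : subdivision B' G st f' c').

(** Take the chain of [c'] through the first edge of [c b]. It traverses this edge in one of two
    directions, and in the second case it is reversed before [chain_through] applies. *)
Lemma sub_match b : exists b' o, c' b' = if o then revchain (c b) else c b.
Proof.
have := sub_chain sub b; have := sub_uniq sub b.
case cb: (c b) => [//|d s] us ch.
have [b' [d' db' dd']] := sub_edge sub' d.1; exists b'.
have ch' := sub_chain sub' b'; have us' := sub_uniq sub' b'.
case: (eq_dart_edge dd') => dE.
  exists false; rewrite dE in db'.
  by apply: (chain_through _ _ _ ch ch' us us' db'); rewrite ?(sub_st sub) ?(sub_st sub').
exists true; apply: (can_inj (@revchainK E)); rewrite revchainK.
apply: (chain_through _ _ _ ch (chain_revchain ch') us).
- exact: (sub_st sub).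
- exact: (sub_st sub).
- exact: (sub_st sub').
- by rewrite map_fst_revchain rev_uniq.
- by rewrite mem_rev; apply/mapP; exists d'; rewrite // dE dflipK.
Qed.

End SubdivisionUnique.

Lemma sub_match_inj (V E : finType) (G : wgraph V E) (st : pred V)
  (VB EB : finType) (B : wgraph VB EB) (f : VB -> V) (c : EB -> seq (E * bool))
  (EB' : finType) (c' : EB' -> seq (E * bool)) (h : EB -> EB') (o : EB -> bool) :
  subdivision B G st f c ->
  (forall b, c' (h b) = if o b then revchain (c b) else c b) -> injective h.
Proof.
move=> sub hE b1 b2 h12.
have := sub_chain sub b1; case cb: (c b1) => [//|d s] _.
have mem b : map fst (c' (h b)) =i map fst (c b).
  by move=> e; rewrite hE; case: (o b); rewrite ?map_fst_revchain ?mem_rev.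
have : d.1 \in map fst (c b2) by rewrite -mem -h12 mem cb mem_head.
case/mapP => d' db2 dd'; apply: (sub_edge_uniq sub _ db2 dd').
by rewrite cb mem_head.
Qed.

Definition oriented_iso (VB EB VB' EB' : finType) (B : wgraph VB EB)
    (B' : wgraph VB' EB') (fV : VB -> VB') (fE : EB -> EB') (o : EB -> bool) : Prop :=
  [/\ bijective fV, bijective fE,
      forall b k, dtail B' (fE b, k) = fV (dtail B (b, k (+) o b))
    & forall v, weight B' (fV v) = weight B v].

(** The chains are determined by [G] and [st] up to reversal. Matching them in both directions gives
    injections between finite sets of edges, hence bijections; [o] records the reversals. *)
Lemma sub_unique (V E : finType) (G : wgraph V E) (st : pred V)
  (VB EB : finType) (B : wgraph VB EB) (f : VB -> V) (c : EB -> seq (E * bool))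
  (VB' EB' : finType) (B' : wgraph VB' EB') (f' : VB' -> V) (c' : EB' -> seq (E * bool)) :
  (forall v, ~~ st v -> valency G v = 2) ->
  subdivision B G st f c -> subdivision B' G st f' c' ->
  (forall v, weight G (f v) = weight B v) ->
  (forall v, weight G (f' v) = weight B' v) ->
  exists fV fE o, [/\ oriented_iso B B' fV fE o, forall v, f' (fV v) = f v
    & forall b, c' (fE b) = if o b then revchain (c b) else c b].
Proof.
move=> val2 sub sub' wB wB'.
have /choice[fV fVE] : forall v, exists v', f' v' = f v.
  by move=> v; have [v' ->] := sub_img sub' (sub_st sub v); exists v'.
have /choice[fV' fVE'] : forall v', exists v, f v = f' v'.
  by move=> v'; have [v ->] := sub_img sub (sub_st sub' v'); exists v.
have /choice[fEo fEoE] : forall b, exists b'o : EB' * bool,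
    c' b'o.1 = if b'o.2 then revchain (c b) else c b.
  by move=> b; have [b' [r rE]] := sub_match val2 sub sub' b; exists (b', r).
have /choice[fEo' fEoE'] : forall b', exists bo : EB * bool,
    c bo.1 = if bo.2 then revchain (c' b') else c' b'.
  by move=> b'; have [b [r rE]] := sub_match val2 sub' sub b'; exists (b, r).
have injE : injective (fun b => (fEo b).1).
  exact: (sub_match_inj (o := fun b => (fEo b).2) sub).
have injE' : injective (fun b => (fEo' b).1).
  exact: (sub_match_inj (o := fun b => (fEo' b).2) sub').
exists fV, (fun b => (fEo b).1), (fun b => (fEo b).2); split=> //; split.
- by exists fV' => v; [apply: (sub_inj sub)|apply: (sub_inj sub')]; rewrite ?fVE' ?fVE // fVE'.
- by apply: inj_card_bij => //; exact: leq_card injE'.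
- move=> b k; apply: (sub_inj sub'); rewrite fVE.
  have := sub_chain sub' (fEo b).1; have := sub_chain sub b; rewrite fEoE.
  case: (fEo b).2 => [/chain_revchain|] ch /(chain_ends ch)[u w].
    by case: k; rewrite /dtail /= -?u -?w.
  by case: k; rewrite /dtail /= -?u -?w.
- by move=> v; rewrite -wB' fVE wB.
Qed.

Lemma chain_join (V E : finType) (G : wgraph V E) (st : pred V) u s v t w :
  chain G st u s v -> ~~ st v -> chain G st v t w -> chain G st u (s ++ t) w.
Proof.
case: s => [//|d s] ch hst ch'; rewrite chain_cat ?(chain_neq0 ch') //.
by move: (chain_last d ch) => /= ->; apply/and3P.
Qed.

Section SubdivisionComp.
Variables (VB EB V1 E1 V2 E2 : finType).
Variables (B : wgraph VB EB) (G1 : wgraph V1 E1) (G2 : wgraph V2 E2).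
Variables (st1 : pred V1) (st2 : pred V2) (st : pred V2).
Variables (f1 : VB -> V1) (c1 : EB -> seq (E1 * bool)).
Variables (f2 : V1 -> V2) (c2 : E1 -> seq (E2 * bool)).
Hypotheses (sub1 : subdivision B G1 st1 f1 c1) (sub2 : subdivision G1 G2 st2 f2 c2).
Hypotheses (st_st1 : forall v, st (f2 v) = st1 v) (st_st2 : forall u, st u -> st2 u).

Definition expand_dart (d : E1 * bool) : seq (E2 * bool) :=
  if d.2 then revchain (c2 d.1) else c2 d.1.

Lemma chain_weaken u s w : chain G2 st2 u s w -> chain G2 st u s w.
Proof.
elim: s u => [//|d s IH] u /= /andP[->]; case: s IH => [//|a s] IH /=.
by case/andP=> h /IH h2; apply/andP; split; [exact: contra (@st_st2 _) h|].
Qed.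

Lemma chain_expand_dart d :
  chain G2 st (f2 (dtail G1 d)) (expand_dart d) (f2 (dhead G1 d)).
Proof.
apply: chain_weaken; have := sub_chain sub2 d.1.
by case: d => e []; rewrite /expand_dart /dtail /dhead //= => /chain_revchain.
Qed.

Lemma chain_expand u s w : chain G1 st1 u s w ->
  chain G2 st (f2 u) (flatten [seq expand_dart d | d <- s]) (f2 w).
Proof.
elim: s u => [//|d s IH] u; have chd := chain_expand_dart d.
case: s IH => [_ /= /andP[/eqP <- /eqP <-]|a s IH]; first by rewrite cats0.
case/andP=> /eqP <- /andP[hst ch].
rewrite [flatten _]/(expand_dart d ++ flatten [seq expand_dart i | i <- a :: s]).
apply: chain_join chd _ (IH _ ch).
by rewrite st_st1.
Qed.

(** A vertex interior to a composite chain arises in one of two ways: inside an expanded dart, where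
    [st_st2] excludes it from [st], or between two expanded darts, where [st_st1] does. *)
Lemma sub_comp : subdivision B G2 st (f2 \o f1)
  (fun b => flatten [seq expand_dart d | d <- c1 b]).
Proof.
split.
- exact: inj_comp (sub_inj sub2) (sub_inj sub1).
- by move=> v; rewrite /= st_st1 (sub_st sub1).
- move=> u stu; have [v uE] := sub_img sub2 (st_st2 stu); subst u.
  by rewrite st_st1 in stu; have [w ->] := sub_img sub1 stu; exists w.
- by move=> b; apply: chain_expand; exact: sub_chain.
move=> e; rewrite -(sub_count sub2 e) -(sub_big sub1 _ (fun x => count _ (c2 x))).
apply: eq_bigr => b _; rewrite count_flatten -map_comp sumnE big_map.
apply: eq_bigr => -[e1 k] _; rewrite /expand_dart /=; case: k => //=.
rewrite -!(count_map fst (pred1 e)) map_fst_revchain.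
exact/permP/permEl/perm_rev.
Qed.

End SubdivisionComp.

(** * Suppression of a bivalent vertex, and existence of the underlying stable graph *)

Section Suppression.
Variables (V E : finType) (G : wgraph V E) (u0 : V) (d1 d2 : E * bool).
Hypotheses (val_u0 : valency G u0 = 2) (t1 : dtail G d1 = u0) (t2 : dtail G d2 = u0).
Hypothesis e12 : d1.1 != d2.1.
Local Notation V' := {v : V | v != u0}.
Local Notation E' := {e : E | e != d2.1}.

Lemma suppress_tail d : dtail G d = u0 -> d = d1 \/ d = d2.
Proof.
move=> td; apply: (valency2_darts val_u0 t1 t2 td).
by apply: contraNneq e12 => ->.
Qed.

Lemma suppress_head1 : dhead G d1 != u0.
Proof.
apply/eqP; rewrite -dtail_flip => /suppress_tail[h|h].
  by have := dflip_neq d1; rewrite h eqxx.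
by move: e12; rewrite -h eqxx.
Qed.

Lemma suppress_head2 : dhead G d2 != u0.
Proof.
apply/eqP; rewrite -dtail_flip => /suppress_tail[h|h].
  by move: e12; rewrite -h eqxx.
by have := dflip_neq d2; rewrite h eqxx.
Qed.

(* The edge of [d1] is kept to stand for the union of the two edges at [u0],
   and runs from the head of [d2] to the head of [d1]. *)
Definition suppress_end (e : E') (k : bool) : V :=
  if sval e == d1.1 then dhead G (if k then d1 else d2) else dtail G (sval e, k).

Lemma suppress_endP e k : suppress_end e k != u0.
Proof.
rewrite /suppress_end; have [_|/eqP ne1] := eqVneq (sval e) d1.1.
  by case: k; [exact: suppress_head1|exact: suppress_head2].
apply/eqP => /suppress_tail[h|h]; first by apply: ne1; rewrite -h.
by have /eqP := svalP e; apply; exact: (congr1 fst h).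
Qed.

Definition suppress : wgraph V' E' :=
  {| esrc := fun e => exist _ (suppress_end e false) (suppress_endP e false);
     etgt := fun e => exist _ (suppress_end e true) (suppress_endP e true);
     weight := fun v => weight G (sval v) |}.

Definition suppress_chain (e : E') : seq (E * bool) :=
  if sval e == d1.1 then [:: dflip d2; d1] else [:: (sval e, false)].

Lemma suppress_sub :
  subdivision suppress G (fun v => v != u0) sval suppress_chain.
Proof.
split; first exact: val_inj.
- exact: svalP.
- by move=> u uu0; exists (exist _ u uu0).
- move=> e; rewrite /suppress_chain /= /suppress_end; case: eqP => _ /=.
    by rewrite dtail_flip dhead_flip t2 t1 !eqxx.
  by rewrite !eqxx.
move=> e.
have e1P : d1.1 != d2.1 by [].
(* The edge of [G] given by [d2] lies on the chain of the merged edge, which is named after [d1];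
   every other edge lies on its own chain. *)
pose e' : E' := if @idP (e != d2.1) is ReflectT h then exist _ e h else exist _ d1.1 e1P.
have e'E : sval e' = if e == d2.1 then d1.1 else e.
  by rewrite /e'; case: {-}_ / idP => /= [/negbTE ->//|/negP]; rewrite negbK => ->.
rewrite (bigD1 e') //= big1 ?addn0.
  rewrite /suppress_chain e'E; have [->|ne2] := eqVneq e d2.1.
    by rewrite eqxx /= eqxx (negbTE e12).
  have [e1|ne1] := eqVneq e d1.1; last by rewrite /= eqxx.
  by rewrite /= eq_sym (negbTE ne2) e1 eqxx.
move=> a; rewrite -val_eqE /= e'E /suppress_chain => ae.
have a2 := svalP a; apply/eqP; rewrite -leqn0 leqNgt -has_count -all_predC.
have [a1|a1] := eqVneq (sval a) d1.1; rewrite /= !andbT.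
  rewrite a1 in ae; apply/andP; split.
    by apply: contraNneq ae => <-; rewrite eqxx.
  by apply: contraNneq ae => <-; rewrite (negbTE e12).
by apply: contraNneq ae => h; rewrite -h (negbTE a2) eqxx.
Qed.

Lemma suppress_valency v : valency suppress v = valency G (sval v).
Proof. by rewrite -(sub_valency suppress_sub). Qed.

Lemma suppress_connected : connected_graph G -> connected_graph suppress.
Proof.
case/connected_graphP=> _ conn.
pose v0 : V' := exist (fun v => v != u0) _ suppress_head1.
(* [q] pushes [u0] along [d1]: the edge of [d1] collapses, and the edge of [d2] turns into the
   merged edge. *)
pose q v : V' := insubd v0 v.
have qE (v : V') : q (sval v) = v by exact: valKd.
have sup (e : E') k (u w : V') : sval u = suppress_end e k -> sval w = suppress_end e (~~ k) ->
    connect (adj suppress finset.setT) u w.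
  move=> ue we; have := @adj_dart _ _ suppress finset.setT (e, k) (finset.in_setT _).
  suff [-> ->] : dtail suppress (e, k) = u /\ dhead suppress (e, k) = w by exact: connect1.
  by case: k ue we => ue we; split; apply/val_inj.
have csym := adj_connect_sym suppress finset.setT.
have q0 : q u0 = v0 by rewrite /q /insubd insubF //= eqxx.
have qv u : u != u0 -> sval (q u) = u by move=> uu0; rewrite /q insubdK.
have step2 : connect (adj suppress finset.setT) (q (dtail G d2)) (q (dhead G d2)).
  rewrite t2 q0; apply: (sup (exist (fun e => e != d2.1) _ e12) true).
    by rewrite /suppress_end /= eqxx.
  by rewrite qv ?suppress_head2 // /suppress_end /= eqxx.
have step1 : connect (adj suppress finset.setT) (q (dtail G d1)) (q (dhead G d1)).
  by rewrite t1 q0 -(qE v0) connect0.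
have step d : connect (adj suppress finset.setT) (q (dtail G d)) (q (dhead G d)).
  have [/eq_dart_edge[]->|n2] := eqVneq d.1 d2.1; first exact: step2.
    by rewrite dtail_flip dhead_flip csym.
  have [/eq_dart_edge[]->|n1] := eqVneq d.1 d1.1; first exact: step1.
    by rewrite dtail_flip dhead_flip csym.
  have tu a : a.1 = d.1 -> dtail G a != u0.
    by move=> ad; apply/eqP => /suppress_tail[] h; move: n1 n2; rewrite -ad h eqxx.
  apply: (sup (exist (fun e => e != d2.1) d.1 n2) d.2); rewrite qv ?tu // /suppress_end /= ?(negbTE n1).
  - by case: (d).
  - by rewrite -dtail_flip.
  - by rewrite -dtail_flip tu.
apply/connected_graphP; split; first by exists v0.
move=> u v; rewrite -[u]qE -[v]qE; move: (conn (sval u) (sval v)).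
apply: (connect_homo (q := q)) => {u v} u v /adjP[d _ [<- <-]]; exact: step.
Qed.

End Suppression.

Lemma connected_loop (V E : finType) (G : wgraph V E) (u0 v : V) :
  connected_graph G -> (forall d, dtail G d = u0 -> dhead G d = u0) -> v = u0.
Proof.
case/connected_graphP => _ conn loop; apply/eqP.
apply: (@connect_closed_pred _ _ (fun v => v == u0) u0 v (eqxx _) _ (conn u0 v)).
by move=> x y /eqP -> /adjP[d _ [td <-]]; rewrite (loop d td).
Qed.

(** Induction on the number of vertices that are not stable. Suppressing one of them keeps the
    valencies and weights of all the others, hence their stability. *)
Lemma subdivision_exists (V E : finType) (G : wgraph V E) : connected_graph G ->
  (forall v, stable_vertex G v || bivalent0 G v) -> (exists v, stable_vertex G v) ->
  exists (VB EB : finType) (B : wgraph VB EB) f c,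
    [/\ subdivision B G (stable_vertex G) f c,
        forall v, weight G (f v) = weight B v & connected_graph B].
Proof.
have [n] := ubnP #|[pred v | ~~ stable_vertex G v]|.
elim: n V E G => [//|n IH] V E G ltn conn bi [vs vsP].
have [/existsP[u0 uns]|] := boolP [exists u, ~~ stable_vertex G u]; last first.
  rewrite negb_exists => /forallP st.
  exists V, E, G, id, (fun e => [:: (e, false)]); split=> //; split=> //.
  - by move=> v; move: (st v); rewrite negbK.
  - by move=> u _; exists u.
  - by move=> b; rewrite /= !eqxx.
  move=> e; rewrite (bigD1 e) //= eqxx big1 // => a /negbTE ae.
  by rewrite /= ae.
have val0 : valency G u0 = 2.
  by have := bi u0; rewrite (negbTE uns) => /andP[/eqP].
have : #|[set d | dtail G d == u0]| == 2 by rewrite -valency_card val0.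
case/cards2P => d1 [d2 [d12 dE]].
have [t1 t2] : dtail G d1 = u0 /\ dtail G d2 = u0.
  have h d : d \in [set d1; d2] -> dtail G d = u0 by rewrite -dE inE => /eqP.
  by split; apply: h; rewrite !inE eqxx ?orbT.
have e12 : d1.1 != d2.1.
  (* If both darts at [u0] came from the same edge, it would be a tadpole and [u0] the only vertex
     of the connected graph; the stable vertex [vs] excludes this. *)
  apply: contraTneq (vsP) => /eq_dart_edge[h|h]; first by rewrite h eqxx in d12.
  suff -> : vs = u0 by [].
  apply: (connected_loop _ conn) => d td.
  have [->|->] := valency2_darts val0 t1 t2 td d12.
    by rewrite h dhead_flip.
  by rewrite -(dflipK d2) -h dhead_flip.
pose G' := suppress val0 t1 t2 e12.
have sub' := suppress_sub val0 t1 t2 e12.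
have stE v : stable_vertex G (sval v) = stable_vertex G' v.
  by rewrite /stable_vertex suppress_valency.
have biE v : bivalent0 G (sval v) = bivalent0 G' v.
  by rewrite /bivalent0 suppress_valency.
have [||||VB [EB [B [f [c [sub w connB]]]]]] := IH _ _ G'.
- rewrite -ltnS; apply: leq_ltn_trans ltn; rewrite -(fintype.card_image val_inj).
  apply/proper_card/fintype.properP; split.
    by apply/fintype.subsetP => _ /fintype.imageP[v vns ->]; rewrite inE stE.
  exists u0; first by rewrite inE.
  by apply/negP => /fintype.imageP[v _ uv]; have := svalP v; rewrite -[sval v]uv eqxx.
- exact: suppress_connected.
- by move=> v; rewrite -stE -biE.
- have vu : vs != u0 by apply: contraNneq uns => <-.
  by exists (exist (fun v => v != u0) vs vu); rewrite -stE.
exists VB, EB, B, (sval \o f), (fun b => flatten [seq expand_dart (suppress_chain d1 (d2:=d2)) d | d <- c b]).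
split=> //; apply: (sub_comp sub sub') => // u su.
by apply: contraTneq su => ->.
Qed.

Lemma inj_surj_bij (T T' : finType) (h : T -> T') :
  injective h -> (forall y, exists x, h x = y) -> bijective h.
Proof. by move=> hI /choice[k hk]; exists k => // x; apply: hI; rewrite hk. Qed.

Section ChainPositions.
Variables (V E : finType) (G : wgraph V E) (st : pred V) (d0 : E * bool).

Lemma chain_positions (p : nat -> V) s : s != [::] ->
  (forall i, i < size s -> dtail G (nth d0 s i) = p i /\ dhead G (nth d0 s i) = p i.+1)%N ->
  (forall i, 0 < i < size s -> ~~ st (p i))%N ->
  chain G st (p 0%N) s (p (size s)).
Proof.
elim: s p => [//|d s IH] p _ ends int; have [/= -> hd] := ends 0%N isT.
rewrite eqxx; case: s IH ends int => [|a s] IH ends int; first by rewrite hd eqxx.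
rewrite hd int //=; apply: (IH (fun i => p i.+1)) => // i /= ilt.
  exact: (ends i.+1).
by apply: (int i.+1); case/andP: ilt => _ ilt.
Qed.

Lemma chain_nth u s w i : chain G st u s w -> (i.+1 < size s)%N ->
  dtail G (nth d0 s i.+1) = dhead G (nth d0 s i) /\ ~~ st (dhead G (nth d0 s i)).
Proof.
elim: s u i => [//|d [//|a s] IH] u [|i] /= /andP[_ /andP[hst ch]].
  by case/andP: ch => /eqP.
exact: (IH _ i ch).
Qed.

Lemma chain_nth0 u s w : chain G st u s w -> dtail G (nth d0 s 0) = u.
Proof. by rewrite nth0; exact: chain_head. Qed.

Lemma chain_nth_last u s w : chain G st u s w -> dhead G (nth d0 s (size s).-1) = w.
Proof. by rewrite nth_last; exact: chain_last. Qed.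

End ChainPositions.

(** * The standard subdivision with prescribed numbers of new vertices *)

Section Subdivide.
Variables (VB EB : finType) (B : wgraph VB EB) (n : EB -> nat).
Local Notation SV := (VB + {b : EB & 'I_(n b)})%type.
Local Notation SE := {b : EB & 'I_(n b).+1}.
Local Notation inner b i := (existT (fun b => 'I_(n b)) b i).
Local Notation segment b i := (existT (fun b => 'I_(n b).+1) b i).

(* The [j]-th vertex met along [b]; the last one is the [n b + 1]-st. *)
Definition subdivide_pos (b : EB) (j : nat) : SV :=
  if j is i.+1 then
    if insub i : option 'I_(n b) is Some i' then inr (inner b i') else inl (etgt B b)
  else inl (esrc B b).

(** An explicit model: by [sub_isomorphism] every subdivision of [B] whose chains have [n b + 1]
    edges, whose new vertices are bivalent of weight 0 and whose old vertices keep their weights is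
    isomorphic to it. *)
Definition subdivide : wgraph SV SE :=
  {| esrc := fun e : SE => subdivide_pos (tag e) (tagged e);
     etgt := fun e : SE => subdivide_pos (tag e) (tagged e).+1;
     weight := fun v : SV => if v is inl v then weight B v else 0%N |}.

Definition is_old (v : SV) : bool := if v is inl _ then true else false.

Definition subdivide_chain (b : EB) : seq (SE * bool) :=
  [seq (segment b i, false) | i <- enum 'I_(n b).+1].

Lemma subdivide_pos_inner b (i : 'I_(n b)) :
  subdivide_pos b i.+1 = inr (inner b i).
Proof. by rewrite /subdivide_pos insubT //= => h; congr (inr (existT _ _ _)); apply/val_inj. Qed.

Lemma subdivide_pos_last b : subdivide_pos b (n b).+1 = inl (etgt B b).
Proof. by rewrite /subdivide_pos insubF ?ltnn. Qed.

Lemma subdivide_posP b j (x : {b : EB & 'I_(n b)}) :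
  (subdivide_pos b j == inr x) = (b == tag x) && (j == (tagged x).+1).
Proof.
case: x => b' i' /=; apply/eqP/andP => [|[/eqP bb' /eqP ->]].
  case: j => [//|j] /=; case: insubP => [i _ ij [bb']|//].
  subst b' => /eqP; rewrite eq_Tagged => /eqP ii; split=> //.
  by rewrite -ij -ii.
by subst b'; rewrite subdivide_pos_inner.
Qed.

Lemma size_subdivide_chain b : size (subdivide_chain b) = (n b).+1.
Proof. by rewrite size_map size_enum_ord. Qed.

Lemma nth_subdivide_chain d0 b (i : 'I_(n b).+1) :
  nth d0 (subdivide_chain b) i = (segment b i, false).
Proof. by rewrite (nth_map i) ?size_enum_ord // nth_ord_enum. Qed.

Lemma subdivide_sub : subdivision B subdivide is_old inl subdivide_chain.
Proof.
split=> //; first by move=> u v [].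
- by case=> // v _; exists v.
- move=> b; have d0 : SE * bool := (segment b ord0, false) .
  have := @chain_positions _ _ subdivide is_old (segment b ord0, false) (subdivide_pos b) (subdivide_chain b).
  rewrite size_subdivide_chain subdivide_pos_last; apply.
  + by rewrite -size_eq0 size_subdivide_chain.
  + by move=> i ilt; rewrite (nth_subdivide_chain _ (Ordinal ilt)).
  + move=> [//|i] /andP[_ ilt].
    by rewrite (@subdivide_pos_inner b (Ordinal (ilt : (i < n b)%N))).
case=> b i; rewrite (bigD1 b) //= big1 ?addn0.
  rewrite count_map -(@eq_count _ (pred1 i)); last first.
    by move=> j /=; rewrite eq_Tagged.
  by rewrite (count_uniq_mem _ (enum_uniq _)) mem_enum.
move=> b' bb'; apply/eqP; rewrite -leqn0 leqNgt -has_count has_map; apply/hasPn => j _ /=.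
by apply: contraNneq bb' => /(congr1 tag) /= ->.
Qed.

Lemma subdivide_valency_old v : valency subdivide (inl v) = valency B v.
Proof. by rewrite -(sub_valency subdivide_sub). Qed.

Lemma subdivide_valency_new x : valency subdivide (inr x) = 2.
Proof.
case: x => b i; rewrite valency_card.
pose e (k : 'I_(n b).+1) : SE := segment b k.
(* The two darts leaving the inner vertex are the next segment forwards and the preceding segment
   backwards. *)
have -> : [set d | dtail subdivide d == inr (existT _ b i)]
    = [set (e (lift ord0 i), false); (e (widen_ord (leqnSn _) i), true)].
  apply/setP => -[[b' j] k]; rewrite !inE !xpair_eqE.
  have -> : dtail subdivide (existT _ b' j, k) = subdivide_pos b' (if k then j.+1 else j).
    by case: k.
  rewrite subdivide_posP /=; have [bb'|bb'] := eqVneq b' b; last first.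
    have h a : (existT _ b' j == e a) = false.
      by apply/negP => /eqP /(congr1 tag) /= h; rewrite h eqxx in bb'.
    by rewrite !h.
  subst b'; rewrite !eq_Tagged /= -!val_eqE /=; rewrite /bump leq0n add1n.
  by case: k; rewrite !(andbT, andbF, orbF) // eqSS.
by rewrite cards2 xpair_eqE andbF.
Qed.

Lemma subdivide_bivalent x : bivalent0 subdivide (inr x).
Proof. by rewrite /bivalent0 subdivide_valency_new. Qed.

Lemma subdivide_stable_old v : stable_vertex subdivide (inl v) = stable_vertex B v.
Proof. by rewrite /stable_vertex subdivide_valency_old. Qed.

Lemma subdivide_stable_new x : stable_vertex subdivide (inr x) = false.
Proof. by rewrite /stable_vertex subdivide_valency_new. Qed.

Lemma subdivide_connect b j : (j <= (n b).+1)%N ->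
  connect (adj subdivide finset.setT) (inl (esrc B b)) (subdivide_pos b j).
Proof.
elim: j => [|j IH] jlt; first exact: connect0.
apply: connect_trans (IH (ltnW jlt)) _; apply: connect1.
pose e : SE := segment b (Ordinal (jlt : (j < (n b).+1)%N)).
exact: (@adj_edge _ _ subdivide finset.setT e (finset.in_setT e)).
Qed.

Lemma subdivide_connected : connected_graph B -> connected_graph subdivide.
Proof.
case/connected_graphP => -[v0 _] conn; apply/connected_graphP.
split; first by exists (inl v0).
have csym := @adj_connect_sym _ _ subdivide finset.setT.
have old v : connect (adj subdivide finset.setT) (inl v0) (inl v).
  apply: (@connect_homo _ _ (adj B finset.setT) _ inl) (conn v0 v) => {}u {}v.
  case/adjP=> -[b k] _ [<- <-].
  have := subdivide_connect (leqnn (n b).+1); rewrite subdivide_pos_last.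
  by case: k; rewrite /dtail /dhead //= csym.
have all v : connect (adj subdivide finset.setT) (inl v0) v.
  case: v => [//|[b i]]; apply: connect_trans (old (esrc B b)) _.
  by rewrite -[inr _](subdivide_pos_inner i) subdivide_connect // ltnS ltnW.
by move=> u v; apply: connect_trans (all v); rewrite csym.
Qed.

(** A new vertex has excess 2, so it contributes nothing to [2 * genus - 2]. *)
Lemma subdivide_genus : connected_graph B -> genus subdivide = genus B.
Proof.
move=> conn; have := genus_excess conn.
have := genus_excess (subdivide_connected conn).
rewrite big_sumType card_sum /=.
have -> : (\sum_v excess subdivide (inl v) = \sum_v excess B v)%N.
  by apply: eq_bigr => v _; rewrite /excess subdivide_valency_old.
have -> : (\sum_x excess subdivide (inr x) = 2 * #|{: {b : EB & 'I_(n b)}}|)%N.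
  under eq_bigr do rewrite (excess_bivalent0 (subdivide_bivalent _)).
  by rewrite sum_nat_const mulnC.
move: (genus _) (genus _) (\sum_v _)%N #|VB| #|{: {b : EB & 'I_(n b)}}| => a b d k m.
by lia.
Qed.

End Subdivide.

Section SubdivisionIso.
Variables (VB EB : finType) (B : wgraph VB EB) (n : EB -> nat).
Variables (V E : finType) (G : wgraph V E) (st : pred V).
Variables (f : VB -> V) (c : EB -> seq (E * bool)) (d0 : E * bool).
Hypotheses (bi : forall v, ~~ st v -> bivalent0 G v) (sub : subdivision B G st f c).
Hypothesis size_c : forall b, size (c b) = (n b).+1.
Local Notation SV := (VB + {b : EB & 'I_(n b)})%type.
Local Notation SE := {b : EB & 'I_(n b).+1}.
Local Notation segment b i := (existT (fun b => 'I_(n b).+1) b i).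

Definition sub_dart b i : E * bool := nth d0 (c b) i.

Definition sub_vertex (v : SV) : V :=
  match v with
  | inl v => f v
  | inr (existT b i) => dhead G (sub_dart b i)
  end.

Definition sub_segment (e : SE) : E := (sub_dart (tag e) (tagged e)).1.

Lemma sub_dart_in b i : (i < (n b).+1)%N -> sub_dart b i \in c b.
Proof. by move=> ilt; rewrite mem_nth // size_c. Qed.

Lemma sub_dart_inj b i b' i' : (i < (n b).+1)%N -> (i' < (n b').+1)%N ->
  (sub_dart b i).1 = (sub_dart b' i').1 -> b = b' /\ i = i'.
Proof.
move=> ilt ilt' eqd.
have [bb' dd'] := sub_dart_uniq sub (sub_dart_in ilt) (sub_dart_in ilt') eqd.
subst b'; split=> //; apply/eqP; rewrite -(nth_uniq d0 _ _ (map_uniq (sub_uniq sub b))) ?size_c //.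
by rewrite /sub_dart in dd'; rewrite dd'.
Qed.

Lemma sub_vertex_pos b j :
  sub_vertex (subdivide_pos B n b j.+1) = dhead G (sub_dart b (minn j (n b))).
Proof.
have [jlt|jge] := ltnP j (n b).
  by rewrite (@subdivide_pos_inner _ _ B n b (Ordinal jlt)).
rewrite /subdivide_pos insubF ?ltnNge ?jge //=.
by rewrite -(chain_nth_last d0 (sub_chain sub b)) size_c.
Qed.

Lemma sub_dart_tail b j : (j < (n b).+1)%N ->
  dtail G (sub_dart b j) = sub_vertex (subdivide_pos B n b j).
Proof.
case: j => [|j] jlt; first exact: (chain_nth0 d0 (sub_chain sub b)).
have [] := chain_nth d0 (sub_chain sub b) (i := j); first by rewrite size_c.
by move=> th _; rewrite [LHS]th sub_vertex_pos (minn_idPl (ltnW (jlt : (j < n b)%N))).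
Qed.

Lemma sub_dart_head b j : (j < (n b).+1)%N ->
  dhead G (sub_dart b j) = sub_vertex (subdivide_pos B n b j.+1).
Proof. by move=> jlt; rewrite sub_vertex_pos (minn_idPl (jlt : (j <= n b)%N)). Qed.

Lemma sub_inner_nonst b (i : 'I_(n b)) : ~~ st (dhead G (sub_dart b i)).
Proof.
have [] // := chain_nth d0 (sub_chain sub b) (i := i).
by rewrite size_c ltnS.
Qed.

Lemma sub_vertex_inj : injective sub_vertex.
Proof.
have old_new v b (i : 'I_(n b)) : f v <> dhead G (sub_dart b i).
  by move=> h; have := sub_inner_nonst i; rewrite -h (sub_st sub).
move=> [v|[b i]] [v'|[b' i']] //=.
- by move/(sub_inj sub) ->.
- by move/old_new.
- by move=> h; case: (old_new _ _ _ (esym h)).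
move=> hh; have ib := sub_inner_nonst i.
have ilt := ltn_ord i; have ilt' := ltn_ord i'.
have [th _] := chain_nth d0 (sub_chain sub b) (i := i)
  (eq_ind_r (fun m => (_ < m)%N) (ilt : (i.+1 < (n b).+1)%N) (size_c b)).
have /andP[/eqP val2 _] := bi ib.
have d12 : dflip (sub_dart b i) != sub_dart b i.+1.
  apply/eqP => /(congr1 fst) /= e12.
  have [_ /eqP] := @sub_dart_inj b i b i.+1 (ltnW ilt) ilt e12.
  by rewrite ltn_eqF.
(* Three darts leave the common vertex: dart [i] of [b] backwards, dart [i + 1] of [b], and dart
   [i'] of [b'] backwards. Valency 2 makes the third equal to one of the others. Equality with the
   second is impossible, since one edge would be traversed by the chains in both directions. *)
have := valency2_darts val2 (dtail_flip G _) th (etrans (dtail_flip G _) (esym hh)) d12.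
case=> [/(can_inj (@dflipK E)) /(congr1 fst) dd|dd].
  have [bb' ii'] := @sub_dart_inj b' i' b i (ltnW ilt') (ltnW ilt) dd; subst b'.
  by congr (inr (existT _ _ _)); apply/val_inj.
have [_ e] := sub_dart_uniq sub (@sub_dart_in b' i' (ltnW ilt')) (@sub_dart_in b i.+1 ilt) (congr1 fst dd).
by have /eqP := dflip_neq (sub_dart b' i'); case; rewrite dd e.
Qed.

Lemma sub_vertex_surj u : exists v, sub_vertex v = u.
Proof.
have [stu|nst] := boolP (st u).
  by have [v ->] := sub_img sub stu; exists (inl v).
have /andP[/eqP val2 _] := bi nst.
have : (0 < valency G u)%N by rewrite val2.
rewrite valency_card card_gt0 => /set0Pn[d]; rewrite inE => /eqP td.
have [b [d' db dd']] := sub_edge sub d.1.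
have ilt : (index d' (c b) < (n b).+1)%N by rewrite -size_c index_mem.
have d'E : d' = sub_dart b (index d' (c b)) by rewrite /sub_dart nth_index.
case: (eq_dart_edge (esym dd')) => dE.
  by exists (subdivide_pos B n b (index d' (c b))); rewrite -sub_dart_tail // -d'E -dE.
exists (subdivide_pos B n b (index d' (c b)).+1); rewrite -sub_dart_head // -d'E.
by rewrite -td dE dtail_flip.
Qed.

Lemma sub_segment_inj : injective sub_segment.
Proof.
move=> [b i] [b' i'] h.
have [bb' ii'] := @sub_dart_inj b i b' i' (ltn_ord _) (ltn_ord _) h; subst b'.
by congr (existT _ _ _); apply/val_inj.
Qed.

Lemma sub_segment_surj e : exists x, sub_segment x = e.
Proof.
have [b [d db <-]] := sub_edge sub e.
have ilt : (index d (c b) < (n b).+1)%N by rewrite -size_c index_mem.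
by exists (segment b (Ordinal ilt)); rewrite /sub_segment /sub_dart /= nth_index.
Qed.

Lemma sub_isomorphism : (forall v, weight G (f v) = weight B v) ->
  isomorphism (subdivide B n) G sub_vertex sub_segment.
Proof.
move=> wf; split.
- exact: inj_surj_bij sub_vertex_inj sub_vertex_surj.
- exact: inj_surj_bij sub_segment_inj sub_segment_surj.
- case=> b i; rewrite /= -sub_dart_tail // -sub_dart_head // /sub_segment /=.
  by case: (sub_dart b i) => e []; rewrite /dtail /dhead //= finset.setUC.
case=> [v|[b i]] //=.
by have /andP[_ /eqP] := bi (sub_inner_nonst i).
Qed.

End SubdivisionIso.

(** * Contractions of subdivisions *)

Section ContractChain.
Variables (V E : finType) (G : wgraph V E) (gam : {set E}).
Local Notation dart := (E * bool)%type.
Local Notation E' := {e : E | e \notin gam}.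
Implicit Types (s : seq dart).

Definition contract_dart (d : dart) : option (E' * bool) :=
  if insub d.1 is Some e then Some (e, d.2) else None.

Definition contract_chain s : seq (E' * bool) := pmap contract_dart s.

Local Notation kept := (fun d : dart => d.1 \notin gam).

Variant contract_dart_spec (d : dart) : option (E' * bool) -> bool -> Type :=
| ContractDartIn of d.1 \in gam : contract_dart_spec d None true
| ContractDartOut (e : E') of sval e = d.1 : contract_dart_spec d (Some (e, d.2)) false.

Lemma contract_dartP d : contract_dart_spec d (contract_dart d) (d.1 \in gam).
Proof.
rewrite /contract_dart; case: insubP => [e dg ed|].
  by rewrite (negbTE dg); constructor.
by rewrite negbK => dg; rewrite dg; constructor.
Qed.

Lemma size_contract_chain s : size (contract_chain s) = count kept s.
Proof.
elim: s => [//|d s IH] /=; case: contract_dartP => [_|e _] //=; by rewrite IH.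
Qed.

Lemma contract_chain_map (T : Type) (F : E -> T) (s : seq dart) :
  map (fun d => F (sval d.1)) (contract_chain s) = [seq F d.1 | d <- s & kept d].
Proof.
elim: s => [//|d s IH] /=; case: contract_dartP => [_|e ed] //=.
by rewrite IH -ed.
Qed.

Lemma count_contract_chain (e : E') s :
  count (fun d => d.1 == e) (contract_chain s) = count (fun d => d.1 == sval e) s.
Proof.
elim: s => [//|d s IH] /=; case: contract_dartP => [dg|e' ed] /=; rewrite IH.
  by case: eqP => [h|//]; have := svalP e; rewrite -h dg.
by rewrite -ed val_eqE.
Qed.

Lemma contract_tail d e : sval e = d.1 ->
  dtail (contract G gam) (e, d.2) = contract_vertex G gam (dtail G d).
Proof. by rewrite /dtail /=; case: d => e0 [] /= ->. Qed.

Lemma contract_head d e : sval e = d.1 ->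
  dhead (contract G gam) (e, d.2) = contract_vertex G gam (dhead G d).
Proof. by rewrite /dhead /=; case: d => e0 [] /= ->. Qed.

Lemma chain_connect (st : pred V) u s w : chain G st u s w ->
  all (fun d => d.1 \in gam) s -> connect (adj G gam) u w.
Proof.
elim: s u => [//|d s IH] u /=; case/andP=> /eqP <- + /andP[/(@adj_dart _ _ G) dg sg].
case: s IH sg => [_ _ /eqP <-|a s IH sg /andP[_ ch]].
  exact: connect1 dg.
exact: connect_trans (connect1 dg) (IH _ ch sg).
Qed.

(** A dropped edge has its ends identified, so consecutive kept edges still meet. Only vertices with
    kept edges on both sides remain interior; the other ones merge with an end of the chain. *)
Lemma chain_contract (st : pred V) (st' : pred {C : {set V} | C \in components G gam})
    u s w : chain G st u s w ->
  (forall d s1 s2, s = d :: s1 ++ s2 -> has kept (d :: s1) -> has kept s2 ->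
     ~~ st' (contract_vertex G gam (dhead G (last d s1)))) ->
  has kept s ->
  chain (contract G gam) st' (contract_vertex G gam u) (contract_chain s)
        (contract_vertex G gam w).
Proof.
elim: s u => [//|d s IH] u ch int /=.
have IHs : has kept s -> chain (contract G gam) st' (contract_vertex G gam (dhead G d))
    (contract_chain s) (contract_vertex G gam w).
  case: s IH ch int => [//|a s] IH ch int hk; have /andP[_ /andP[_ ch']] := ch.
  apply: (IH _ ch') => // d' s1 s2 as12 h1 h2.
  apply: (int d (d' :: s1) s2) => //; first by rewrite as12.
  by move: h1 => /= ->; rewrite orbT.
case: contract_dartP => [dg|e ed] /=.
  move/IHs; suff /eqP -> : contract_vertex G gam u == contract_vertex G gam (dhead G d) by [].
  rewrite contract_vertex_eq; case/andP: ch => /eqP <- _.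
  exact/connect1/adj_dart.
move=> _; rewrite (contract_tail ed) (contract_head ed); case/andP: (ch) => /eqP -> _; rewrite eqxx /=.
have [hk|] := boolP (has kept s).
  have := IHs hk; case E1: (contract_chain s) => [//|a t] ->; rewrite andbT.
  apply: (int d [::] s) => //=; rewrite -ed (svalP e) //.
(* No kept edge follows: the rest of the chain lies in [gam] and joins the head of [d] to [w]. *)
rewrite -all_predC => hs; have : contract_chain s = [::].
  apply/nilP; rewrite /nilp size_contract_chain -leqn0 leqNgt -has_count -all_predC //.
move=> ->; rewrite contract_vertex_eq.
case: s ch hs {IH int IHs} => [/= /andP[_ /eqP ->]|a s /andP[_ /andP[_ ch]] hs].
  by rewrite connect0.
apply: (@chain_connect st _ (a :: s) _ ch); apply: sub_all hs => x /=; by rewrite negbK.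
Qed.

End ContractChain.

Section ContractSubdivision.
Variables (VB EB : finType) (B : wgraph VB EB) (V E : finType) (G : wgraph V E).
Variables (f : VB -> V) (c : EB -> seq (E * bool)) (gam : {set E}).
Local Notation st := (stable_vertex G).
Hypothesis sub : subdivision B G st f c.
Hypothesis bi : forall v, stable_vertex G v || bivalent0 G v.
Hypothesis gam_proper : gam \proper [set: E]%SET.
Local Notation kept := (fun d : E * bool => d.1 \notin gam).
Local Notation G' := (contract G gam).

Definition contracted_edges : {set EB} :=
  [set b | all (fun d => d.1 \in gam) (c b)].
Local Notation gB := contracted_edges.
Local Notation B' := (contract B gB).

Lemma contracted_edgesN b : (b \notin gB) = has kept (c b).
Proof. by rewrite inE -has_predC. Qed.

(* The labels separate the components of [gam], seen along the chains: the
   [j]-th vertex of [c b] is labelled by an end of [b] when it is joined to it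
   inside [gam], and else by the number of edges of [c b] outside [gam]
   before it. *)
Definition chain_label (b : EB) (j : nat) :
    {C : {set VB} | C \in components B gB} + EB * nat :=
  let k := count kept (take j (c b)) in
  if k == 0%N then inl (contract_vertex B gB (esrc B b))
  else if k == count kept (c b) then inl (contract_vertex B gB (etgt B b))
  else inr (b, k).

(** When the whole chain is contracted, the label is the class of the source of [b], which is then
    also that of the target. *)
Lemma chain_label_size b :
  chain_label b (size (c b)) = inl (contract_vertex B gB (etgt B b)).
Proof.
rewrite /chain_label take_size eqxx; case: eqP => // /eqP k0.
congr inl; apply/eqP; rewrite contract_vertex_eq; apply/connect1/adj_edge.
by rewrite -[_ \in _]negbK contracted_edgesN has_count (eqP k0) ltnn.
Qed.

(** By the isomorphism with the standard subdivision, each vertex is either old or has a unique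
    inner position on one chain. Labels given by positions therefore define a function on vertices,
    provided they are right at the ends of the chains. *)
Lemma exists_label : exists rho : V -> {C : {set VB} | C \in components B gB} + EB * nat,
  (forall v, rho (f v) = inl (contract_vertex B gB v)) /\
  forall b d j, (j < size (c b))%N ->
    rho (dtail G (nth d (c b) j)) = chain_label b j /\
    rho (dhead G (nth d (c b) j)) = chain_label b j.+1.
Proof.
have /fintype.properP[_ [e0 _ _]] := gam_proper.
pose n b := (size (c b)).-1; pose d0 : E * bool := (e0, false).
have sz b : size (c b) = (n b).+1.
  by rewrite prednK // lt0n size_eq0; exact: chain_neq0 (sub_chain sub b).
have bist v : ~~ st v -> bivalent0 G v by move=> h; have := bi v; rewrite (negbTE h).
pose lab (v : VB + {b : EB & 'I_(n b)}) := match v with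
  | inl v => inl (contract_vertex B gB v)
  | inr (existT b i) => chain_label b i.+1 end.
have labE b j : (j <= (n b).+1)%N -> lab (subdivide_pos B n b j) = chain_label b j.
  case: j => [_|j]; first by rewrite /chain_label take0.
  rewrite leq_eqVlt => /orP[/eqP[->]|]; first by rewrite subdivide_pos_last -sz chain_label_size.
  by rewrite ltnS => jlt; rewrite (@subdivide_pos_inner _ _ B n b (Ordinal jlt)).
have /choice[g gE] := sub_vertex_surj d0 bist sub sz.
have gK v : g (sub_vertex G f c d0 v) = v by apply: (sub_vertex_inj (d0 := d0) bist sub sz); rewrite gE.
exists (lab \o g); split=> [v|b d j jlt]; first by rewrite /= (gK (inl v)).
rewrite (set_nth_default d0) // -/(sub_dart c d0 b j).
move: (jlt); rewrite sz => jlt'; rewrite (sub_dart_tail _ sub sz) // (sub_dart_head _ sub sz) //.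
by rewrite -[(lab \o g) _]/(lab (g _)) -[in X in _ /\ X](labE b j.+1) // -(labE b j) ?(ltnW jlt') //= !gK.
Qed.

Lemma f_connect v w : connect (adj B gB) v w -> connect (adj G gam) (f v) (f w).
Proof.
apply: (connect_homo (q := f)) => {}v {}w /adjP[[b k]]; rewrite inE => bg [<- <-].
have fb := chain_connect (sub_chain sub b) bg.
by case: k {bg} => //; rewrite /dtail /dhead /= adj_connect_sym.
Qed.

(** An edge of [gam] leaves the number of kept edges passed unchanged, so the labels are constant on
    the components of [gam]. *)
Lemma label_connect : exists rho : V -> {C : {set VB} | C \in components B gB} + EB * nat,
  [/\ forall v, rho (f v) = inl (contract_vertex B gB v),
      forall b d s1 s2, c b = d :: s1 ++ s2 -> has kept (d :: s1) -> has kept s2 ->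
        exists k, rho (dhead G (last d s1)) = inr (b, k)
    & forall u w, connect (adj G gam) u w -> rho u = rho w].
Proof.
have [rho [rhof rhoc]] := exists_label; exists rho; split=> //.
  move=> b d s1 s2 cb; rewrite !has_count => h1 h2.
  have [|_] := rhoc b d (size s1); first by rewrite cb /= size_cat ltnS leq_addr.
  rewrite cb -cat_cons nth_cat /= ltnSn -last_nth => ->.
  rewrite /chain_label cb -cat_cons take_size_cat // eqn0Ngt h1 /=.
  rewrite count_cat addnA -[X in X == _]addn0 eqn_add2l eq_sym eqn0Ngt h2 /=.
  by eexists.
apply: connect_constant => e eg.
have [b [d db de]] := sub_edge sub e.
have ilt : (index d (c b) < size (c b))%N by rewrite index_mem.
have [] := rhoc b d (index d (c b)) ilt; rewrite nth_index // => rt rh.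
suff h : rho (dtail G d) = rho (dhead G d).
  by case: d de h {db ilt rt rh} => x [] /= <- h; [symmetry|]; exact: h.
rewrite rt rh /chain_label (take_nth d ilt) nth_index // -cats1 count_cat /=.
by rewrite de eg !addn0.
Qed.

(** The labels [inl] distinguish images of vertices in different components; this makes [f]
    injective on components. *)
Lemma f_connectE v w : connect (adj G gam) (f v) (f w) = connect (adj B gB) v w.
Proof.
apply/idP/idP; last exact: f_connect.
have [rho [rhof _ rhoE]] := label_connect => /rhoE.
rewrite !rhof => /(congr1 (fun x => if x is inl C then C else contract_vertex B gB v)).
by move/eqP; rewrite contract_vertex_eq.
Qed.

Lemma contract_stable (C : {C : {set V} | C \in components G gam}) :
  stable_vertex G' C = [exists v in sval C, st v].
Proof. by rewrite contract_nonstable //; exact: excess_ge2. Qed.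

Lemma subdivision_contract : exists f' : {C : {set VB} | C \in components B gB} ->
    {C : {set V} | C \in components G gam},
  (forall v, f' (contract_vertex B gB v) = contract_vertex G gam (f v)) /\
  subdivision B' G' (stable_vertex G') f' (fun b => contract_chain gam (c (sval b))).
Proof.
have /choice[r rE] := @contract_vertex_surj _ _ B gB.
have f'E v : contract_vertex G gam (f (r (contract_vertex B gB v))) = contract_vertex G gam (f v).
  apply/eqP; rewrite contract_vertex_eq f_connectE -contract_vertex_eq.
  by rewrite -rE.
exists (fun C => contract_vertex G gam (f (r C))); split=> //; split.
- move=> C D /eqP; rewrite contract_vertex_eq f_connectE -contract_vertex_eq.
  by rewrite -!rE => /eqP.
- move=> C; rewrite contract_stable; apply/existsP; exists (f (r C)).
  by rewrite mem_component connect0 (sub_st sub).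
- move=> C; rewrite contract_stable => /existsP[u /andP[uC stu]].
  have [v uE] := sub_img sub stu; exists (contract_vertex B gB v).
  by rewrite f'E; apply/esym/eqP; rewrite contract_vertexE -uE.
- move=> [b bg]; rewrite /= !f'E.
  (* A vertex between two kept edges has a label [inr], while stable vertices are old and have
     labels [inl]. Its component thus contains no stable vertex and contracts to a vertex that is
     not stable. *)
  have [rho [rhof rhoi rhoE]] := label_connect.
  apply: (chain_contract (sub_chain sub b)); last by rewrite -contracted_edgesN.
  move=> d s1 s2 cb h1 h2; have [k rk] := rhoi b d s1 s2 cb h1 h2.
  rewrite contract_stable; apply/existsP => -[u /andP[]].
  rewrite mem_component => /rhoE ru stu; have [v uE] := sub_img sub stu.
  by move: ru; rewrite rk uE rhof.
move=> e; under eq_bigr do rewrite count_contract_chain.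
rewrite -(big_sig _ (fun b => b \notin gB) (fun b => count (fun d => d.1 == sval e) (c b))).
rewrite -(sub_count sub (sval e)) [in RHS](bigID (fun b => b \in gB)) /=.
rewrite [X in (X + _)%N]big1 // => b; rewrite inE => bg.
apply/eqP; rewrite -leqn0 leqNgt -has_count; apply/hasPn => d db.
by apply: contraNneq (svalP e) => <-; exact: (allP bg).
Qed.

End ContractSubdivision.

Section SubdivisionExcess.
Variables (VB EB : finType) (B : wgraph VB EB) (V E : finType) (G : wgraph V E).
Variables (f : VB -> V) (c : EB -> seq (E * bool)).
Local Notation st := (stable_vertex G).
Hypothesis sub : subdivision B G st f c.
Hypothesis bi : forall v, stable_vertex G v || bivalent0 G v.
Hypothesis wf : forall v, weight G (f v) = weight B v.

Lemma sub_excess v : excess G (f v) = excess B v.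
Proof. by rewrite /excess wf (sub_valency sub). Qed.

Lemma sub_stable v : stable_vertex B v.
Proof.
rewrite /stable_vertex -[(_ + _)%N]/(excess B v) -sub_excess.
exact: (sub_st sub v).
Qed.

(** Vertices of [D] that do not come from [C] are bivalent of weight 0, so their [excess - 2]
    vanishes. For whole graphs this compares genera, for components it compares the weights after a
    contraction. *)
Lemma sub_sum_excess (C : {set VB}) (D : {set V}) :
  (forall v, (f v \in D) = (v \in C)) ->
  (\sum_(u in D) excess G u + 2 * #|C| = \sum_(v in C) excess B v + 2 * #|D|)%N.
Proof.
move=> CD.
have ex2 := excess_ge2 bi.
have h : (\sum_(u in D) (excess G u - 2) = \sum_(v in C) (excess B v - 2))%N.
  under [RHS]eq_bigr do rewrite -sub_excess.
  rewrite -(@big_imset _ _ _ _ _ f (mem C) (fun u => (excess G u - 2)%N)) /=; last first.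
    by move=> v w _ _; exact: sub_inj sub v w.
  rewrite (bigID (mem (f @: C)%SET)) /= [X in (_ + X)%N]big1 ?addn0.
    apply: eq_bigl => u; rewrite andbC; have [/imsetP[v vC ->]|//] := boolP (u \in _).
    by rewrite CD vC.
  move=> u /andP[uD uC]; have [stu|nst] := boolP (st u).
    have [v uE] := sub_img sub stu; case/negP: uC; rewrite uE imset_f //.
    by rewrite -CD -uE.
  by have := bi u; rewrite (negbTE nst) => /excess_bivalent0 ->.
have hG : (\sum_(u in D) excess G u = \sum_(u in D) (excess G u - 2) + 2 * #|D|)%N.
  rewrite -sum1_card big_distrr -big_split /=; apply: eq_bigr => u _.
  by rewrite muln1 subnK.
have hB : (\sum_(v in C) excess B v = \sum_(v in C) (excess B v - 2) + 2 * #|C|)%N.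
  rewrite -sum1_card big_distrr -big_split /=; apply: eq_bigr => u _.
  by rewrite muln1 subnK // -sub_excess.
by rewrite hG hB h addnAC.
Qed.

Lemma sub_genus : connected_graph G -> connected_graph B -> genus B = genus G.
Proof.
move=> /genus_excess hG /genus_excess hB.
have := @sub_sum_excess [set: VB] [set: V] (fun v => etrans (finset.in_setT _) (esym (finset.in_setT _))).
rewrite !cardsT.
have -> : (\sum_(u in [set: V]) excess G u = \sum_u excess G u)%N.
  by apply: eq_bigl => u; rewrite inE.
have -> : (\sum_(u in [set: VB]) excess B u = \sum_u excess B u)%N.
  by apply: eq_bigl => u; rewrite inE.
move: hG hB; move: (genus G) (genus B) #|V| #|VB| (\sum_u _)%N (\sum_u _)%N.
by move=> x y z t a b; lia.
Qed.

Variable gam : {set E}.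
Hypothesis gam_proper : gam \proper [set: E]%SET.

(** The loop numbers of corresponding components need not be compared: the excesses agree by
    additivity and the valencies by [sub_valency], which leaves equal weights. *)
Lemma subdivision_contract_weight f' c' :
  (forall v, f' (contract_vertex B (contracted_edges c gam) v) = contract_vertex G gam (f v)) ->
  subdivision (contract B (contracted_edges c gam)) (contract G gam)
    (stable_vertex (contract G gam)) f' c' ->
  forall C, weight (contract G gam) (f' C) = weight (contract B (contracted_edges c gam)) C.
Proof.
move=> f'E sub' C; have [v0 CE] := contract_vertex_surj C.
have hG := excess_contract (f' C); have hB := excess_contract C.
have := @sub_sum_excess (sval C) (sval (f' C)) _.
have CD v : (f v \in sval (f' C)) = (v \in sval C).
  by rewrite CE f'E !mem_component (f_connectE sub bi gam_proper).
move=> /(_ CD) h; move: hG hB; rewrite /excess (sub_valency sub').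
move: h; move: (valency _ _) (weight _ _) (weight _ _) (#|_|) (#|_|) (\sum_(_ in _) _)%N (\sum_(_ in _) _)%N.
by move=> k x y z t a b; lia.
Qed.

End SubdivisionExcess.

(** * Isomorphisms, transport of subdivisions, and the classes of graphs *)

Section OrientedIso.
Variables (V E V' E' : finType) (G : wgraph V E) (G' : wgraph V' E').
Variables (fV : V -> V') (fE : E -> E').

(** An isomorphism matches only unordered pairs of ends, and [o] marks the edges it reverses. A
    tadpole, where either value would do, gets [false]. *)
Lemma isomorphism_oriented : isomorphism G G' fV fE ->
  exists o, oriented_iso G G' fV fE o.
Proof.
case=> bV bE ends w.
exists (fun e => esrc G' (fE e) != fV (esrc G e)); split=> // e k.
have h (a b x y : V') : [set a; b] = [set x; y] ->
    (a = x /\ b = y) \/ (a != x /\ a = y /\ b = x).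
  move=> abxy; have [ax|ax] := eqVneq a x.
    left; split=> //; subst x.
    have : b \in [set a; y] by rewrite -abxy !inE eqxx orbT.
    have : y \in [set a; b] by rewrite abxy !inE eqxx orbT.
    by rewrite !inE => /orP[/eqP ya|/eqP ->//] /orP[/eqP ->|/eqP ->].
  right; split=> //; have : a \in [set x; y] by rewrite -abxy !inE eqxx.
  have : x \in [set a; b] by rewrite abxy !inE eqxx.
  by rewrite !inE (negbTE ax) eq_sym (negbTE ax) => /= /eqP -> /eqP ->.
have [[ax bx]|[ax [ay bx]]] := h _ _ _ _ (ends e).
  by rewrite ax eqxx; case: k; rewrite /dtail.
by rewrite ax; case: k; rewrite /dtail.
Qed.

Variable o : E -> bool.
Hypothesis iso : oriented_iso G G' fV fE o.

Lemma oriented_isomorphism : isomorphism G G' fV fE.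
Proof.
case: iso => bV bE ends w; split=> // e.
have := ends e false; have := ends e true; rewrite /dtail /= => -> ->.
by case: (o e) => //=; rewrite finset.setUC.
Qed.

Lemma oriented_iso_head e k : dhead G' (fE e, k) = fV (dhead G (e, k (+) o e)).
Proof.
case: iso => _ _ ends _.
by rewrite -!dtail_flip /dflip /= ends addNb.
Qed.

(** An isomorphism is a subdivision whose chains are single edges, so valencies and composition with
    isomorphisms come from the results on subdivisions. *)
Lemma oriented_iso_sub : subdivision G G' predT fV (fun e => [:: (fE e, o e)]).
Proof.
case: iso => bV bE ends w; split=> //.
- exact: bij_inj bV.
- by case: bV => g _ gK u _; exists (g u); rewrite gK.
- move=> e; rewrite /= oriented_iso_head ends addbb.
  by rewrite /dtail /dhead /= !eqxx.
case: bE => g fEK gK e; rewrite (bigD1 (g e)) //= gK eqxx big1 // => a.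
by rewrite addn0; have [<-|//] := eqVneq (fE a) e; rewrite fEK eqxx.
Qed.

Lemma iso_valency v : valency G' (fV v) = valency G v.
Proof. exact: sub_valency oriented_iso_sub v. Qed.

Lemma iso_excess v : excess G' (fV v) = excess G v.
Proof. by case: iso => _ _ _ w; rewrite /excess iso_valency w. Qed.

Lemma iso_stable v : stable_vertex G' (fV v) = stable_vertex G v.
Proof. by case: iso => _ _ _ w; rewrite /stable_vertex iso_valency w. Qed.

Lemma iso_bivalent0 v : bivalent0 G' (fV v) = bivalent0 G v.
Proof. by case: iso => _ _ _ w; rewrite /bivalent0 iso_valency w. Qed.

Lemma iso_connected : connected_graph G -> connected_graph G'.
Proof.
case: iso => -[g fVK gK] bE ends w.
case/connected_graphP => -[v0 _] conn; apply/connected_graphP.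
split; first by exists (fV v0).
move=> u v; rewrite -[u]gK -[v]gK.
apply: (connect_homo (q := fV)) (conn (g u) (g v)) => {}u {}v.
case/adjP => -[e k] _ [<- <-]; apply: connect1.
have := @adj_dart _ _ G' finset.setT (fE e, k (+) o e) (finset.in_setT _).
by rewrite ends oriented_iso_head addbK.
Qed.

Lemma iso_genus : connected_graph G -> genus G' = genus G.
Proof.
move=> conn; have h1 := genus_excess conn; have h2 := genus_excess (iso_connected conn).
have [bV _ _ _] := iso.
have hs : (\sum_v excess G' v = \sum_v excess G v)%N.
  rewrite (reindex fV) /=; last exact: onW_bij.
  by apply: eq_bigr => v _; rewrite iso_excess.
move: h1 h2; rewrite hs (bij_eq_card bV).
by move: (genus _) (genus _) (\sum_v _)%N #|V'| => x y z t; lia.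
Qed.

Lemma oriented_iso_inv : exists gV gE, [/\ cancel fV gV, cancel gV fV, cancel fE gE,
  cancel gE fE & oriented_iso G' G gV gE (o \o gE)].
Proof.
case: iso => -[gV fVK gVK] [gE fEK gEK] ends w.
exists gV, gE; split=> //; split.
- by exists fV.
- by exists fE.
- by move=> e k; have := ends (gE e) (k (+) o (gE e)); rewrite gEK addbK => ->; rewrite fVK.
- by move=> v; rewrite -w gVK.
Qed.

End OrientedIso.

Section TransportSubdivision.
Variables (VB EB V E : finType) (B : wgraph VB EB) (G : wgraph V E) (st : pred V).
Variables (f : VB -> V) (c : EB -> seq (E * bool)).
Hypothesis sub : subdivision B G st f c.

Lemma sub_iso_target (V' E' : finType) (G' : wgraph V' E') fV fE o (st' : pred V') :
  oriented_iso G G' fV fE o -> (forall v, st' (fV v) = st v) ->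
  exists2 c', subdivision B G' st' (fV \o f) c'
    & forall b, map fst (c' b) = map (fun d => fE d.1) (c b).
Proof.
move=> iso stE; have sub2 := oriented_iso_sub iso.
eexists; first by apply: (sub_comp sub sub2 stE) => u.
move=> b /=; elim: (c b) => [//|[e k] s IH].
by rewrite /= map_cat IH; case: k.
Qed.

Lemma sub_iso_source (VB' EB' : finType) (B' : wgraph VB' EB') fV fE o :
  oriented_iso B B' fV fE o ->
  exists f' c', [/\ subdivision B' G st f' c', forall v, f' (fV v) = f v
    & forall b, c' (fE b) = if o b then revchain (c b) else c b].
Proof.
move=> iso; have [gV [gE [fVK _ fEK _ iso']]] := oriented_iso_inv iso.
have := sub_comp (st := st) (oriented_iso_sub iso') sub.
move=> /(_ (fun v => sub_st sub v) (fun u h => h)) sub'.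
exists (f \o gV), (fun b => flatten [seq expand_dart c d | d <- [:: (gE b, (o \o gE) b)]]).
split=> // [v|b]; first by rewrite /= fVK.
by rewrite /= fEK cats0.
Qed.

End TransportSubdivision.

(** The disjoint union runs over graphs on ordinals; graphs built on other finite types are
    renumbered to enter it. *)
Definition ord_graph (V E : finType) (G : wgraph V E) : graph :=
  Graph {| esrc := fun e : 'I_#|E| => enum_rank (esrc G (enum_val e));
           etgt := fun e : 'I_#|E| => enum_rank (etgt G (enum_val e));
           weight := fun v : 'I_#|V| => weight G (enum_val v) |}.

Lemma ord_graph_iso (V E : finType) (G : wgraph V E) :
  oriented_iso G (ord_graph G) enum_rank enum_rank (fun=> false).
Proof.
split; [exact: enum_rank_bij|exact: enum_rank_bij| |].
  by move=> e k; rewrite addbF /dtail /= enum_rankK; case: k.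
by move=> v; rewrite /= enum_rankK.
Qed.

Definition stable_wgraph g (V E : finType) (G : wgraph V E) : Prop :=
  [/\ (0 < #|E|)%N, connected_graph G, genus G = g & forall v, stable_vertex G v].

Definition neq2_wgraph g (V E : finType) (G : wgraph V E) : Prop :=
  [/\ (0 < #|E|)%N, connected_graph G, genus G = g,
      forall v, stable_vertex G v || bivalent0 G v & exists v, stable_vertex G v].

Lemma stable_wgraphE g (G : graph) : stable_wgraph g G <-> stable_graphs g G.
Proof. by split=> -[e0 *]; split=> //; rewrite card_ord in e0 *. Qed.

Lemma neq2_wgraphE g (G : graph) : neq2_wgraph g G <-> neq2_graphs g G.
Proof. by split=> -[e0 *]; split=> //; rewrite card_ord in e0 *. Qed.

Section Classes.
Variable g : nat.

Lemma iso_stable_wgraph (V E V' E' : finType) (G : wgraph V E) (G' : wgraph V' E')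
    fV fE o : oriented_iso G G' fV fE o -> stable_wgraph g G -> stable_wgraph g G'.
Proof.
move=> iso [e0 conn gG st]; have [[h fVK hK] bE _ _] := iso; split.
- by rewrite -(bij_eq_card bE).
- exact: iso_connected iso conn.
- by rewrite (iso_genus iso conn).
- by move=> v; rewrite -[v]hK (iso_stable iso).
Qed.

Lemma iso_neq2_wgraph (V E V' E' : finType) (G : wgraph V E) (G' : wgraph V' E')
    fV fE o : oriented_iso G G' fV fE o -> neq2_wgraph g G -> neq2_wgraph g G'.
Proof.
move=> iso [e0 conn gG st [v0 stv0]]; have [[h fVK hK] bE _ _] := iso; split.
- by rewrite -(bij_eq_card bE).
- exact: iso_connected iso conn.
- by rewrite (iso_genus iso conn).
- by move=> v; rewrite -[v]hK (iso_stable iso) (iso_bivalent0 iso).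
- by exists (fV v0); rewrite (iso_stable iso).
Qed.

Lemma subdivide_neq2 (VB EB : finType) (B : wgraph VB EB) (n : EB -> nat) :
  stable_wgraph g B -> neq2_wgraph g (subdivide B n).
Proof.
case=> /card_gt0P[b0 _] conn gB st; split.
- by apply/card_gt0P; exists (existT _ b0 ord0).
- exact: subdivide_connected.
- by rewrite subdivide_genus.
- by case=> [v|x]; rewrite ?subdivide_bivalent ?orbT // subdivide_stable_old st.
- by exists (inl (esrc B b0)); rewrite subdivide_stable_old.
Qed.

Lemma contract_stable_wgraph (VB EB : finType) (B : wgraph VB EB) (gam : {set EB}) :
  gam \proper [set: EB]%SET -> stable_wgraph g B -> stable_wgraph g (contract B gam).
Proof.
move=> /fintype.properP[_ [e0 _ e0N]] [_ conn gB st]; split.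
- by apply/card_gt0P; exists (exist _ e0 e0N).
- exact: contract_connected.
- by rewrite contract_genus.
- move=> C; rewrite contract_nonstable => [|v]; last exact: ltnW (st v).
  have [v ->] := contract_vertex_surj C; apply/existsP; exists v.
  by rewrite mem_component connect0 st.
Qed.

Lemma contract_bivalent (V E : finType) (G : wgraph V E) (gam : {set E}) :
  gam \proper [set: E]%SET -> neq2_wgraph g G ->
  forall C, stable_vertex (contract G gam) C || bivalent0 (contract G gam) C.
Proof.
move=> /fintype.properP[_ [e0 _ e0N]] [_ conn gB st _] C; apply: bivalent0P.
- exact: contract_connected.
- by apply/card_gt0P; exists (exist _ e0 e0N).
- have := excess_contract C; have ex2 := excess_ge2 st.
  have : (\sum_(v in sval C) 2 <= \sum_(v in sval C) excess G v)%N by apply: leq_sum.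
  rewrite sum_nat_const; move: #|_| (\sum_(_ in _) _)%N (excess _ _) => x y z; lia.
Qed.

Lemma subdivision_graph_exists (G : graph) : neq2_graphs g G ->
  exists B : graph, stable_graphs g B /\ exists f c,
    subdivision B G (stable_vertex G) f c /\ forall v, weight G (f v) = weight B v.
Proof.
move=> /neq2_wgraphE[e0 conn gG bi st].
have [VB [EB [B [f [c [sub w connB]]]]]] := subdivision_exists conn bi st.
have isoB := ord_graph_iso B.
exists (ord_graph B); split.
  apply/stable_wgraphE; apply: (iso_stable_wgraph isoB); split=> //.
  - have /card_gt0P[e _] := e0; have [b _] := sub_edge sub e.
    by apply/card_gt0P; exists b.
  - by rewrite (sub_genus sub bi w).
  - exact: sub_stable sub w.
have [f' [c' [sub' f'E _]]] := sub_iso_source sub isoB.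
exists f', c'; split=> // v.
have [[h hK Kh] _ _ wB] := isoB.
by rewrite -[v]Kh f'E w wB.
Qed.

End Classes.

(** * Marked points on an edge *)

Local Open Scope ring_scope.

Section Breaks.
Variable R : realFieldType.
Implicit Types (s t : seq R) (x y a : R).

Definition total s : R := \sum_(x <- s) x.

Definition nonneg s : bool := all (fun x => 0 <= x) s.

(* The vertices along a chain of edges of lengths [s]. *)
Definition breaks s : seq R := 0 :: scanl +%R 0 s.

(** Both ends are left out by position and not by value, so marks that happen to lie at an end are
    kept and the length of the list depends only on that of [s]. *)
Definition interior s : seq R := behead (belast 0 (scanl +%R 0 s)).

Lemma foldl_addr a s : foldl +%R a s = a + total s.
Proof.
elim: s a => [|x s IH] a /=; first by rewrite /total big_nil addr0.
by rewrite IH /total big_cons addrA.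
Qed.

Lemma total_cat s t : total (s ++ t) = total s + total t.
Proof. exact: big_cat. Qed.

Lemma total_rev s : total (rev s) = total s.
Proof. by apply: perm_big; apply/permEl/perm_rev. Qed.

Lemma total_ge0 s : nonneg s -> 0 <= total s.
Proof. by move=> /allP s0; rewrite /total big_seq sumr_ge0. Qed.

Lemma last_scanl a s : last a (scanl +%R a s) = a + total s.
Proof. by rewrite -foldl_addr; elim: s a => [|x s IH] a //=. Qed.

Lemma breaks_interior s : s != [::] -> breaks s = 0 :: rcons (interior s) (total s).
Proof.
rewrite /breaks /interior lastI last_scanl add0r.
by case: s => [//|x s] _ /=; rewrite -rcons_cons.
Qed.

Lemma breaksP s x : reflect (exists s1 s2, s = s1 ++ s2 /\ x = total s1) (x \in breaks s).
Proof.
have h a : x \in a :: scanl +%R a s <-> exists s1 s2, s = s1 ++ s2 /\ x = a + total s1.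
  elim: s a => [|y s IH] a /=; split.
  - by rewrite inE => /eqP ->; exists [::], [::]; rewrite /total big_nil addr0.
  - by case=> -[|? ?] [s2 [// _ ->]]; rewrite /total big_nil addr0 mem_head.
  - rewrite inE => /orP[/eqP ->|/IH[s1 [s2 [-> ->]]]].
      by exists [::], (y :: s); rewrite /total big_nil addr0.
    by exists (y :: s1), s2; rewrite /total big_cons addrA.
  - case=> -[|z s1] [s2 [ss xE]]; first by rewrite xE /total big_nil addr0 mem_head.
    case: ss => yz ss; rewrite inE; apply/orP; right; apply/IH.
    by exists s1, s2; rewrite xE /total big_cons addrA yz.
apply: (iffP idP); rewrite /breaks.
  by move/h => [s1 [s2 [-> ->]]]; exists s1, s2; rewrite add0r.
by case=> s1 [s2 [ss xs]]; apply/h; exists s1, s2; rewrite add0r.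
Qed.

Lemma breaks_rev s x : (x \in breaks (rev s)) = (total s - x \in breaks s).
Proof.
apply/breaksP/breaksP => -[s1 [s2 [ss xs]]].
  exists (rev s2), (rev s1); split; first by rewrite -rev_cat -ss revK.
  by rewrite xs -(total_rev s) ss total_cat total_rev addrC addKr.
exists (rev s2), (rev s1); split; first by rewrite -rev_cat ss.
by rewrite total_rev -[x](subKr (total s)) xs ss total_cat addrC addKr.
Qed.

Lemma breaks_filter s : breaks [seq x <- s | x != 0] =i breaks s.
Proof.
suff h a : a :: scanl +%R a [seq x <- s | x != 0] =i a :: scanl +%R a s by exact: h.
elim: s a => [//|x s IH] a y /=.
have [->|x0] := eqVneq x 0; rewrite /=.
  by rewrite addr0 IH !inE orbA orbb.
by rewrite in_cons IH -in_cons.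
Qed.

Lemma breaks_sorted s : nonneg s -> sorted <%R (breaks [seq x <- s | x != 0]).
Proof.
suff h a : nonneg s -> path <%R a (scanl +%R a [seq x <- s | x != 0]) by exact: h.
elim: s a => [//|x s IH] a /= /andP[x0 s0].
case: (eqVneq x 0) => [_|xn0] /=; first exact: IH.
by rewrite IH // andbT ltrDl lt_neqAle eq_sym xn0.
Qed.

(* Deleting the zero lengths does not move the vertices, which determine the
   remaining lengths. *)
Lemma eq_breaks_filter s t : nonneg s -> nonneg t -> breaks s =i breaks t ->
  [seq x <- s | x != 0] = [seq x <- t | x != 0].
Proof.
move=> s0 t0 st.
have : breaks [seq x <- s | x != 0] = breaks [seq x <- t | x != 0].
  apply: lt_sorted_eq; [exact: breaks_sorted|exact: breaks_sorted|].
  by move=> x; rewrite !breaks_filter.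
case=> /(can_inj (@scanlK _ _ (fun x y => y - x) +%R _ 0)); apply => a b.
by rewrite addrC addKr.
Qed.

Lemma total_filter s : total [seq x <- s | x != 0] = total s.
Proof.
rewrite /total big_filter [RHS](bigID (fun x => x != 0)) /= [X in _ + X]big1 ?addr0 //.
by move=> x; rewrite negbK => /eqP.
Qed.

Lemma eq_breaks_total s t : nonneg s -> nonneg t -> breaks s =i breaks t -> total s = total t.
Proof. by move=> s0 t0 st; rewrite -total_filter (eq_breaks_filter s0 t0 st) total_filter. Qed.

(** Insertion uses [Num.min] and [Num.max] instead of a case distinction, which makes every entry of
    the sorted list a continuous function of the unsorted ones. *)
Fixpoint insert a s : seq R :=
  if s is x :: s' then Num.min a x :: insert (Num.max a x) s' else [:: a].

Definition isort s : seq R := foldr insert [::] s.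

Lemma perm_insert a s : perm_eq (insert a s) (a :: s).
Proof.
elim: s a => [//|x s IH] a /=.
apply: (@perm_trans _ (Num.min a x :: Num.max a x :: s)); first by rewrite perm_cons.
case: (leP a x) => _ //.
by apply/permP => P /=; rewrite addnCA.
Qed.

Lemma insert_path b a s : b <= a -> path <=%R b s -> path <=%R b (insert a s).
Proof.
elim: s a b => [|x s IH] a b ba /=; first by rewrite ba.
case/andP=> bx xs; rewrite le_min ba bx /=.
case: (leP a x) => ax; first apply: IH => //.
  by case: (s) xs => //= y s' /andP[xy ->]; rewrite (le_trans ax xy).
by apply: IH => //; exact: ltW.
Qed.

Lemma perm_isort s : perm_eq (isort s) s.
Proof.
elim: s => [//|a s IH] /=; apply: perm_trans (perm_insert _ _) _.
by rewrite perm_cons.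
Qed.

Lemma isort_path b s : all (fun x => b <= x) s -> path <=%R b (isort s).
Proof. by elim: s => [//|a s IH] /= /andP[ba /IH]; exact: insert_path. Qed.

Definition differences s : seq R := pairmap (fun x y => y - x) 0 s.

Lemma breaks_differences s : breaks (differences s) = 0 :: s.
Proof.
rewrite /breaks /differences (@pairmapK _ _ (fun x y => y - x) +%R) // => x y.
by rewrite addrC subrK.
Qed.

Lemma total_differences s : total (differences s) = last 0 s.
Proof.
rewrite -[LHS]add0r -last_scanl; congr last.
by have [] := breaks_differences s.
Qed.

Lemma nonneg_differences s : path <=%R 0 s -> nonneg (differences s).
Proof.
suff h a : path <=%R a s -> nonneg (pairmap (fun x y => y - x) a s) by exact: h.
elim: s a => [//|x s IH] a /= /andP[ax /IH ->].
by rewrite subr_ge0 ax.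
Qed.

End Breaks.

Section Spread.
Variable R : realFieldType.
Variable H : R -> R -> seq R.
Implicit Types (s t : seq R) (x L p : R).

Hypothesis H_range : forall L p, 0 <= p <= L -> all (fun x => 0 <= x <= L) (H L p).
Hypothesis H_ends : forall L p, 0 <= L -> p = 0 \/ p = L -> {subset H L p <= [:: 0; L]}.

(* The inner vertex [p] of an edge of length [L] is replaced by the points of
   [H L p], and by their mirror images for the opposite orientation. *)
Definition mirror L p : seq R := H L p ++ [seq L - x | x <- H L (L - p)].

Definition spread s : seq R :=
  differences (rcons (isort (flatten [seq mirror (total s) p | p <- interior s])) (total s)).

Lemma mirror_sym L p x : (x \in mirror L (L - p)) = (L - x \in mirror L p).
Proof.
have h (t : seq R) y : (y \in [seq L - z | z <- t]) = (L - y \in t).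
  apply/mapP/idP => [[z zt ->]|yt]; first by rewrite subKr.
  by exists (L - y); rewrite ?subKr.
by rewrite !mem_cat !h !subKr orbC.
Qed.

Lemma mirror_range L p : 0 <= p <= L -> all (fun x => 0 <= x <= L) (mirror L p).
Proof.
move=> pL; rewrite all_cat H_range //= all_map.
have pL' : 0 <= L - p <= L.
  by case/andP: pL => p0 pL; rewrite subr_ge0 pL gerBl.
apply: sub_all (H_range pL') => x /= /andP[x0 xL].
by rewrite subr_ge0 xL gerBl.
Qed.

Lemma mirror_ends L p : 0 <= L -> p = 0 \/ p = L -> {subset mirror L p <= [:: 0; L]}.
Proof.
move=> L0 pE x; rewrite mem_cat => /orP[|/mapP[y]]; first exact: H_ends.
have pE' : L - p = 0 \/ L - p = L by case: pE => ->; rewrite ?subr0 ?subrr; [right|left].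
by move/(H_ends L0 pE'); rewrite !inE => /orP[] /eqP -> ->; rewrite ?subr0 ?subrr eqxx ?orbT.
Qed.

Lemma breaks_range s x : nonneg s -> x \in breaks s -> 0 <= x <= total s.
Proof.
move=> s0 /breaksP[s1 [s2 [ss ->]]].
move: s0; rewrite ss /nonneg all_cat => /andP[/total_ge0 h1 /total_ge0 h2].
by rewrite h1 total_cat lerDl.
Qed.

Lemma interior_range s x : nonneg s -> x \in interior s -> 0 <= x <= total s.
Proof.
move=> s0 xs; apply: breaks_range => //.
case: s s0 xs => [//|a s] s0 xs.
by rewrite breaks_interior // inE mem_rcons inE xs !orbT.
Qed.

Lemma spread_path s : nonneg s ->
  path <=%R 0 (rcons (isort (flatten [seq mirror (total s) p | p <- interior s])) (total s)).
Proof.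
move=> s0; have all_in x : x \in flatten [seq mirror (total s) p | p <- interior s] ->
    0 <= x <= total s.
  case/flatten_mapP => p /(interior_range s0) /mirror_range /allP; exact.
rewrite rcons_path isort_path /=; last by apply/allP => x /all_in /andP[].
have := mem_last 0 (isort (flatten [seq mirror (total s) p | p <- interior s])).
rewrite inE => /orP[/eqP ->|]; first exact: total_ge0.
by rewrite (perm_mem (perm_isort _)) => /all_in /andP[].
Qed.

Lemma nonneg_spread s : nonneg s -> nonneg (spread s).
Proof. by move=> s0; apply/nonneg_differences/spread_path. Qed.

Lemma total_spread s : total (spread s) = total s.
Proof. by rewrite total_differences last_rcons. Qed.

Lemma spread_neq0 s : spread s != [::].
Proof. by rewrite -size_eq0 size_pairmap size_rcons. Qed.

(** By [H_ends] the two ends may be counted among the marks without creating new points. Hence the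
    result depends only on the set [breaks s], and not on lengths 0 or repeated marks. *)
Lemma breaks_spread s x : nonneg s -> s != [::] ->
  (x \in breaks (spread s)) =
  [|| x == 0, x == total s | has (fun p => x \in mirror (total s) p) (breaks s)].
Proof.
move=> s0 sN; rewrite breaks_differences inE mem_rcons inE (perm_mem (perm_isort _)).
rewrite breaks_interior //.
have [//|xn0] := eqVneq x 0; have [//|xnL] := eqVneq x (total s); rewrite /=.
have ends p : p = 0 \/ p = total s -> x \in mirror (total s) p = false.
  move=> pE; apply/negP => /(mirror_ends (total_ge0 s0) pE).
  by rewrite !inE (negbTE xn0) (negbTE xnL).
rewrite has_rcons !ends /=; [|by right|by left].
by apply/flatten_mapP/hasP => -[p ps xp]; exists p.
Qed.

Lemma spread_breaks s t : nonneg s -> nonneg t -> s != [::] -> t != [::] ->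
  breaks s =i breaks t -> breaks (spread s) =i breaks (spread t).
Proof.
move=> s0 t0 sN tN st x; rewrite !breaks_spread // -(eq_breaks_total s0 t0 st).
by rewrite (eq_has_r st).
Qed.

(** Reversal exchanges [p] and [L - p], and [mirror] was made symmetric under this exchange. *)
Lemma spread_rev s : nonneg s -> s != [::] ->
  breaks (spread (rev s)) =i breaks (rev (spread s)).
Proof.
move=> s0 sN x.
have s0' : nonneg (rev s) by rewrite /nonneg all_rev.
have sN' : rev s != [::] by rewrite -size_eq0 size_rev size_eq0.
rewrite breaks_rev !breaks_spread // total_spread total_rev.
rewrite orbCA subr_eq0 [_ == x]eq_sym -[X in _ - x == X]subr0 (inj_eq (subrI _)).
congr [|| _, _ | _]; apply/hasP/hasP => -[p ps xp].
  exists (total s - p); first by rewrite -breaks_rev.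
  by rewrite mirror_sym subKr.
by exists (total s - p); rewrite ?breaks_rev ?subKr ?mirror_sym.
Qed.

Lemma spread_zero s : nonneg s -> total s = 0 -> all (fun x => x == 0) (spread s).
Proof.
move=> s0 t0; have h0 := nonneg_spread s0.
have /eqP := total_spread s; rewrite t0 /total big_seq psumr_eq0; last first.
  by move=> x xs; exact: (allP h0).
by move/allP => h; apply/allP => x xs; have := h x xs; rewrite xs.
Qed.

End Spread.

Section Stages.
Variable R : realFieldType.
Implicit Types (s L p x : R).

(** Of the two points in [stage1], the one that falls outside the edge is moved to an end, where it
    does not count as a mark. *)
Definition clamp L x : R := Num.min (Num.max x 0) L.

(** Slope 3 fits a length [L] backwards and [2 * L] forwards into the time [L]: the value falls from
    0 to [- L] at [p = L / 3] and then rises to [L] at [p = L]. *)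
Definition stretch L p : R := Num.max (- (3 * p)) (3 * p - 2 * L).

(* Seen in the circle obtained from [[0, L]] by gluing its ends, [p] moves to
   [stretch L p], which runs through the circle once backwards and then twice
   forwards.  A point [x] of [[- L, L]] stands for [x] or [x + L]. *)
Definition stage1 s L p : seq R :=
  let x := (1 - s) * p + s * stretch L p in [:: clamp L x; clamp L (x + L)].

(* [stretch L p] is also the union of two loops of degree 0, which are
   shrunk. *)
Definition stage2 s L p : seq R :=
  [:: L + (1 - s) * Num.min (stretch L p) 0;
      L + (1 - s) * Num.max (Num.max (- (3 * p)) (- L)) (3 * p - 3 * L)].

Lemma clamp_range L x : 0 <= L -> 0 <= clamp L x <= L.
Proof. by move=> L0; rewrite /clamp ge_min le_min lexx orbT andbT L0 andbT le_max lexx orbT. Qed.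

Lemma clamp_id L x : 0 <= x <= L -> clamp L x = x.
Proof. by case/andP=> x0 xL; rewrite /clamp (max_idPl x0) (min_idPl xL). Qed.

Lemma clamp_le0 L x : 0 <= L -> x <= 0 -> clamp L x = 0.
Proof. by move=> L0 x0; rewrite /clamp (max_idPr x0) (min_idPl L0). Qed.

Lemma clamp_ge L x : 0 <= L -> L <= x -> clamp L x = L.
Proof.
move=> L0 Lx; rewrite /clamp; have x0 := le_trans L0 Lx.
by rewrite (max_idPl x0) (min_idPr Lx).
Qed.

Lemma stage1_range s L p : 0 <= p <= L -> all (fun x => 0 <= x <= L) (stage1 s L p).
Proof. by case/andP=> p0 pL; rewrite /= !clamp_range // (le_trans p0 pL). Qed.

(** The functions [p] and [stretch L p] agree at both ends, so the straight-line homotopy between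
    them does not move there. *)
Lemma stage1_ends s L p : 0 <= L -> p = 0 \/ p = L ->
  {subset stage1 s L p <= [:: 0; L]}.
Proof.
move=> L0 pE; have [x [x0 xE]] : exists x, (x = 0 \/ x = L) /\ (1 - s) * p + s * stretch L p = x.
  case: pE => ->; [exists 0|exists L]; split; rewrite ?(or_introl, or_intror) //; [by left| |by right|].
    by rewrite /stretch !mulr0 oppr0 sub0r (max_idPl _) ?oppr_le0 ?mulr_ge0 // !mulr0 addr0.
  rewrite /stretch; have -> : 3 * L - 2 * L = L by ring.
  rewrite (max_idPr _); first by ring.
  by lra.
move=> y; rewrite /stage1 xE !inE.
case: x0 => ->; rewrite ?add0r => /orP[] /eqP ->.
- by rewrite clamp_le0 // eqxx.
- by rewrite clamp_ge // eqxx orbT.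
- by rewrite clamp_ge // eqxx orbT.
- by rewrite clamp_ge ?lerDl // eqxx orbT.
Qed.

(** The first loop of degree 0: back to [- L] at [L / 3], forwards to 0 at [2 * L / 3], then at
    rest. Adding [L] turns it into a path on the edge. *)
Lemma loop1_range L p : 0 <= p <= L -> - L <= Num.min (stretch L p) 0 <= 0.
Proof.
case/andP=> p0 pL; rewrite le_min ge_min lexx orbT andbT /stretch le_max.
apply/andP; split; last by lra.
by case: (leP (- L) (- (3 * p))) => //= h; lra.
Qed.

(** The second loop of degree 0: back to [- L] at [L / 3], at rest until [2 * L / 3], then forwards
    to 0. *)
Lemma loop2_range L p : 0 <= p <= L ->
  - L <= Num.max (Num.max (- (3 * p)) (- L)) (3 * p - 3 * L) <= 0.
Proof.
case/andP=> p0 pL; rewrite !le_max lexx orbT /= !ge_max.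
by apply/andP; split; [apply/andP; split|]; lra.
Qed.

Lemma stage2_range s L p : 0 <= s <= 1 -> 0 <= p <= L ->
  all (fun x => 0 <= x <= L) (stage2 s L p).
Proof.
move=> s01 pL.
have h y : - L <= y <= 0 -> 0 <= L + (1 - s) * y <= L.
  case/andP=> Ly y0; case/andP: s01 => s0 s1.
  have u0 : 0 <= 1 - s by rewrite subr_ge0.
  have u1 : 1 - s <= 1 by rewrite gerBl.
  apply/andP; split; last by rewrite gerDl mulr_ge0_le0.
  rewrite -lerBlDl sub0r; apply: le_trans Ly _.
  have : s * y <= 0 by rewrite mulr_ge0_le0.
  by rewrite mulrBl mul1r; lra.
by rewrite /= !h ?loop1_range ?loop2_range.
Qed.

Lemma stage2_ends s L p : 0 <= L -> p = 0 \/ p = L ->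
  {subset stage2 s L p <= [:: 0; L]}.
Proof.
move=> L0 pE; rewrite /stage2; have [-> ->] : Num.min (stretch L p) 0 = 0 /\
    Num.max (Num.max (- (3 * p)) (- L)) (3 * p - 3 * L) = 0.
  rewrite /stretch; case: pE => ->; rewrite ?mulr0 ?oppr0 ?subrr ?sub0r.
    have L2 : - (2 * L) <= 0 by rewrite oppr_le0 mulr_ge0.
    have L3 : - (3 * L) <= 0 by rewrite oppr_le0 mulr_ge0.
    have L1 : - L <= 0 by rewrite oppr_le0.
    by rewrite (max_idPl L2) (max_idPl L1) (max_idPl L3) minxx.
  have h : 3 * L - 2 * L = L by ring.
  have L3 : - (3 * L) <= L by lra.
  have L1 : Num.max (- (3 * L)) (- L) <= 0 by rewrite ge_max !oppr_le0 mulr_ge0.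
  by rewrite h (max_idPr L3) (min_idPr L0) (max_idPr L1).
by move=> y; rewrite !mulr0 addr0 !inE => /orP[] ->; rewrite orbT.
Qed.

Lemma stage1_start L p : 0 <= p <= L -> stage1 0 L p = [:: p; L].
Proof.
move=> pL; rewrite /stage1 subr0 mul1r mul0r addr0 clamp_id // clamp_ge //.
  by case/andP: pL; exact: le_trans.
by case/andP: pL => p0 _; rewrite lerDr.
Qed.

Lemma stage2_end L p : stage2 1 L p = [:: L; L].
Proof. by rewrite /stage2 subrr !mul0r addr0. Qed.

(** On the first third both loops run back together. On the second third one returns while the other
    rests at 0, and on the last third the other returns while the first rests at [L]. Apart from the
    ends, this leaves exactly the single moving point of [stage1]. *)
Lemma stage12 L p x : 0 <= p <= L ->
  x \in [:: 0, L & stage1 1 L p] = (x \in [:: 0, L & stage2 0 L p]).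
Proof.
move=> pL; have /andP[p0 pL'] := pL; have L0 := le_trans p0 pL'.
rewrite /stage1 /stage2 subrr mul0r add0r subr0 !mul1r !inE.
have [h1|h1] := leP (3 * p) L.
  have -> : stretch L p = - (3 * p) by rewrite /stretch (max_idPl _) //; lra.
  have -> : clamp L (- (3 * p)) = 0 by rewrite clamp_le0 //; lra.
  rewrite clamp_id; last by apply/andP; split; lra.
  have -> : Num.min (- (3 * p)) 0 = - (3 * p) by rewrite (min_idPl _) //; lra.
  have -> : Num.max (- (3 * p)) (- L) = - (3 * p) by rewrite (max_idPl _) //; lra.
  have -> : Num.max (- (3 * p)) (3 * p - 3 * L) = - (3 * p) by rewrite (max_idPl _) //; lra.
  by rewrite [L + _]addrC; case: (x == 0); case: (x == L); case: (x == _).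
have -> : stretch L p = 3 * p - 2 * L by rewrite /stretch (max_idPr _) //; lra.
have -> : Num.max (- (3 * p)) (- L) = - L by rewrite (max_idPr _) //; lra.
have [h2|h2] := leP (3 * p) (2 * L).
  have -> : clamp L (3 * p - 2 * L) = 0 by rewrite clamp_le0 //; lra.
  rewrite clamp_id; last by apply/andP; split; lra.
  have -> : Num.min (3 * p - 2 * L) 0 = 3 * p - 2 * L by rewrite (min_idPl _) //; lra.
  have -> : Num.max (- L) (3 * p - 3 * L) = - L by rewrite (max_idPl _) //; lra.
  rewrite subrr [L + _]addrC.
  by case: (x == 0); case: (x == L); case: (x == _).
have -> : clamp L (3 * p - 2 * L) = 3 * p - 2 * L by rewrite clamp_id //; apply/andP; split; lra.
rewrite clamp_ge //; last by lra.
have -> : Num.min (3 * p - 2 * L) 0 = 0 by rewrite (min_idPr _) //; lra.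
have -> : Num.max (- L) (3 * p - 3 * L) = 3 * p - 3 * L by rewrite (max_idPr _) //; lra.
have -> : L + (3 * p - 3 * L) = 3 * p - 2 * L by ring.
by rewrite addr0; case: (x == 0); case: (x == L); case: (x == _).
Qed.

End Stages.

Section SpreadStages.
Variable R : realFieldType.
Implicit Types (s t : seq R) (x L p u : R) (H : R -> R -> seq R).

Definition admissible H : Prop :=
  (forall L p, 0 <= p <= L -> all (fun x => 0 <= x <= L) (H L p)) /\
  (forall L p, 0 <= L -> p = 0 \/ p = L -> {subset H L p <= [:: 0; L]}).

Lemma stage1_admissible u : admissible (stage1 u).
Proof. by split; [exact: stage1_range|exact: stage1_ends]. Qed.

Lemma stage2_admissible u : 0 <= u <= 1 -> admissible (stage2 u).
Proof. by move=> u01; split=> *; [exact: stage2_range|exact: stage2_ends]. Qed.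

(** The ends are vertices in any case, so the moved marks matter only up to 0 and [L]; reflection
    preserves this set of ends. *)
Lemma spread_congr H H' s : admissible H -> admissible H' ->
  (forall L p x, 0 <= p <= L -> x \in [:: 0, L & H L p] = (x \in [:: 0, L & H' L p])) ->
  nonneg s -> s != [::] -> breaks (spread H s) =i breaks (spread H' s).
Proof.
move=> [Hr He] [Hr' He'] HH' s0 sN x; rewrite !breaks_spread //.
have [//|x0] := eqVneq x 0; have [//|xL] := eqVneq x (total s); rewrite !orFb.
apply: eq_in_has => p ps; have pL := breaks_range s0 ps.
have pL' : 0 <= total s - p <= total s.
  by case/andP: pL => p0 pL; rewrite subr_ge0 pL gerBl.
have h q y : y != 0 -> y != total s -> 0 <= q <= total s ->
    (y \in H (total s) q) = (y \in H' (total s) q).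
  by move=> y0 yL /(HH' _ _ y); rewrite !inE (negbTE y0) (negbTE yL).
rewrite !mem_cat h //; congr (_ || _); apply/mapP/mapP => -[y yH xE]; exists y => //.
  rewrite -h //.
    by apply: contraNneq xL => yE; rewrite xE yE subr0.
  by apply: contraNneq x0 => yE; rewrite xE yE subrr.
rewrite h //.
  by apply: contraNneq xL => yE; rewrite xE yE subr0.
by apply: contraNneq x0 => yE; rewrite xE yE subrr.
Qed.

Lemma spread_start s : nonneg s -> s != [::] -> breaks (spread (stage1 0) s) =i breaks s.
Proof.
move=> s0 sN x.
have adm : admissible (fun L p => [:: p]).
  by split=> [L p /= ->//|L p _ pE y]; rewrite !inE => /eqP ->; case: pE => ->; rewrite eqxx ?orbT.
rewrite (spread_congr (stage1_admissible 0) adm) // => [|L p y pL].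
  have [a1 a2] := adm; rewrite breaks_spread //.
  apply/idP/idP => [|xs].
    case/or3P => [/eqP ->|/eqP ->|/hasP[p ps]].
    - by rewrite breaks_interior // mem_head.
    - by rewrite breaks_interior // inE mem_rcons mem_head orbT.
    - by rewrite /mirror /= subKr !inE orbb => /eqP ->.
  by apply/or3P/Or33/hasP; exists x; rewrite // mem_head.
by rewrite stage1_start // !inE orbA orbC; case: (y == L); case: (y == 0); case: (y == p).
Qed.

Lemma spread_middle s : nonneg s -> s != [::] ->
  breaks (spread (stage1 1) s) =i breaks (spread (stage2 0) s).
Proof.
move=> s0 sN; apply: spread_congr => //; first exact: stage1_admissible.
  by apply: stage2_admissible; rewrite lexx ler01.
by move=> L p x; exact: stage12.
Qed.

Lemma spread_end s : nonneg s -> s != [::] ->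
  breaks (spread (stage2 1) s) =i breaks [:: total s].
Proof.
move=> s0 sN x.
have [a1 a2] : admissible (stage2 1) by apply: stage2_admissible; rewrite ler01 lexx.
have -> : (x \in breaks [:: total s]) = (x == 0) || (x == total s).
  by rewrite /breaks /= add0r !inE.
rewrite breaks_spread //.
have [//|xN0] := eqVneq x 0; have [//|xL] := eqVneq x (total s); rewrite !orFb.
apply/hasPn => p _; rewrite /mirror !stage2_end /= subrr !inE.
by rewrite (negbTE xN0) (negbTE xL).
Qed.

Lemma spread1 H L : spread H [:: L] = [:: L].
Proof. by rewrite /spread /differences /= subr0 /total big_seq1. Qed.

End SpreadStages.

Lemma oriented_iso_comp (V1 E1 V2 E2 V3 E3 : finType) (G1 : wgraph V1 E1)
    (G2 : wgraph V2 E2) (G3 : wgraph V3 E3) fV fE o hV hE r :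
  oriented_iso G1 G2 fV fE o -> oriented_iso G2 G3 hV hE r ->
  oriented_iso G1 G3 (hV \o fV) (hE \o fE) (fun e => o e (+) r (fE e)).
Proof.
move=> [bV bE ends w] [bV' bE' ends' w']; split.
- exact: bij_comp.
- exact: bij_comp.
- by move=> e k; rewrite /= ends' ends -addbA [r _ (+) _]addbC.
- by move=> v; rewrite /= w' w.
Qed.

(** Both graphs are isomorphic to the same standard subdivision, by maps that respect the positions
    on the chains and hence the labels. *)
Lemma same_subdivision_iso (T : Type) (VB EB : finType) (B : wgraph VB EB)
    (V1 E1 V2 E2 : finType) (G1 : wgraph V1 E1) (G2 : wgraph V2 E2) st1 st2 f1 c1 f2 c2
    (x1 : E1 -> T) (x2 : E2 -> T) :
  (forall v, ~~ st1 v -> bivalent0 G1 v) -> (forall v, ~~ st2 v -> bivalent0 G2 v) ->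
  subdivision B G1 st1 f1 c1 -> subdivision B G2 st2 f2 c2 ->
  (forall v, weight G1 (f1 v) = weight B v) -> (forall v, weight G2 (f2 v) = weight B v) ->
  (forall b, [seq x1 d.1 | d <- c1 b] = [seq x2 d.1 | d <- c2 b]) -> (0 < #|E1|)%N ->
  exists fV fE, isomorphism G1 G2 fV fE /\ forall e, x1 e = x2 (fE e).
Proof.
move=> bi1 bi2 sub1 sub2 w1 w2 x12 /card_gt0P[e1 _].
have [b0 [d0 d0b _]] := sub_edge sub1 e1.
have size12 b : size (c1 b) = size (c2 b).
  by rewrite -(size_map (fun d => x1 d.1)) x12 size_map.
have [e2 _] : exists e2 : E2, true.
  have := sub_chain sub2 b0; case: (c2 b0) => [//|[e2 k] s] _; by exists e2.
pose n b := (size (c1 b)).-1.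
have sz1 b : size (c1 b) = (n b).+1.
  by rewrite prednK // lt0n size_eq0; exact: chain_neq0 (sub_chain sub1 b).
have sz2 b : size (c2 b) = (n b).+1 by rewrite -size12.
have [r1 iso1] := isomorphism_oriented (sub_isomorphism (e1, false) bi1 sub1 sz1 w1).
have [r2 iso2] := isomorphism_oriented (sub_isomorphism (e2, false) bi2 sub2 sz2 w2).
have [gV [gE [_ _ fEK gEK iso1']]] := oriented_iso_inv iso1.
do 2!eexists; split; first exact: oriented_isomorphism (oriented_iso_comp iso1' iso2).
move=> e; rewrite /= -{1}[e]gEK; case: (gE e) => b i.
rewrite /sub_segment /sub_dart /=.
have := congr1 (fun s => nth (x1 e1) s i) (x12 b).
rewrite (nth_map (e1, false)) ?sz1 // (nth_map (e2, false)) ?sz2 //.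
Qed.

(** * Points of the glued space and their chains *)

Section Points.
Variables (R : realType) (K : set graph).
Local Open Scope classical_set_scope.
Local Notation D := (disjoint_simplices R K).

Lemma simplex_row (G : graph) (x : 'I_(nedge G) -> R) :
  (forall e, 0 <= x e) -> \sum_e x e = 1 -> simplex R G (\row_e x e).
Proof.
move=> x0 x1; split=> [e|]; first by rewrite mxE.
by rewrite -x1; apply: eq_bigr => e _; rewrite mxE.
Qed.

Definition mk_point (G : graph) (KG : K G) (x : 'I_(nedge G) -> R)
    (hx : simplex R G (\row_e x e)) : D :=
  existT (fun G : K => simplex R (sval G)) (exist (fun G => G \in K) G (mem_set KG))
    (exist (fun v => v \in simplex R G) _ (mem_set hx)).

Lemma coord_mk_point G (KG : K G) x (hx : simplex R G (\row_e x e)) e :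
  coord R K (mk_point KG hx) e = x e.
Proof. by rewrite /coord /= mxE. Qed.

Lemma coord_ge0 (p : D) e : 0 <= coord R K p e.
Proof. by case: p e => G [x xP] e; have [h _] := set_mem xP; exact: h. Qed.

Lemma sum_coord (p : D) : \sum_e coord R K p e = 1.
Proof. by case: p => G [x xP]; have [_ h] := set_mem xP; exact: h. Qed.

Lemma dgraph_in (p : D) : K (dgraph p).
Proof. exact: set_mem (svalP (projT1 p)). Qed.

(** A presentation describes [p] by a stable graph and the successive lengths along its edges. By
    [presents_unique] it is determined up to isomorphism and reversal of chains, so constructions
    may use any choice of it. *)
Definition presents (p : D) (B : graph) (s : 'I_(nedge B) -> seq R) : Prop :=
  exists f c, [/\ subdivision B (dgraph p) (stable_vertex (dgraph p)) f c,
    forall v, weight (dgraph p) (f v) = weight B v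
    & forall b, s b = [seq coord R K p d.1 | d <- c b]].
Arguments presents p B s : clear implicits.

Definition lengths (B : graph) (s : 'I_(nedge B) -> seq R) : Prop :=
  [/\ forall b, nonneg (s b), forall b, s b != [::] & \sum_b total (s b) = 1].

Lemma presents_lengths p B s : presents p B s -> lengths s.
Proof.
case=> f [c [sub w sE]]; split=> [b|b|].
- by rewrite sE; apply/allP => _ /mapP[d _ ->]; exact: coord_ge0.
- by rewrite sE -size_eq0 size_map size_eq0; exact: chain_neq0 (sub_chain sub b).
rewrite -(sum_coord p) -(sub_big sub +%R (coord R K p)).
by apply: eq_bigr => b _; rewrite sE /total big_map.
Qed.

Lemma presents_oriented p (B B' : graph) s fV fE o : presents p B s ->
  oriented_iso B B' fV fE o ->
  exists2 s', presents p B' s' & forall b, s' (fE b) = if o b then rev (s b) else s b.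
Proof.
case=> f [c [sub w sE]] iso; have [f' [c' [sub' f'E c'E]]] := sub_iso_source sub iso.
exists (fun b => [seq coord R K p d.1 | d <- c' b]).
  exists f', c'; split=> // v; have [[h hK Kh] _ _ wB] := iso.
  by rewrite -[v]Kh f'E w wB.
move=> b; rewrite c'E sE; case: (o b) => //.
by rewrite (map_comp (coord R K p) fst) map_fst_revchain map_rev -map_comp.
Qed.

Variable g : nat.
Hypothesis K_neq2 : K `<=` neq2_graphs g.

Lemma dgraph_bivalent (p : D) v :
  ~~ stable_vertex (dgraph p) v -> bivalent0 (dgraph p) v.
Proof.
have [_ _ _ /(_ v) + _] := K_neq2 (dgraph_in p).
by case: (stable_vertex _ v).
Qed.

Lemma presents_unique p (B B' : graph) s s' : presents p B s -> presents p B' s' ->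
  exists fV fE o, oriented_iso B B' fV fE o /\
    forall b, s' (fE b) = if o b then rev (s b) else s b.
Proof.
case=> f [c [sub w sE]] [f' [c' [sub' w' sE']]].
have val2 v : ~~ stable_vertex (dgraph p) v -> valency (dgraph p) v = 2.
  by case/dgraph_bivalent/andP => /eqP.
have [fV [fE [r [iso _ c'E]]]] := sub_unique val2 sub sub' w w'.
exists fV, fE, r; split=> // b; rewrite sE' c'E sE; case: (r b) => //.
by rewrite (map_comp (coord R K p) fst) map_fst_revchain map_rev -map_comp.
Qed.

Lemma dgraph_edges (p : D) : (0 < #|'I_(nedge (dgraph p))|)%N.
Proof.
rewrite card_ord lt0n; apply/eqP => n0; have := sum_coord p.
rewrite big1 => [|e _]; last by have := ltn_ord e; rewrite [X in (_ < X)%N -> _]n0.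
by move/eqP; rewrite eq_sym oner_eq0.
Qed.

(** A criterion for a face identification: only the lengths of [q] along its chains are compared,
    since a presentation determines graph and coordinates up to isomorphism. *)
Lemma contract_face_glue p q (B B'' : graph) f c
    (gam : {set 'I_(nedge (dgraph p))}) (gB : {set 'I_(nedge B)}) fV fE o s'' :
  subdivision B (dgraph p) (stable_vertex (dgraph p)) f c ->
  (forall v, weight (dgraph p) (f v) = weight B v) ->
  gam \proper [set: 'I_(nedge (dgraph p))]%SET ->
  (forall e, e \in gam -> coord R K p e = 0) ->
  gB = contracted_edges c gam ->
  oriented_iso (contract B gB) B'' fV fE o ->
  presents q B'' s'' ->
  (forall b, let s := [seq coord R K p d.1 | d <- c (sval b) & d.1 \notin gam] in
     s'' (fE b) = if o b then rev s else s) ->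
  glue p q.
Proof.
move=> sub w gamP gam0 gBE; subst gB => iso [f'' [c'' [sub'' w'' sE'']]] sE.
have /neq2_wgraphE neq2 := K_neq2 (dgraph_in p); have [_ conn _ bi _] := neq2.
have [f' [f'E sub']] := subdivision_contract sub bi gamP.
have w' := subdivision_contract_weight sub bi w gamP f'E sub'.
have [h [a [suba hE aE]]] := sub_iso_source sub' iso.
have bi' C : ~~ stable_vertex (contract (dgraph p) gam) C -> bivalent0 (contract (dgraph p) gam) C.
  by have := contract_bivalent gamP neq2 C; case: (stable_vertex _ C).
apply/asboolP; apply: rst_step; right; exists gam; split=> //.
apply: (@same_subdivision_iso R _ _ _ _ _ _ _ _ _ _ _ _ _ _ _
  (coord R K q) (fun e => coord R K p (sval e)) (@dgraph_bivalent q) bi' sub'' suba w'' _ _ (dgraph_edges q)).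
  move=> v; have [[k kK Kk] _ _ wB] := iso.
  by rewrite -[v]Kk hE w' wB.
move=> b; have [_ [k kK Kk] _ _] := iso.
rewrite -[b]Kk -sE'' sE aE /=; case: (o (k b)).
  by rewrite (map_comp (fun e => coord R K p (sval e)) fst) map_fst_revchain map_rev
    -map_comp -contract_chain_map.
by rewrite -contract_chain_map.
Qed.

End Points.
Arguments presents {R K} p B s.

Section Neq2Points.
Variables (R : realType) (g : nat).
Local Open Scope classical_set_scope.
Local Notation D := (disjoint_simplices R (neq2_graphs g)).

Section SubPoint.
Variables (B : graph) (n : 'I_(nedge B) -> nat).
Hypothesis stB : stable_graphs g B.

(** The numbers of new vertices are kept apart from the lengths, so that the graph stays the same
    while the lengths vary continuously. *)
Definition sub_graph : graph := ord_graph (subdivide B n).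

Lemma sub_graph_neq2 : neq2_graphs g sub_graph.
Proof.
apply/neq2_wgraphE; apply: iso_neq2_wgraph (ord_graph_iso _) _.
by apply: subdivide_neq2; apply/stable_wgraphE.
Qed.

Variable s : 'I_(nedge B) -> seq R.

Definition sub_coord (e : 'I_(nedge sub_graph)) : R :=
  let x : {b & 'I_(n b).+1} := enum_val e in nth 0 (s (tag x)) (tagged x).

Hypotheses (sP : lengths s) (sz : forall b, size (s b) = (n b).+1).

Lemma sub_coord_simplex : simplex R sub_graph (\row_e sub_coord e).
Proof.
have [s0 _ s1] := sP; apply: simplex_row => [e|].
  rewrite /sub_coord; case: (enum_val e) => b i /=.
  by apply: (allP (s0 b)); rewrite mem_nth // sz.
rewrite -s1 /sub_coord.
pose F (x : {b & 'I_(n b).+1}) := nth 0 (s (tag x)) (tagged x).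
rewrite -(big_enum_val (A := predT) (fun x : {b & 'I_(n b).+1} => F x)).
have -> : (\sum_b total (s b) = \sum_b \sum_(i < (n b).+1) nth 0 (s b) i).
  by apply: eq_bigr => b _; rewrite /total (big_nth 0) big_mkord sz.
by rewrite sig_big_dep.
Qed.

Definition sub_point : D := mk_point sub_graph_neq2 sub_coord_simplex.

Lemma presents_sub_point : presents sub_point B s.
Proof.
have iso := ord_graph_iso (subdivide B n).
have [_ _ _ st] := stB.
have stE v : stable_vertex sub_graph (enum_rank v) = is_old v.
  rewrite (iso_stable iso); case: v => [v|x]; last exact: subdivide_stable_new.
  by rewrite subdivide_stable_old st.
have [c' sub' c'E] := sub_iso_target (subdivide_sub B n) iso stE.
exists (enum_rank \o inl), c'; split=> // [v|b]; first by rewrite /= enum_rankK.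
rewrite (map_comp (coord R _ sub_point) fst) c'E -map_comp.
rewrite /subdivide_chain -map_comp.
apply: (@eq_from_nth _ 0); first by rewrite size_map size_enum_ord sz.
move=> i; rewrite sz => ilt.
rewrite (nth_map (Ordinal ilt)) ?size_enum_ord //=.
rewrite coord_mk_point /sub_coord enum_rankK /=.
by rewrite -[X in nth _ _ X = _]/(nat_of_ord (Ordinal ilt)) nth_enum_ord.
Qed.

End SubPoint.

Lemma lengths_point B (s : 'I_(nedge B) -> seq R) : stable_graphs g B -> lengths s ->
  exists p : D, presents p B s.
Proof.
move=> stB sP; have [s0 sN _] := sP.
have sz b : size (s b) = (size (s b)).-1.+1 by rewrite prednK // lt0n size_eq0.
by exists (sub_point stB sP sz); exact: presents_sub_point.
Qed.

Let neq2P : neq2_graphs g `<=` neq2_graphs g := fun _ h => h.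

Lemma total_eq0 (t : seq R) : nonneg t -> (total t == 0) = all (fun x => x == 0) t.
Proof.
move=> /allP t0; rewrite /total big_seq psumr_eq0 //.
by apply: eq_in_all => x xt; rewrite xt.
Qed.

(* Both points have the same contraction of their edges of length 0. *)
Lemma eq_breaks_glue (p q : D) (B : graph) s t : stable_graphs g B ->
  presents p B s -> presents q B t -> (forall b, breaks (s b) =i breaks (t b)) ->
  glue p q.
Proof.
move=> stB ps qt st.
have [s0 sN s1] := presents_lengths ps; have [t0 _ _] := presents_lengths qt.
have filt b : [seq x <- s b | x != 0] = [seq x <- t b | x != 0].
  exact: eq_breaks_filter.
pose gB := [set b | all (fun x => x == 0) (s b)]%SET.
have gBp : gB \proper [set: 'I_(nedge B)]%SET.
  rewrite properT; apply/eqP => gT; suff: (1 : R) == 0 by rewrite oner_eq0.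
  rewrite -s1; apply/eqP/big1 => b _.
  by apply/eqP; rewrite total_eq0 //; have : b \in gB by [rewrite gT]; rewrite inE.
have isoB := ord_graph_iso (contract B gB).
set B'' := ord_graph _ in isoB.
have stB'' : stable_graphs g B''.
  apply/stable_wgraphE; apply: iso_stable_wgraph isoB _.
  by apply: contract_stable_wgraph => //; apply/stable_wgraphE.
pose s'' (b : 'I_(nedge B'')) :=
  [seq x <- s (sval (enum_val b : {b | b \notin gB})) | x != 0].
have s''P : lengths s''.
  split=> [b|b|].
  - by apply/allP => x; rewrite mem_filter => /andP[_ /(allP (s0 _))].
  - have := svalP (enum_val b : {b | b \notin gB}); rewrite inE => /allPn[x xs x0].
    by rewrite -has_filter; apply/hasP; exists x.
  rewrite /s'' -(big_enum_val (A := predT)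
    (fun x : {b | b \notin gB} => total [seq y <- s (sval x) | y != 0])) /=.
  rewrite -(big_sig _ (fun b => b \notin gB) (fun b => total [seq y <- s b | y != 0])).
  under eq_bigr do rewrite total_filter.
  rewrite -s1 [RHS](bigID (fun b => b \in gB)) /= [X in X + _]big1 ?add0r // => b.
  by rewrite inE -total_eq0 // => /eqP.
have [r rP] := lengths_point stB'' s''P.
(* Contracting all edges of length 0 in [u] leaves the nonzero lengths on each chain; the chains
   that disappear entirely are those of the edges in [gB]. The result is [r] for both points. *)
have half (u : D) w : presents u B w -> (forall b, [seq x <- w b | x != 0] = [seq x <- s b | x != 0]) ->
    glue u r.
  case=> f [c [sub wf wE]] ws.
  pose gam := [set e | coord R _ u e == 0]%SET.
  have kept b : [seq coord R _ u d.1 | d <- c b & d.1 \notin gam] = [seq x <- s b | x != 0].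
    rewrite -ws wE filter_map; congr map; apply: eq_filter => d /=; by rewrite inE.
  apply: (@contract_face_glue R _ g neq2P u r B B'' f c gam gB _ _ _ s'' sub wf _ _ _ isoB rP).
  - rewrite properT; apply/eqP => gT; suff: (1 : R) == 0 by rewrite oner_eq0.
    rewrite -(sum_coord u); apply/eqP/big1 => e _.
    by apply/eqP; have : e \in gam by [rewrite gT]; rewrite inE.
  - by move=> e; rewrite inE => /eqP.
  - apply/setP => b; rewrite !inE -[RHS]negbK -has_predC -[LHS]negbK -has_predC.
    congr negb; rewrite !has_filter -!size_eq0; congr (~~ (_ == _)).
    by have := congr1 size (kept b); rewrite size_map => /esym.
  - by move=> b /=; rewrite kept /s'' enum_rankK.
apply: glue_trans (half _ _ ps _) _ => //.
by rewrite glue_sym; apply: (half _ _ qt) => b; rewrite filt.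
Qed.

End Neq2Points.

Section GlueInvariance.
Variables (R : realType) (g : nat).
Local Open Scope classical_set_scope.
Local Notation D := (disjoint_simplices R (neq2_graphs g)).
Let neq2P : neq2_graphs g `<=` neq2_graphs g := fun _ h => h.

(** Here only complete chains are contracted, so the surviving chains keep all their lengths, zeros
    included. *)
Lemma presents_contract_glue (p q : D) (B B'' : graph) (gB : {set 'I_(nedge B)})
    fV fE o s s'' :
  presents p B s -> gB \proper [set: 'I_(nedge B)]%SET ->
  (forall b, b \in gB -> all (fun x => x == 0) (s b)) ->
  oriented_iso (contract B gB) B'' fV fE o -> presents q B'' s'' ->
  (forall b, s'' (fE b) = if o b then rev (s (sval b)) else s (sval b)) ->
  glue p q.
Proof.
case=> f [c [sub wf sE]] gBp s0 iso qs sE''.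
pose gam := [set e | [exists b in gB, e \in map fst (c b)]]%SET.
have gamE b d : d \in c b -> (d.1 \in gam) = (b \in gB).
  move=> db; rewrite inE; apply/existsP/idP => [[b' /andP[gb' /mapP[d' db' dd']]]|bg].
    by rewrite (sub_edge_uniq sub db db' dd').
  by exists b; rewrite bg map_f.
have hd b : exists d, d \in c b.
  have := sub_chain sub b; case: (c b) => [//|d s1] _.
  by exists d; rewrite mem_head.
apply: (@contract_face_glue R _ g neq2P p q B B'' f c gam gB fV fE o s'' sub wf _ _ _ iso qs).
- have /fintype.properP[_ [b _ bg]] := gBp; have [d db] := hd b.
  apply/fintype.properP; split; first exact: finset.subsetT.
  by exists d.1; rewrite ?(gamE _ _ db) ?finset.in_setT.
- move=> e; have [b [d db <-]] := sub_edge sub e; rewrite (gamE _ _ db) => /s0.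
  by rewrite sE => /allP/(_ (coord R _ p d.1))/(_ (map_f _ db))/eqP.
- apply/setP => b; rewrite inE; apply/idP/allP => [bg d db|ag]; first by rewrite (gamE _ _ db).
  by have [d db] := hd b; rewrite -(gamE _ _ db) ag.
move=> b s1; rewrite sE''.
suff -> : s1 = s (sval b) by [].
rewrite /s1 sE; congr map; apply/all_filterP/allP => d db.
by rewrite (gamE _ _ db) (svalP b).
Qed.

(** The face [q] arises by omitting some zeros from the lists of lengths; chains omitted entirely
    contract edges of [B], and elsewhere the positions of the vertices do not change. *)
Lemma face_glue_presents (p q : D) (B : graph) s : stable_graphs g B ->
  face_glue p q -> presents p B s ->
  exists (gB : {set 'I_(nedge B)}) s'', [/\ gB \proper [set: 'I_(nedge B)]%SET,
    forall b, b \in gB -> all (fun x => x == 0) (s b),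
    stable_graphs g (ord_graph (contract B gB)),
    presents q (ord_graph (contract B gB)) s''
  & forall b, breaks (s'' (enum_rank b)) =i breaks (s (sval b))].
Proof.
move=> stB [gam [gamP gam0 [hV [hE [hiso hc]]]]] [f [c [sub wf sE]]].
have /neq2_wgraphE neq2 := neq2P (dgraph_in p); have [_ conn _ bi _] := neq2.
have [f' [f'E sub']] := subdivision_contract sub bi gamP.
have w' := subdivision_contract_weight sub bi wf gamP f'E sub'.
set gB := contracted_edges c gam in f' f'E sub' w'.
have gBp : gB \proper [set: 'I_(nedge B)]%SET.
  have /fintype.properP[_ [e _ eg]] := gamP; have [b [d db de]] := sub_edge sub e.
  apply/fintype.properP; split; first exact: finset.subsetT.
  exists b; first by rewrite inE.
  by rewrite contracted_edgesN; apply/hasP; exists d; rewrite // de.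
have isoB := ord_graph_iso (contract B gB).
have [h [a [suba ha aE]]] := sub_iso_source sub' isoB.
have [r riso] := isomorphism_oriented hiso.
have [kV [kE [hVK kVK hEK kEK iso']]] := oriented_iso_inv riso.
have stE v : stable_vertex (dgraph q) (kV v) = stable_vertex (contract (dgraph p) gam) v.
  exact: iso_stable iso' v.
have [c3 sub3 c3E] := sub_iso_target suba iso' stE.
exists gB, (fun b => [seq coord R _ q d.1 | d <- c3 b]); split=> //.
- move=> b; rewrite inE sE => /allP bg; apply/allP => _ /mapP[d db ->].
  by rewrite gam0 // bg.
- apply/stable_wgraphE; apply: iso_stable_wgraph isoB _.
  by apply: contract_stable_wgraph => //; apply/stable_wgraphE.
- exists (kV \o h), c3; split=> // v; have [_ _ _ wk] := iso'.
  have [[m mK Km] _ _ wB] := isoB.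
  by rewrite -[(kV \o h) v]/(kV (h v)) wk -{1}[v]Km ha w' -wB Km.
move=> b x.
rewrite (map_comp (coord R _ q) fst) c3E -map_comp aE /= sE.
rewrite (eq_map (g := fun d => coord R _ p (sval d.1))); last by move=> d /=; rewrite hc kEK.
rewrite contract_chain_map.
rewrite -[LHS]breaks_filter -[RHS]breaks_filter !filter_map -filter_predI.
congr (x \in breaks (map _ _)); apply: eq_filter => d /=.
by case: (boolP (d.1 \in gam)) => [/gam0 ->|_]; rewrite ?eqxx ?andbT.
Qed.

Lemma glue_map (K : set graph) (Z : Type) (F : disjoint_simplices R K -> Z) :
  (forall p q, glue_step p q -> F p = F q) -> forall p q, glue p q -> F p = F q.
Proof.
move=> step p q /asboolP; elim=> {p q} [p q|p|p q _|p q r _ h1 _ h2] //.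
- exact: step.
- by rewrite h1.
Qed.

Lemma iso_glue_presents (K : set graph) (p q : disjoint_simplices R K) (B : graph) s :
  iso_glue p q -> presents p B s -> presents q B s.
Proof.
case=> hV [hE [/isomorphism_oriented[r iso] hc]] [f [c [sub wf sE]]].
have [c' sub' c'E] := sub_iso_target sub iso (iso_stable iso).
exists (hV \o f), c'; split=> // [v|b].
  by have [_ _ _ w] := iso; rewrite /= w wf.
rewrite sE (map_comp (coord R _ q) fst) c'E -map_comp.
by apply: eq_map => d /=; rewrite hc.
Qed.

Section SpreadInvariance.
Variable H : R -> R -> seq R.
Hypothesis admH : admissible H.

Lemma lengths_spread B (s : 'I_(nedge B) -> seq R) : lengths s ->
  lengths (fun b => spread H (s b)).
Proof.
have [a1 a2] := admH; case=> s0 sN s1; split=> [b|b|].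
- exact: nonneg_spread.
- exact: spread_neq0.
- by rewrite -s1; apply: eq_bigr => b _; rewrite total_spread.
Qed.

(** Two presentations of [p] differ by an isomorphism and reversals of edges, and [spread_rev]
    absorbs the reversals. *)
Lemma spread_presents_unique (p q q' : D) (B B' : graph) s s' :
  stable_graphs g B -> stable_graphs g B' ->
  presents p B s -> presents p B' s' ->
  presents q B (fun b => spread H (s b)) -> presents q' B' (fun b => spread H (s' b)) ->
  glue q q'.
Proof.
have [a1 a2] := admH.
move=> stB stB' ps ps' qs qs'; have [s0 sN _] := presents_lengths ps.
have [fV [fE [r [iso sE]]]] := presents_unique neq2P ps ps'.
have [t qt tE] := presents_oriented qs iso.
apply: (eq_breaks_glue stB' qt qs') => b.
have [_ [k kK Kk] _ _] := iso; rewrite -[b]Kk tE sE; case: (r _) => // x.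
by rewrite spread_rev.
Qed.

Lemma spread_presents_face (p p' q q' : D) (B B' : graph) s s' :
  stable_graphs g B -> stable_graphs g B' -> face_glue p p' ->
  presents p B s -> presents p' B' s' ->
  presents q B (fun b => spread H (s b)) -> presents q' B' (fun b => spread H (s' b)) ->
  glue q q'.
Proof.
have [a1 a2] := admH.
move=> stB stB' pp' ps ps' qs qs'; have [s0 sN _] := presents_lengths ps.
have [gB [s'' [gBp gB0 stB'' ps'' sE]]] := face_glue_presents stB pp' ps.
have [s0'' sN'' s1''] := presents_lengths ps''.
pose t (b : 'I_(nedge (ord_graph (contract B gB)))) : seq R :=
  spread H (s (sval (enum_val b : {b | b \notin gB}))).
have st b : breaks (t b) =i breaks (spread H (s'' b)).
  move=> x; rewrite /t; apply: spread_breaks => // y.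
  by rewrite -sE enum_valK.
have tP : lengths t.
  split=> [b|b|].
  - exact: nonneg_spread.
  - exact: spread_neq0.
  rewrite -s1''; apply: eq_bigr => b _; rewrite total_spread -[s'' b]/(s'' b).
  rewrite -(total_spread H (s'' b)) -(total_spread H (s _)).
  by apply: eq_breaks_total; [exact: nonneg_spread|exact: nonneg_spread|exact: st].
(* Two intermediate points on the contracted graph: [r] carries the moved lengths of the surviving
   chains of [p], and [w] the moves of the lengths of [p']. They have the same vertex positions,
   because [s] and [s''] do. *)
have [r rt] := lengths_point stB'' tP.
have [w ws] := lengths_point stB'' (lengths_spread (presents_lengths ps'')).
apply: (@glue_trans _ _ r).
  apply: (presents_contract_glue qs gBp _ (ord_graph_iso _) rt) => [b bg|b].
    apply: spread_zero => //; apply/eqP; rewrite total_eq0 //; exact: gB0.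
  by rewrite /t enum_rankK.
apply: (@glue_trans _ _ w); first exact: (eq_breaks_glue stB'' rt ws).
exact: spread_presents_unique stB'' stB' ps'' ps' ws qs'.
Qed.

End SpreadInvariance.
End GlueInvariance.

(** * Continuity *)

Section ContinuousSeq.
Variables (R : realType) (T : topologicalType).
Local Open Scope classical_set_scope.
Implicit Types (f h : T -> R) (s : T -> seq R).

Lemma continuousD f h : continuous f -> continuous h -> continuous (fun z => f z + h z).
Proof. by move=> cf ch z; exact: cvgD (cf z) (ch z). Qed.

Lemma continuousM f h : continuous f -> continuous h -> continuous (fun z => f z * h z).
Proof. by move=> cf ch z; exact: cvgM (cf z) (ch z). Qed.

Lemma continuousN f : continuous f -> continuous (fun z => - f z).
Proof. by move=> cf z; exact: cvgN (cf z). Qed.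

Lemma continuousB f h : continuous f -> continuous h -> continuous (fun z => f z - h z).
Proof. by move=> cf ch; apply: continuousD => //; exact: continuousN. Qed.

Lemma continuous_const (a : R) : continuous (fun _ : T => a).
Proof. exact: cst_continuous. Qed.

Lemma continuous_dist f h : continuous f -> continuous h ->
  continuous (fun z => `|f z - h z|).
Proof. by move=> cf ch z; apply: cvg_norm; exact: continuousB. Qed.

Lemma continuous_max f h : continuous f -> continuous h ->
  continuous (fun z => Num.max (f z) (h z)).
Proof.
move=> cf ch; rewrite (_ : (fun z => _) = (fun z => (f z + h z + `|f z - h z|) * 2^-1)).
  apply: (@continuousM (fun z => f z + h z + `|f z - h z|) (fun=> 2^-1)).
    apply: (@continuousD (fun z => f z + h z)); first exact: continuousD.
    exact: continuous_dist.
  exact: continuous_const.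
by apply/funext => z; rewrite maxr_absE.
Qed.

Lemma continuous_min f h : continuous f -> continuous h ->
  continuous (fun z => Num.min (f z) (h z)).
Proof.
move=> cf ch; rewrite (_ : (fun z => _) = (fun z => (f z + h z - `|f z - h z|) * 2^-1)).
  apply: (@continuousM (fun z => f z + h z - `|f z - h z|) (fun=> 2^-1)).
    apply: (@continuousB (fun z => f z + h z)); first exact: continuousD.
    exact: continuous_dist.
  exact: continuous_const.
by apply/funext => z; rewrite minr_absE.
Qed.

(** The constructors force the length to be constant on [T], so a list of this kind is a finite
    family of continuous functions. *)
Inductive continuous_seq : (T -> seq R) -> Prop :=
| ContinuousNil : continuous_seq (fun=> [::])
| ContinuousCons f s : continuous f -> continuous_seq s ->
    continuous_seq (fun z => f z :: s z).

Lemma continuous_seq_insert f s : continuous f -> continuous_seq s ->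
  continuous_seq (fun z => insert (f z) (s z)).
Proof.
move=> cf cs; elim: cs f cf => {s} [|h s ch cs IH] f cf /=.
  by apply: ContinuousCons => //; exact: ContinuousNil.
apply: ContinuousCons; first exact: continuous_min.
by apply: IH; exact: continuous_max.
Qed.

Lemma continuous_seq_isort s : continuous_seq s -> continuous_seq (fun z => isort (s z)).
Proof.
elim=> {s} [|f s cf cs IH] /=; first exact: ContinuousNil.
exact: continuous_seq_insert.
Qed.

Lemma continuous_seq_scanl f s : continuous f -> continuous_seq s ->
  continuous_seq (fun z => scanl +%R (f z) (s z)).
Proof.
move=> cf cs; elim: cs f cf => {s} [|h s ch cs IH] f cf /=; first exact: ContinuousNil.
have cfh := continuousD cf ch.
by apply: ContinuousCons => //; exact: IH.
Qed.

Lemma continuous_seq_pairmap f s : continuous f -> continuous_seq s ->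
  continuous_seq (fun z => pairmap (fun x y => y - x) (f z) (s z)).
Proof.
move=> cf cs; elim: cs f cf => {s} [|h s ch cs IH] f cf /=; first exact: ContinuousNil.
by apply: ContinuousCons; [exact: continuousB|exact: IH].
Qed.

Lemma continuous_seq_interior s : continuous_seq s ->
  continuous_seq (fun z => interior (s z)).
Proof.
suff h t : continuous_seq t -> continuous_seq (fun z => behead (belast 0 (t z))).
  by move=> cs; apply: h; apply: continuous_seq_scanl cs; exact: continuous_const.
case=> {t} [|f t cf ct] /=; first exact: ContinuousNil.
elim: ct f cf => {t} [|h t ch ct IH] f cf /=; first exact: ContinuousNil.
by apply: ContinuousCons => //; exact: IH.
Qed.

Lemma continuous_seq_rcons f s : continuous f -> continuous_seq s ->
  continuous_seq (fun z => rcons (s z) (f z)).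
Proof.
move=> cf; elim=> {s} [|h s ch cs IH] /=.
  by apply: ContinuousCons => //; exact: ContinuousNil.
exact: ContinuousCons.
Qed.

Lemma continuous_seq_cat s t : continuous_seq s -> continuous_seq t ->
  continuous_seq (fun z => s z ++ t z).
Proof. by move=> + ct; elim=> {s} [|h s ch cs IH] //=; exact: ContinuousCons. Qed.

Lemma continuous_seq_flatten (k : T -> R -> seq R) s :
  (forall f, continuous f -> continuous_seq (fun z => k z (f z))) ->
  continuous_seq s -> continuous_seq (fun z => flatten [seq k z p | p <- s z]).
Proof.
move=> ck; elim=> {s} [|h s ch cs IH] /=; first exact: ContinuousNil.
by apply: continuous_seq_cat => //; exact: ck.
Qed.

Lemma continuous_seq_sub f s : continuous f -> continuous_seq s ->
  continuous_seq (fun z => [seq f z - x | x <- s z]).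
Proof.
move=> cf; elim=> {s} [|h s ch cs IH] /=; first exact: ContinuousNil.
by apply: ContinuousCons => //; exact: continuousB.
Qed.

Lemma continuous_seq_map (I : Type) (F : I -> T -> R) (c : seq I) :
  (forall i, continuous (F i)) -> continuous_seq (fun z => [seq F i z | i <- c]).
Proof.
move=> cF; elim: c => [|i c IH] /=; first exact: ContinuousNil.
exact: ContinuousCons.
Qed.

Lemma continuous_nth s i : continuous_seq s -> continuous (fun z => nth 0 (s z) i).
Proof.
move=> cs; elim: cs i => {s} [|h s ch cs IH] [|i] //=; exact: continuous_const.
Qed.

Lemma continuous_total s : continuous_seq s -> continuous (fun z => total (s z)).
Proof.
elim=> {s} [|h s ch cs IH].
  rewrite (_ : (fun z => _) = (fun=> 0)); first exact: continuous_const.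
  by apply/funext => z; rewrite /total big_nil.
rewrite (_ : (fun z => _) = (fun z => h z + total (s z))); first exact: continuousD.
by apply/funext => z; rewrite /total big_cons.
Qed.

Lemma continuous_row n (F : T -> 'I_n -> R) : (forall i, continuous (F^~ i)) ->
  continuous (fun z => \row_i F z i : 'rV[R]_n).
Proof.
move=> cF z A [P Pnbhs PA].
have : \forall w \near z, forall i, P ord0 i (F w i).
  apply: filter_forall => i; apply: cF.
  by have := Pnbhs ord0 i; rewrite mxE.
by apply: filterS => w Pw; apply: PA => i j; rewrite mxE ord1.
Qed.

Definition continuous_move (H : R -> R -> R -> seq R) : Prop :=
  forall f h k : T -> R, continuous f -> continuous h -> continuous k ->
    continuous_seq (fun z => H (f z) (h z) (k z)).

Lemma continuous_spread H f s : continuous_move H -> continuous f -> continuous_seq s ->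
  continuous_seq (fun z => spread (H (f z)) (s z)).
Proof.
move=> cH cf cs; have ct := continuous_total cs.
apply: continuous_seq_pairmap (@continuous_const 0) _.
apply: continuous_seq_rcons => //; apply: continuous_seq_isort.
apply: (continuous_seq_flatten (k := fun z p => mirror (H (f z)) (total (s z)) p)).
  move=> h ch; apply: continuous_seq_cat; first exact: cH.
  by apply: continuous_seq_sub => //; apply: cH => //; exact: continuousB.
exact: continuous_seq_interior.
Qed.

Lemma continuous_clamp f h : continuous f -> continuous h ->
  continuous (fun z => clamp (f z) (h z)).
Proof.
by move=> cf ch; apply: continuous_min => //; apply: continuous_max => //; exact: continuous_const.
Qed.

Lemma continuous_stretch f h : continuous f -> continuous h ->
  continuous (fun z => stretch (f z) (h z)).
Proof.
move=> cf ch; have c (a : R) := continuousM (@continuous_const a).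
by apply: continuous_max; [apply: continuousN|apply: continuousB]; apply: c.
Qed.

Lemma continuous_stage1 : continuous_move (@stage1 R).
Proof.
move=> f h k cf ch ck; have c1 := continuousB (@continuous_const 1) cf.
have cx := continuousD (continuousM c1 ck) (continuousM cf (continuous_stretch ch ck)).
apply: ContinuousCons; first exact: continuous_clamp.
apply: ContinuousCons; last exact: ContinuousNil.
by apply: continuous_clamp => //; exact: continuousD.
Qed.

Lemma continuous_stage2 : continuous_move (@stage2 R).
Proof.
move=> f h k cf ch ck; have c1 := continuousB (@continuous_const 1) cf.
have c (a : R) := continuousM (@continuous_const a).
apply: ContinuousCons.
  apply: continuousD => //; apply: continuousM => //; apply: continuous_min.
    exact: continuous_stretch.
  exact: continuous_const.
apply: ContinuousCons; last exact: ContinuousNil.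
apply: continuousD => //; apply: continuousM => //; apply: continuous_max.
  by apply: continuous_max; apply: continuousN => //; exact: c.
by apply: continuousB; apply: c.
Qed.

End ContinuousSeq.

Section GluedTopology.
Variables (R : realType) (K : set graph).
Local Open Scope classical_set_scope.
Local Notation D := (disjoint_simplices R K).
Local Notation X := (glued_space R K).

Lemma glued_pi_eq (p q : D) : glue p q -> glued_pi p = glued_pi q.
Proof. by move=> pq; apply/glued_piP/asboolP. Qed.

Lemma glue_repr (p : D) : glue (repr (glued_pi p)) p.
Proof. by apply/asboolP/glued_piP; exact: reprK. Qed.

Lemma glued_pi_continuous : continuous (@glued_pi R K).
Proof. exact: (@pi_continuous D). Qed.

Lemma glued_continuous (Z : topologicalType) (F : X -> Z) :
  continuous (F \o @glued_pi R K) -> continuous F.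
Proof. by move=> cF; apply/(@quotient_continuous D). Qed.

Lemma disjoint_continuous (Z : topologicalType) (F : D -> Z) :
  (forall G : K, continuous (fun x => F (existT (fun G : K => simplex R (sval G)) G x))) ->
  continuous F.
Proof.
move=> cF; apply/continuousP => A oA; apply/sigT_openP => G.
by have /continuousP/(_ A oA) := cF G.
Qed.

Lemma simplex_continuous (T : topologicalType) (G : graph) (F : T -> simplex R G) :
  continuous (fun z => set_val (F z)) -> continuous F.
Proof. exact: continuous_comp_initial. Qed.

Lemma continuous_entry n (i : 'I_n) : continuous (fun x : 'rV[R]_n => x ord0 i).
Proof.
move=> x A Ax; exists (fun k j => if j == i then A else setT).
  by move=> k j; rewrite (ord1 k); case: eqP => [->//|_]; exact: filterT.
by move=> y /(_ ord0 i); rewrite eqxx.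
Qed.

Lemma continuous_coord (G : graph) (e : 'I_(nedge G)) :
  continuous (fun x : simplex R G => (set_val x : 'rV[R]_(nedge G)) ord0 e).
Proof.
move=> x; apply: (@continuous_comp _ _ _ set_val (fun x : 'rV[R]_(nedge G) => x ord0 e)).
  exact: initial_continuous.
exact: continuous_entry.
Qed.

End GluedTopology.

Section GluedHomotopy.
Variables (R : realType) (K : set graph) (Z : topologicalType).
Local Open Scope classical_set_scope.
Local Notation D := (disjoint_simplices R K).
Local Notation X := (glued_space R K).
Import ArrowAsCompactOpen.

(* [R] being locally compact, homotopies are continuous maps to the space of
   paths, and those descend to the quotient. *)
Lemma glued_homotopy (F : D * R -> Z) :
  (forall G : K, continuous (fun z : simplex R (sval G) * R => F (existT _ G z.1, z.2))) ->
  (forall p q t, glue p q -> F (p, t) = F (q, t)) ->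
  continuous (fun z : X * R => F (repr z.1, z.2)).
Proof.
move=> cF gF.
have cD : continuous (fun (p : D) (t : R) => F (p, t)).
  apply: disjoint_continuous => G.
  by have [] := continuous_curry (cF G).
have cX : continuous (fun (x : X) (t : R) => F (repr x, t)).
  apply: glued_continuous; rewrite (_ : _ \o _ = (fun (p : D) (t : R) => F (p, t))) //.
  by apply/funext => p; apply/funext => t /=; apply: gF; exact: glue_repr.
rewrite (_ : (fun z => _) = uncurry (fun (x : X) (t : R) => F (repr x, t))); last first.
  by apply/funext => -[x t].
apply: continuous_uncurry_regular => //.
- exact: locally_compactR.
- exact: uniform_regular.
move=> x; have [G [y yx]] : exists G y, repr x = existT (fun G : K => simplex R (sval G)) G y.
  by case: (repr x) => G y; exists G, y.
rewrite yx; have [_ h] := continuous_curry (cF G); exact: h.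
Qed.

End GluedHomotopy.

Section Moves.
Variables (R : realType) (g : nat).
Local Open Scope classical_set_scope.
Local Notation K := (neq2_graphs g).
Local Notation D := (disjoint_simplices R K).
Local Notation X := (glued_space R K).

Section Stabilization.
Variable G : K.

Let stab_exists := cid (subdivision_graph_exists (set_mem (svalP G))).

Definition stab : graph := projT1 stab_exists.

Lemma stabP : stable_graphs g stab.
Proof. by have [] := projT2 stab_exists. Qed.

Let stab_map_exists := cid (proj2 (projT2 stab_exists)).

Definition stab_chain : 'I_(nedge stab) -> seq ('I_(nedge (sval G)) * bool) :=
  projT1 (cid (projT2 stab_map_exists)).

Lemma stab_sub : exists f, subdivision stab (sval G) (stable_vertex (sval G)) f stab_chain /\
  forall v, weight (sval G) (f v) = weight stab v.
Proof. by exists (projT1 stab_map_exists); exact: projT2 (cid (projT2 stab_map_exists)). Qed.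

Definition stab_lengths (x : 'rV[R]_(nedge (sval G))) (b : 'I_(nedge stab)) : seq R :=
  [seq x ord0 d.1 | d <- stab_chain b].

(** A chain of [k] edges has [k - 1] marks, each replaced by two points and their counterparts under
    reflection. *)
Definition move_count (b : 'I_(nedge stab)) : nat := (4 * (size (stab_chain b)).-1)%N.

End Stabilization.

Lemma presents_stab (p : D) :
  presents p (stab (projT1 p)) (stab_lengths (set_val (projT2 p))).
Proof. by have [f [sub w]] := stab_sub (projT1 p); exists f, (@stab_chain (projT1 p)). Qed.

Section Move.
Variable H : R -> R -> R -> seq R.
Hypothesis admH : forall u, 0 <= u <= 1 -> admissible (H u).
Hypothesis sizeH : forall u L p, size (H u L p) = 2.
Hypothesis contH : forall T : topologicalType, @continuous_move R T H.

(** Clamping the time to the unit interval makes the move meaningful and continuous on all of [R],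
    the parameter space of [glued_homotopy]. *)
Definition move_lengths (G : K) (x : 'rV[R]_(nedge (sval G))) (t : R) b : seq R :=
  spread (H (clamp 1 t)) (stab_lengths x b).

Lemma clamp01 (t : R) : 0 <= clamp 1 t <= 1.
Proof. by apply: clamp_range. Qed.

Lemma size_move_lengths (G : K) (x : 'rV[R]_(nedge (sval G))) t b :
  size (move_lengths x t b) = (move_count b).+1.
Proof.
rewrite size_pairmap size_rcons (perm_size (perm_isort _)) size_flatten /shape -map_comp.
rewrite (eq_map (g := fun=> 4%N)); last by move=> p /=; rewrite size_cat size_map !sizeH.
rewrite sumnE big_map big_const_seq count_predT iter_addn_0.
by rewrite /interior size_behead size_belast size_scanl size_map.
Qed.

Lemma lengths_move (p : D) t : lengths (move_lengths (set_val (projT2 p)) t).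
Proof.
apply: lengths_spread; first exact/admH/clamp01.
exact: presents_lengths (presents_stab p).
Qed.

Definition move_point (p : D) (t : R) : D :=
  sub_point (stabP (projT1 p)) (lengths_move p t) (size_move_lengths _ t).

Lemma presents_move_point (p : D) t :
  presents (move_point p t) (stab (projT1 p)) (move_lengths (set_val (projT2 p)) t).
Proof. exact: presents_sub_point. Qed.

Lemma move_point_glue (p q : D) t : glue p q ->
  glued_pi (move_point p t) = glued_pi (move_point q t).
Proof.
apply: (@glue_map R K _ (fun p => glued_pi (move_point p t))) => {p q} p q pq.
apply: glued_pi_eq.
have adm := admH (clamp01 t).
case: pq => pq.
  exact: (spread_presents_unique adm (stabP _) (stabP _)
    (iso_glue_presents pq (presents_stab p)) (presents_stab q)
    (presents_move_point p t) (presents_move_point q t)).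
exact: (spread_presents_face adm (stabP _) (stabP _) pq (presents_stab p) (presents_stab q)
  (presents_move_point p t) (presents_move_point q t)).
Qed.

(** Chains of one edge carry no marks, so [spread] leaves them unchanged. The presentation chosen by
    [stab] may be a different one, hence the appeal to uniqueness. *)
Lemma move_point_fixed (p : D) B (s : 'I_(nedge B) -> R) t :
  stable_graphs g B -> presents p B (fun b => [:: s b]) ->
  glued_pi (move_point p t) = glued_pi p.
Proof.
move=> stB ps; apply: glued_pi_eq.
apply: (spread_presents_unique (admH (clamp01 t)) (stabP _) stB (presents_stab p) ps
  (presents_move_point p t)).
rewrite (_ : (fun b => _) = (fun b => [:: s b])) //.
by apply/funext => b; rewrite spread1.
Qed.

Lemma move_continuous :
  continuous (fun z : X * R => glued_pi (move_point (repr z.1) z.2)).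
Proof.
apply: (glued_homotopy (F := fun z : D * R => glued_pi (move_point z.1 z.2))) => [G|p q t]; last first.
  exact: move_point_glue.
pose T := (simplex R (sval G) * R)%type.
pose p0 (z : T) : D := existT _ G z.1.
(* For fixed [G] all moved points lie in the simplex of the subdivision given by [move_count], so
   only their coordinates have to be continuous. *)
pose F (z : T) : simplex R (sub_graph (@move_count G)) :=
  exist (fun v => v \in simplex R _) _
    (mem_set (sub_coord_simplex (lengths_move (p0 z) z.2) (size_move_lengths _ z.2))).
have cF : continuous F.
  apply: simplex_continuous; apply: continuous_row => e.
  pose b := tag (enum_val e : {b & 'I_(move_count b).+1}).
  refine (@continuous_nth R _ (fun z : T => move_lengths (set_val z.1) z.2 b)
    (tagged (enum_val e : {b & 'I_(move_count b).+1})) _).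
  apply: (@continuous_spread _ _ H (fun z : T => clamp 1 z.2)
    (fun z : T => [seq (set_val z.1 : 'rV[R]_(nedge (sval G))) ord0 d.1 | d <- stab_chain b])).
  - exact: contH.
  - by apply: continuous_clamp; [exact: continuous_const|move=> z; exact: cvg_snd].
  apply: (@continuous_seq_map R T _ (fun (d : 'I_(nedge (sval G)) * bool) (z : T) =>
    (set_val z.1 : 'rV[R]_(nedge (sval G))) ord0 d.1)) => d z.
  apply: (@continuous_comp _ _ _ fst (fun x : simplex R (sval G) =>
    (set_val x : 'rV[R]_(nedge (sval G))) ord0 d.1)); first exact: cvg_fst.
  exact: continuous_coord.
pose G' : K := exist (fun G => G \in K) _ (mem_set (sub_graph_neq2 (@move_count G) (stabP G))).
move=> z; apply: (@continuous_comp _ _ _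
  (fun z => existT (fun G : K => simplex R (sval G)) G' (F z)) (@glued_pi R K));
  last exact: glued_pi_continuous.
apply: (@continuous_comp _ _ _ F (existT (fun G : K => simplex R (sval G)) G')); first exact: cF.
exact: existT_continuous.
Qed.

End Move.
End Moves.

(** * The retraction onto the moduli space of stable graphs *)

Section Retraction.
Variables (R : realType) (g : nat).
Local Open Scope classical_set_scope.
Local Notation K := (neq2_graphs g).
Local Notation S := (stable_graphs g).
Local Notation D := (disjoint_simplices R K).
Local Notation DS := (disjoint_simplices R S).
Local Notation X := (glued_space R K).
Local Notation XS := (glued_space R S).
Let neq2P : K `<=` neq2_graphs g := fun _ h => h.

Lemma total_simplex (B : graph) (s : 'I_(nedge B) -> seq R) : lengths s ->
  simplex R B (\row_b total (s b)).
Proof. by case=> s0 _ s1; apply: simplex_row => // b; exact: total_ge0. Qed.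

Definition total_point (B : graph) (stB : S B) (s : 'I_(nedge B) -> seq R)
  (sP : lengths s) : DS := mk_point stB (total_simplex sP).

Lemma coord_total_point (B : graph) (stB : S B) s (sP : lengths s) b :
  coord R S (total_point stB sP) b = total (s b).
Proof. exact: coord_mk_point. Qed.

Lemma total_point_unique (p : D) (B B' : graph) (stB : S B) (stB' : S B') s s'
    (sP : lengths s) (sP' : lengths s') :
  presents p B s -> presents p B' s' -> glue (total_point stB sP) (total_point stB' sP').
Proof.
move=> ps ps'; have [fV [fE [r [iso sE]]]] := presents_unique neq2P ps ps'.
apply/asboolP; apply: rst_step; left; exists fV, fE; split.
  exact: oriented_isomorphism iso.
move=> b; rewrite [LHS]coord_total_point [RHS]coord_total_point sE.
by case: (r b); rewrite ?total_rev.
Qed.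

(** Omitting zeros does not change the total of a chain, and a chain omitted entirely has total 0.
    What remains is a face identification between stable graphs. *)
Lemma total_point_face (p q : D) (B B' : graph) (stB : S B) (stB' : S B') s s'
    (sP : lengths s) (sP' : lengths s') :
  face_glue p q -> presents p B s -> presents q B' s' ->
  glue (total_point stB sP) (total_point stB' sP').
Proof.
move=> pq ps qs'; have [s0 sN _] := sP.
have [gB [s'' [gBp gB0 stB'' qs'' sE]]] := face_glue_presents stB pq ps.
have sP'' := presents_lengths qs''; have [s0'' _ _] := sP''.
apply: glue_trans (total_point_unique stB'' stB' sP'' sP' qs'' qs').
have [gV [gE [_ _ _ hEK iso]]] := oriented_iso_inv (ord_graph_iso (contract B gB)).
apply/asboolP; apply: rst_step; right; exists gB; split=> //.
  by move=> b bg; rewrite [LHS]coord_total_point; apply/eqP; rewrite total_eq0 // gB0.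
exists gV, gE; split; first exact: oriented_isomorphism iso.
move=> b; rewrite [LHS]coord_total_point [RHS]coord_total_point -{1}[b]hEK.
by apply: eq_breaks_total => //; exact: sE.
Qed.

Definition retract_point (p : D) : DS :=
  total_point (stabP (projT1 p)) (presents_lengths (presents_stab p)).

Lemma retract_point_glue (p q : D) : glue p q ->
  glued_pi (retract_point p) = glued_pi (retract_point q).
Proof.
apply: (@glue_map R K _ (fun p => glued_pi (retract_point p))) => {p q} p q [pq|pq].
  apply: glued_pi_eq; apply: (total_point_unique _ _ _ _ (iso_glue_presents pq (presents_stab p))).
  exact: presents_stab.
exact/glued_pi_eq/(total_point_face _ _ _ _ pq (presents_stab p) (presents_stab q)).
Qed.

Definition retract (x : X) : XS := glued_pi (retract_point (repr x)).

Lemma retract_pi (p : D) : retract (glued_pi p) = glued_pi (retract_point p).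
Proof. exact/retract_point_glue/glue_repr. Qed.

Lemma retract_continuous : continuous retract.
Proof.
apply: glued_continuous.
rewrite (_ : _ \o _ = (fun p => glued_pi (retract_point p))); last first.
  by apply/funext => p; exact: retract_pi.
apply: disjoint_continuous => G.
pose F (x : simplex R (sval G)) : simplex R (stab G) :=
  exist (fun v => v \in simplex R (stab G)) _
    (mem_set (total_simplex (presents_lengths
      (presents_stab (existT (fun G : K => simplex R (sval G)) G x))))).
have cF : continuous F.
  apply: simplex_continuous; apply: continuous_row => b.
  apply: (@continuous_total R _ (fun x : simplex R (sval G) => stab_lengths (set_val x) b)).
  apply: (@continuous_seq_map R _ _ (fun (d : 'I_(nedge (sval G)) * bool) (x : simplex R (sval G)) =>
    (set_val x : 'rV[R]_(nedge (sval G))) ord0 d.1)) => d.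
  exact: continuous_coord.
pose G' : S := exist (fun G => G \in S) _ (mem_set (stabP G)).
move=> x; apply: (@continuous_comp _ _ _
  (fun x => existT (fun G : S => simplex R (sval G)) G' (F x)) (@glued_pi R S));
  last exact: glued_pi_continuous.
apply: (@continuous_comp _ _ _ F (existT (fun G : S => simplex R (sval G)) G')); first exact: cF.
exact: existT_continuous.
Qed.

Definition edge_lengths (q : DS) (e : 'I_(nedge (dgraph q))) : seq R := [:: coord R S q e].

Lemma presents_widen (q : DS) :
  presents (widen_point (stable_neq2 (g := g)) q) (dgraph q) (@edge_lengths q).
Proof.
have [_ _ _ st] := dgraph_in q.
exists id, (fun e => [:: (e, false)]); split=> //; split=> //.
- by move=> u _; exists u.
- by move=> b; rewrite /= !eqxx.
move=> e; rewrite (bigD1 e) //= eqxx big1 // => a /negbTE ae.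
by rewrite /= ae.
Qed.

Lemma incl_retract_point (p : D) :
  presents (widen_point (stable_neq2 (g := g)) (retract_point p)) (stab (projT1 p))
    (fun b => [:: total (stab_lengths (set_val (projT2 p)) b)]).
Proof.
suff <- : @edge_lengths (retract_point p) = (fun b : 'I_(nedge (stab (projT1 p))) =>
    [:: total (stab_lengths (set_val (projT2 p)) b)]) by exact: presents_widen.
by apply/funext => b; rewrite /edge_lengths coord_total_point.
Qed.

Lemma retract_incl (y : XS) : retract (MG_incl R g y) = y.
Proof.
rewrite -[y]reprK; set q := repr y; rewrite [X in retract X]glued_inclE retract_pi.
apply: glued_pi_eq.
have qP := presents_lengths (presents_widen q).
apply: glue_trans (total_point_unique _ (dgraph_in q) _ qP (presents_stab _) (presents_widen q)) _.
apply/asboolP; apply: rst_step; left; exists id, id; split.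
  by split=> //; exists id.
by move=> e; rewrite [LHS]coord_total_point /total big_seq1.
Qed.

End Retraction.

(** * The embedding and the two-stage deformation *)

Section Deformation.
Variables (R : realType) (g : nat).
Local Open Scope classical_set_scope.
Local Notation K := (neq2_graphs g).
Local Notation D := (disjoint_simplices R K).
Local Notation X := (glued_space R K).

Lemma MG_incl_continuous : continuous (MG_incl R g).
Proof.
apply: glued_continuous.
rewrite (_ : _ \o _ = (fun q => glued_pi (widen_point (stable_neq2 (g := g)) q))); last first.
  by apply/funext => q; exact: glued_inclE.
apply: disjoint_continuous => G x.
apply: (@continuous_comp _ _ _
  (existT (fun G : K => simplex R (sval G)) (widen_graph (stable_neq2 (g := g)) G))
  (@glued_pi R K)); last exact: glued_pi_continuous.
exact: existT_continuous.
Qed.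

(** A continuous map with a continuous left inverse is an embedding: the preimage of [U] under
    [retract] is the required open set. *)
Lemma MG_incl_embedding : embedding (MG_incl R g).
Proof.
split; first exact: MG_incl_continuous.
  exact: can_inj (@retract_incl R g).
move=> U oU; exists (@retract R g @^-1` U).
  by have /continuousP/(_ U oU) := @retract_continuous R g.
by apply/seteqP; split=> y /=; rewrite retract_incl.
Qed.

Let adm2 u : 0 <= u <= 1 -> admissible (@stage2 R u) := @stage2_admissible R u.
Let adm1 u : 0 <= u <= 1 -> admissible (@stage1 R u) := fun _ => stage1_admissible u.
Let size1 (u L p : R) : size (stage1 u L p) = 2 := erefl.
Let size2 (u L p : R) : size (stage2 u L p) = 2 := erefl.

Definition move1 (z : X * R) : X := glued_pi (move_point adm1 size1 (repr z.1) z.2).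
Definition move2 (z : X * R) : X := glued_pi (move_point adm2 size2 (repr z.1) z.2).

Lemma move1_continuous : continuous move1.
Proof. by apply: move_continuous => T; exact: continuous_stage1. Qed.

Lemma move2_continuous : continuous move2.
Proof. by apply: move_continuous => T; exact: continuous_stage2. Qed.

Lemma clamp_0 : clamp 1 0 = 0 :> R.
Proof. by rewrite clamp_id // lexx ler01. Qed.

Lemma clamp_1 : clamp 1 1 = 1 :> R.
Proof. by rewrite clamp_id // ler01 lexx. Qed.

Lemma move1_start x : move1 (x, 0) = x.
Proof.
rewrite -[RHS]reprK; apply: glued_pi_eq => /=.
have ps := presents_stab (repr x); have [s0 sN _] := presents_lengths ps.
apply: (eq_breaks_glue (stabP _) (presents_move_point _ _ _ _) ps) => b y.
by rewrite /move_lengths clamp_0 spread_start.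
Qed.

Lemma move12 x : move1 (x, 1) = move2 (x, 0).
Proof.
apply: glued_pi_eq => /=.
have ps := presents_stab (repr x); have [s0 sN _] := presents_lengths ps.
apply: (eq_breaks_glue (stabP _) (presents_move_point _ _ _ _) (presents_move_point _ _ _ _)) => b y.
by rewrite /move_lengths clamp_0 clamp_1 spread_middle.
Qed.

(** At the end of the second stage every moved mark is at an end of its edge, and one edge of
    unchanged total length remains of each chain. *)
Lemma move2_end x : move2 (x, 1) = MG_incl R g (retract x).
Proof.
rewrite /retract [RHS]glued_inclE; apply: glued_pi_eq => /=.
have ps := presents_stab (repr x); have [s0 sN _] := presents_lengths ps.
apply: (eq_breaks_glue (stabP _) (presents_move_point _ _ _ _) (incl_retract_point _)) => b y.
by rewrite /move_lengths clamp_1 spread_end.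
Qed.

Lemma move_incl (H : R -> R -> R -> seq R) admH sizeH (y : MG R g) t :
  glued_pi (@move_point R g H admH sizeH (repr (MG_incl R g y)) t) = MG_incl R g y.
Proof.
rewrite -[y]reprK; set q := repr y.
have -> : MG_incl R g (\pi_(glued_space R (stable_graphs g)) q)%qT
    = glued_pi (widen_point (stable_neq2 (g := g)) q) by exact: glued_inclE.
rewrite (move_point_glue admH sizeH t (glue_repr _)).
exact: (move_point_fixed admH sizeH t (dgraph_in q) (presents_widen q)).
Qed.

Definition deformation (z : X * R) : X :=
  if z.2 <= 2^-1 then move1 (z.1, 2 * z.2) else move2 (z.1, 2 * z.2 - 1).

Lemma pair_continuous (h : X * R -> R) : continuous h ->
  continuous (fun z => (z.1, h z)).
Proof.
move=> ch z.
by apply: (@cvg_pair _ _ _ (nbhs z) (nbhs z.1) (nbhs (h z)) _ _ _ fst h); [exact: cvg_fst|exact: ch].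
Qed.

Lemma deformation_continuous : {within [set: X * R], continuous deformation}.
Proof.
have csnd : continuous (fun z : X * R => z.2) by move=> z; exact: cvg_snd.
have c1 : continuous (fun z : X * R => move1 (z.1, 2 * z.2)).
  move=> z; apply: (@continuous_comp _ _ _ (fun z : X * R => (z.1, 2 * z.2)) move1).
    by apply: pair_continuous; apply: continuousM => // y; exact: cvg_cst.
  exact: move1_continuous.
have c2 : continuous (fun z : X * R => move2 (z.1, 2 * z.2 - 1)).
  move=> z; apply: (@continuous_comp _ _ _ (fun z : X * R => (z.1, 2 * z.2 - 1)) move2).
    apply: pair_continuous; apply: continuousB => [|y]; last exact: cvg_cst.
    by apply: continuousM => // y; exact: cvg_cst.
  exact: move2_continuous.
pose A := [set z : X * R | z.2 <= 2^-1]; pose B := [set z : X * R | 2^-1 <= z.2].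
have -> : [set: X * R] = A `|` B.
  by apply/seteqP; split=> // z _; have [h|/ltW h] := leP z.2 2^-1; [left|right].
apply: withinU_continuous.
- have /continuous_closedP h := csnd; by apply: (h [set t : R | t <= 2^-1]); exact: closed_le.
- have /continuous_closedP h := csnd; by apply: (h [set t : R | 2^-1 <= t]); exact: closed_ge.
- apply: (@subspace_eq_continuous _ A _ (fun z => move1 (z.1, 2 * z.2)) deformation).
    by move=> z; rewrite inE /A /= /deformation => ->.
  exact: continuous_subspaceT.
- apply: (@subspace_eq_continuous _ B _ (fun z => move2 (z.1, 2 * z.2 - 1)) deformation).
    (* On [B] the formula of the second half differs from the definition at most at time [2^-1],
       where the two stages agree by [move12]. *)
    move=> [x t]; rewrite inE /B /= /deformation /= => ht.
    case: (leP t 2^-1) => // ht'.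
    have -> : t = 2^-1 by apply/le_anti/andP.
    by rewrite divff ?pnatr_eq0 // subrr move12.
  exact: continuous_subspaceT.
Qed.

Lemma MG_deformation_retract : deformation_retract R (range (MG_incl R g)).
Proof.
exists deformation; split.
- by apply: continuous_subspaceW deformation_continuous.
- by move=> x; rewrite /deformation /= invr_ge0 ler0n mulr0 move1_start.
- move=> x; rewrite /deformation /= [1 <= _]lt_geF ?invf_lt1 ?ltr1n //.
  have -> : 2 * 1 - 1 = 1 :> R by ring.
  by rewrite move2_end; exists (retract x).
- move=> _ t [y _ <-] _; rewrite /deformation.
  by case: ifP => _; exact: move_incl.
Qed.

End Deformation.

Theorem proposition5p12 (R : realType) (g : nat) (hg : (2 <= g)%N) :
  embedding (MG_incl R g) /\
  deformation_retract R (range (MG_incl R g)).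
Proof. by split; [exact: MG_incl_embedding|exact: MG_deformation_retract]. Qed.
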